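(* Let $\Omega\subset\mathbb{R}^N$ ($N\ge 2$) be a bounded smooth domain, let $1<p<\infty$, and let $(g_0,V_0)$ be an admissible pair of measurable functions on $\Omega$. Let $I=\inf\{\lambda(g,V)\colon g\in\mathcal{R}(g_0),\ V\in\mathcal{R}(V_0)\}$, and let $g^*\in\mathcal{R}(g_0)$ and $V_*\in\mathcal{R}(V_0)$ be such that $\lambda(g^*,V_* )=I$. Then there exist an increasing function $\phi$ and a decreasing function $\psi$ such that $$g^*=\phi(u_* )\quad\text{a.e. in }\Omega,\qquad V_*=\psi(u_* )\quad\text{a.e. in }\Omega,$$ where $u_*$ is the positive eigenfunction associated to $\lambda(g^*,V_* )$.
   Context: Exponents: $q>N/p$ if $1<p\le N$, and $q=1$ if $p>N$; $q'$ is the conjugate exponent of $q$ ($q'=\infty$ if $q=1$). Notation: $f^-=\min\{f,0\}$, $f^+=\max\{f,0\}$, and for $r=p$ or $r=pq'$, $$S_r=\inf\Big\{\int_\Omega|\nabla u|^p\,dx\colon u\in W^{1,p}_0(\Omega),\ \|u\|_{L^r(\Omega)}=1\Big\}.$$ A pair $(g,V)$ of measurable functions on $\Omega$ is called admissible if: (i) $g,V\in L^q(\Omega)$; (ii) either $\|V^-\|_{L^q(\Omega)}<S_{pq'}$, or $V\ge -S_p+\delta$ for some $\delta>0$; (iii) $g^+\not\equiv 0$. For an admissible pair, $\lambda(g,V)$ denotes the unique positive principal eigenvalue of $-\Delta_p u+V|u|^{p-2}u=\lambda g|u|^{p-2}u$ in $\Omega$, $u=0$ on $\partial\Omega$, where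 $\Delta_p u=\operatorname{div}(|\nabla u|^{p-2}\nabla u)$; it is characterized by $$\lambda(g,V)=\min\Big\{\int_\Omega |\nabla u|^p+V|u|^p\,dx\colon u\in W^{1,p}_0(\Omega),\ \int_\Omega g|u|^p\,dx=1\Big\}.$$ The eigenvalue $\lambda(g,V)$ is simple, and its eigenfunctions have constant sign and do not vanish in $\Omega$; ''the positive eigenfunction'' $u$ is the one with $u>0$ in $\Omega$, normalized by $\int_\Omega g u^p\,dx=1$. A measurable $f:\Omega\to\mathbb{R}$ is a rearrangement of a measurable $h:\Omega\to\mathbb{R}$ if $|\{x\in\Omega\colon f(x)\ge\alpha\}|=|\{x\in\Omega\colon h(x)\ge\alpha\}|$ for all $\alpha\in\mathbb{R}$, where $|\cdot|$ is Lebesgue measure; $\mathcal{R}(h)$ is the set of all rearrangements of $h$. If $g\in\mathcal{R}(g_0)$ and $V\in\mathcal{R}(V_0)$ with $(g_0,V_0)$ admissible, then $(g,V)$ is admissible. A pair $(g^*,V_* )\in\mathcal{R}(g_0)\times\mathcal{R}(V_0)$ with $\lambda(g^*,V_* )=I$ exists. *)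

(* Defs.v *)
From HB Require Import structures.
From mathcomp Require Import all_boot all_order all_algebra.
From mathcomp Require Import all_classical all_reals all_analysis.

Set Implicit Arguments.
Unset Strict Implicit.
Unset Printing Implicit Defensive.

Import Order.TTheory GRing.Theory Num.Theory.
Import numFieldNormedType.Exports.

Local Open Scope classical_set_scope.
Local Open Scope ring_scope.

(* Lebesgue measure on R^N: the outer measure generated by the volume of
   half-open boxes, restricted to its Caratheodory (= Lebesgue) measurable
   sets. *)

Section lebesgue_outer.
Context (R : realType) (N : nat).
Implicit Types (a b : 'rV[R]_N) (X : set 'rV[R]_N).

Definition box a b : set 'rV[R]_N :=
  [set x | forall i, a ord0 i < x ord0 i <= b ord0 i].

Definition box_volume a b : R :=
  \prod_(i < N) Num.max 0 (b ord0 i - a ord0 i).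

(* [None] is an unused slot, so that finite families are covered too. *)
Definition obox (o : option ('rV[R]_N * 'rV[R]_N)) : set 'rV[R]_N :=
  if o is Some ab then box ab.1 ab.2 else set0.

Definition obox_volume (o : option ('rV[R]_N * 'rV[R]_N)) : \bar R :=
  (if o is Some ab then box_volume ab.1 ab.2 else 0)%:E.

Definition box_cover X : set (nat -> option ('rV[R]_N * 'rV[R]_N)) :=
  [set c | X `<=` \bigcup_k obox (c k)].

Definition lebesgue_outer X : \bar R :=
  ereal_inf [set (\sum_(k <oo) obox_volume (c k))%E | c in box_cover X].

Lemma obox_volume_ge0 o : (0 <= obox_volume o)%E.
Proof.
case: o => [ab|] /=; rewrite lee_fin //.
by apply: prodr_ge0 => i _; rewrite le_max lexx.
Qed.

Lemma lebesgue_outer_ge0 X : (0 <= lebesgue_outer X)%E.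
Proof.
apply: le_ereal_inf_tmp => _ [c _ <-]; apply: nneseries_ge0 => n _ _.
exact: obox_volume_ge0.
Qed.

Lemma lebesgue_outer0 : lebesgue_outer set0 = 0%E.
Proof.
apply/eqP; rewrite eq_le lebesgue_outer_ge0 andbT.
apply: ereal_inf_lbound; exists (fun=> None) => //.
by rewrite eseries0.
Qed.

Lemma le_lebesgue_outer : {homo lebesgue_outer : A B / A `<=` B >-> (A <= B)%E}.
Proof.
move=> A B AB; apply: ereal_inf_le_tmp => _ [c Bc <-].
by exists c => //; exact: subset_trans Bc.
Qed.

Lemma lebesgue_outer_sigma_subadditive : sigma_subadditive lebesgue_outer.
Proof.
move=> A; have [[i ioo]|] := pselect (exists i, lebesgue_outer (A i) = +oo%E).
  rewrite (eseries_pinfty _ _ ioo) ?leey// => n _.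
  by rewrite -ltNye (lt_le_trans _ (lebesgue_outer_ge0 _)).
rewrite -forallNE => Aoo.
suff add2e (e : {posnum R}) : (lebesgue_outer (\bigcup_n A n) <=
    \sum_(i <oo) lebesgue_outer (A i) + e%:num%:E)%E.
  by apply/lee_addgt0Pr => _/posnumP[].
apply: (@le_trans _ _ _ _ _ _ (epsilon_trick _ _ _)) => //; last first.
  by move=> n; exact: lebesgue_outer_ge0.
pose P n c := box_cover (A n) c /\ (\sum_(k <oo) obox_volume (c k) <=
  lebesgue_outer (A n) + (e%:num / (2 ^ n.+1)%:R)%:E)%E.
have [G PG] : {G & forall n, P n (G n)}.
  apply: (@choice _ _ P) => n; rewrite /P.
  have fA : lebesgue_outer (A n) \is a fin_num.
    rewrite ge0_fin_numE ?lebesgue_outer_ge0// ltey; exact/eqP/Aoo.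
  have en1 : (0 < e%:num / (2 ^ n.+1)%:R)%R by [].
  have [x [c Ac <-] cx] := lb_ereal_inf_adherent en1 fA.
  by exists c; split => //; exact: ltW.
have /card_esym/ppcard_eqP[f] := card_nat2.
pose V i := obox_volume (uncurry G i).
have V0 i : (0 <= V i)%E by exact: obox_volume_ge0.
apply: (@le_trans _ _ (\esum_(i in setT) V i)).
  apply: ereal_inf_lbound; exists (uncurry G \o f).
    move=> t [n _ Ant]; have [k _ Gt] := (PG n).1 _ Ant.
    by exists (f^-1%FUN (n, k)) => //=; rewrite invK ?inE.
  rewrite -(esum_pred_image V _ xpredT) ?[fun=> _]set_true//.
  by rewrite image_eq.
rewrite (_ : esum _ _ =
    (\sum_(i <oo) \sum_(j <oo) obox_volume (G i j))%E); last first.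
  pose J : nat -> set (nat * nat) := fun i => [set (i, j) | j in setT].
  rewrite (_ : setT = \bigcup_k J k); last first.
    by rewrite predeqE => -[a b]; split => // _; exists a => //; exists b.
  rewrite esum_bigcupT //=; last first.
    apply/trivIsetP => i j _ _ ij.
    rewrite predeqE => -[n m] /=; split => //= -[] [_] _ [<-{n} _].
    by move=> [m' _] [] /esym/eqP; rewrite (negbTE ij).
  rewrite -(image_id [set: nat]) -fun_true esum_pred_image//; last first.
    by move=> n _; exact: esum_ge0.
  apply: eq_eseriesr => /= j _.
  rewrite -(esum_pred_image V (pair j) predT)//=; last first.
    by move=> ? ? _ _; exact: (@can_inj _ _ _ snd).
  by congr esum; rewrite predeqE => -[a b]; split; move=> [i _ <-]; exists i.
apply: lee_nneseries => [n _ _|n _]; last exact: (PG n).2.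
by apply: nneseries_ge0 => k _ _; exact: obox_volume_ge0.
Qed.

HB.instance Definition _ := isOuterMeasure.Build R 'rV[R]_N lebesgue_outer
  lebesgue_outer0 lebesgue_outer_ge0 le_lebesgue_outer
  lebesgue_outer_sigma_subadditive.

End lebesgue_outer.

(* ['rV[R]_N] with the sigma-algebra of Lebesgue measurable sets. *)
Notation RN R N := (caratheodory_type (@lebesgue_outer R N)).

Definition leb (R : realType) (N : nat) : {measure set (RN R N) -> \bar R} :=
  let mu : {outer_measure set 'rV[R]_N -> \bar R} := @lebesgue_outer R N in
  [the {measure set (caratheodory_type mu) -> \bar R} of
    (mu : set (caratheodory_type mu) -> \bar R)].

Section smoothness.
Context (R : realType).

Definition partial N (i : 'I_N) (f : 'rV[R]_N -> R) : 'rV[R]_N -> R :=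
  fun x => 'D_(delta_mx ord0 i) f x.

Definition gradient N (f : 'rV[R]_N -> R) (x : 'rV[R]_N) : 'rV[R]_N :=
  \row_i partial i f x.

Fixpoint Ck N (k : nat) (f : 'rV[R]_N -> R) : Prop :=
  if k is k'.+1 then
    (forall x, differentiable f x) /\ (forall i, Ck k' (partial i f))
  else continuous f.

Definition smooth N (f : 'rV[R]_N -> R) : Prop := forall k, Ck k f.

(* Near each boundary point, [Omega] is, up to the choice and orientation of a
   coordinate axis, the region on one side of the graph of a smooth function of
   the remaining coordinates. *)
Definition smooth_boundary N (Omega : set 'rV[R]_N) : Prop :=
  forall x0, (closure Omega `\` interior Omega) x0 ->
  exists (i : 'I_N) (s : bool) (gamma : 'rV[R]_N.-1 -> R) (r : R),
    [/\ smooth gamma, 0 < r &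
        forall x, ball x0 r x ->
          (Omega x <-> gamma (col' i x) < (-1) ^+ s * x ord0 i)].

Definition smooth_bounded_domain N (Omega : set 'rV[R]_N) : Prop :=
  [/\ open Omega, connected Omega, Omega !=set0, bounded_set Omega &
      smooth_boundary Omega].

End smoothness.

Section problem.
Context (R : realType) (N : nat).
Variable Omega : set (RN R N).

Local Notation mu := (@leb R N).
Implicit Types (f h g V u v : RN R N -> R) (G H : RN R N -> 'rV[R]_N).

Definition dotp (x y : 'rV[R]_N) : R := \sum_i x ord0 i * y ord0 i.

(* The library norm [`|x|] on row vectors is the sup norm. *)
Definition enorm (x : 'rV[R]_N) : R := Num.sqrt (dotp x x).

Definition normL (r : \bar R) f : \bar R := Lnorm mu r (EFin \o (f \_ Omega)).

Definition inL (r : \bar R) f : Prop :=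
  measurable_fun Omega f /\ (normL r f < +oo)%E.

Definition C1c (phi : 'rV[R]_N -> R) : Prop :=
  Ck 1 phi /\
  exists K : set 'rV[R]_N,
    [/\ compact K, K `<=` Omega & forall x, ~ K x -> phi x = 0].

(* [W0 p u G]: [u] belongs to W^{1,p}_0(Omega), the closure in W^{1,p}(Omega) of
   the C^1 functions with compact support in Omega, and [G] is its gradient.
   The gradient operator being closed in L^p, the L^p limit [G] of the
   gradients is the weak gradient of [u], hence determined by [u] up to a null
   set. *)
Definition W0 (p : R) u G : Prop :=
  [/\ measurable_fun Omega u,
      forall i, measurable_fun Omega (fun x => G x ord0 i) &
      exists phi : nat -> 'rV[R]_N -> R,
        [/\ forall n, C1c (phi n),
            (\int[mu]_(x in Omega) (`|phi n x - u x| `^ p)%:E)%E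
              @[n --> \oo] --> 0%E &
            (\int[mu]_(x in Omega)
               (enorm (gradient (phi n) x - G x) `^ p)%:E)%E
              @[n --> \oo] --> 0%E]].

Definition dirichlet (p : R) G : \bar R :=
  (\int[mu]_(x in Omega) (enorm (G x) `^ p)%:E)%E.

Definition sobolev_const (p : R) (r : \bar R) : \bar R :=
  ereal_inf [set t | exists u G,
    [/\ W0 p u G, normL r u = 1%E & t = dirichlet p G]].

Definition exponent_cond (p q : R) : Prop :=
  (p <= N%:R -> N%:R / p < q) /\ (N%:R < p -> q = 1).

Definition conj_exponent (q : R) : \bar R :=
  if q == 1 then +oo%E else (q / (q - 1))%:E.

Definition negpart f : RN R N -> R := fun x => Num.min (f x) 0.
Definition pospart f : RN R N -> R := fun x => Num.max (f x) 0.

Definition admissible (p q : R) g V : Prop :=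
  [/\ inL q%:E g, inL q%:E V,
      (normL q%:E (negpart V) < sobolev_const p (p%:E * conj_exponent q))%E \/
      (exists2 delta : R, 0 < delta &
        {ae mu, forall x, Omega x ->
          (- sobolev_const p p%:E + delta%:E <= (V x)%:E)%E}) &
      ~ {ae mu, forall x, Omega x -> pospart g x = 0}].

(* [u], with gradient [G], is a weak solution of
     - Delta_p u + V |u|^{p-2} u = l g |u|^{p-2} u in Omega,
     u = 0 on the boundary of Omega.
   The zeroth-order terms are required to be integrable because [Rintegral] is
   only meaningful then; for g, V in L^q this is automatic (Hoelder and Sobolev
   inequalities). For p < 2 the singular factor |G|^{p-2} is always multiplied
   by G, so its value at G = 0 is irrelevant. *)
Definition weak_solution (p : R) g V (l : R) u G : Prop :=
  W0 p u G /\
  forall v H, W0 p v H ->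
    [/\ mu.-integrable Omega
          (EFin \o (fun x => V x * `|u x| `^ (p - 2) * u x * v x)),
        mu.-integrable Omega
          (EFin \o (fun x => g x * `|u x| `^ (p - 2) * u x * v x)) &
        \int[mu]_(x in Omega) (enorm (G x) `^ (p - 2) * dotp (G x) (H x)) +
        \int[mu]_(x in Omega) (V x * `|u x| `^ (p - 2) * u x * v x) =
        l * \int[mu]_(x in Omega) (g x * `|u x| `^ (p - 2) * u x * v x)].

(* Elements of W^{1,p}_0 being classes modulo null sets, positivity in Omega is
   positivity almost everywhere. *)
Definition positive_eigenfunction (p : R) g V (l : R) u : Prop :=
  (exists G, weak_solution p g V l u G) /\
  {ae mu, forall x, Omega x -> 0 < u x}.

Definition principal_eigenvalue (p : R) g V (l : R) : Prop :=
  exists u, positive_eigenfunction p g V l u.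

Definition rearrangements h : set (RN R N -> R) :=
  [set f | measurable_fun Omega f /\
    forall alpha : R, mu (Omega `&` [set x | alpha <= f x]) =
                      mu (Omega `&` [set x | alpha <= h x])].

Definition unique_positive_principal_eigenvalue (p : R) g V (l : R) :
    Prop :=
  unique (fun t => 0 < t /\ principal_eigenvalue p g V t) l.

End problem.

(* Main.v *)
(* Let v > 0 be an eigenfunction of (g, V) with eigenvalue l(g, V). Picone's identity shows that
   J(w) = \int |Dw|^p + (V - l(g, V) g) |w|^p >= 0 for every w in W^{1,p}_0, and us satisfies
   the Euler-Lagrange equation of this functional for the optimal pair.

   Suppose that gs (or -Vs) is not an increasing function of us. Then two sets of positive
   measure carry its values in the wrong order with respect to a level of us, and by a density
   argument one of them meets a translate of the other: there are A and h, with A and A + h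
   disjoint, us(x + h) <= us(x) on A, and strictly larger values of gs on A + h. Swapping the
   values on A and A + h gives a rearrangement. By optimality J(us) <= 0 for the swapped pair, so
   J(us) = 0, the eigenvalue is unchanged, and 0 minimizes J. If us takes the same values on A
   and A + h, the value of J at us is not yet contradictory. However, J is negative at
   us e^{t x_i} for a suitable coordinate (h_i <> 0) and a small t of sign opposite to h_i: in
   comparison with the equation of us tested by us e^{p t x_i}, the gradient terms cost only
   o(t), while the swapped part, where |us|^p is now weighted in favour of A, gains a multiple
   of |t|. This contradicts J >= 0. *)
Require Import Defs.
From mathcomp Require Import all_boot all_order all_algebra.
From mathcomp Require Import all_classical all_reals all_analysis.
From mathcomp Require Import measurable_realfun ring lra.

Import Order.TTheory GRing.Theory Num.Theory.
Import numFieldNormedType.Exports.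

Set Implicit Arguments.
Unset Strict Implicit.
Unset Printing Implicit Defensive.

Local Open Scope classical_set_scope.
Local Open Scope ring_scope.

(** * Lebesgue measure and translations *)

(** The obstacle is a level set of [us] of positive measure: nothing excludes it, and moving weight
    inside it leaves J(us) unchanged, so J must be tested at another function. This is why values
    are exchanged by a translation and not by an arbitrary measure-preserving map: from A to A + h
    the weight e^{p t x_i} changes by the constant factor e^{p t h_i}, so the gain is linear in t,
    however irregular A is.

    The loss is o(t) for two reasons. Since |us e^{t x_i}|^p = |us|^{p-2} us (us e^{p t x_i}), the
    zeroth-order terms of the old weight cancel exactly against the equation. By convexity of |.|^p,
    what remains of the gradient terms is at most t times a difference of fluxes at two points that
    merge as t tends to 0.

    The eigenvalue of a swapped pair is given through a positive eigenfunction only. Its minimality,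
    that is J >= 0, therefore has to be extracted from the weak equation, although that
    eigenfunction is neither known to be bounded nor bounded away from 0. *)

Section lebesgue_space.
Context (R : realType) (N : nat).
Implicit Types (a b h : 'rV[R]_N) (X A : set 'rV[R]_N).
Local Notation mu := (@leb R N).
Local Notation lo := (@lebesgue_outer R N).

Lemma lebesgue_outer_cover X c : X `<=` \bigcup_k obox (c k) ->
  (lo X <= \sum_(k <oo) obox_volume (c k))%E.
Proof. by move=> Xc; apply: ereal_inf_lbound; exists c. Qed.

Lemma box_volume_ge0 a b : 0 <= box_volume a b.
Proof. by have := obox_volume_ge0 (Some (a, b)); rewrite /obox_volume lee_fin. Qed.

Lemma lebesgue_outer_box_le a b : (lo (box a b) <= (box_volume a b)%:E)%E.
Proof.
pose c (k : nat) : option ('rV[R]_N * 'rV[R]_N) := if k is 0%N then Some (a, b) else None.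
have H1 : (lo (box a b) <= \sum_(k <oo) obox_volume (c k))%E.
  by apply: lebesgue_outer_cover => x xab; exists 0%N.
apply: (le_trans H1).
rewrite nneseries_recl//; last by move=> n _; exact: obox_volume_ge0.
by rewrite eseries_cond/= eseries0 ?adde0// => -[|n].
Qed.

Definition setc (a : 'rV[R]_N) (i : 'I_N) (t : R) : 'rV[R]_N :=
  \row_j if j == i then t else a ord0 j.

Lemma box_volume_split a b i t :
  box_volume a (setc b i (Num.min (b ord0 i) t)) +
  box_volume (setc a i (Num.max (a ord0 i) t)) b = box_volume a b.
Proof.
rewrite /box_volume (bigD1 i)//= [X in _ + X](bigD1 i)//= [RHS](bigD1 i)//=.
rewrite !mxE eqxx (eq_bigr (fun j => Num.max 0 (b ord0 j - a ord0 j))); last first.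
  by move=> j /negPf ji; rewrite mxE ji.
rewrite [X in _ + _ * X](eq_bigr (fun j => Num.max 0 (b ord0 j - a ord0 j))); last first.
  by move=> j /negPf ji; rewrite mxE ji.
rewrite -mulrDl; congr (_ * _).
by case: (leP (b ord0 i) t) => ?; case: (leP (a ord0 i) t) => ?;
  rewrite /Num.max; repeat (case: ifPn; rewrite -?leNgt => ?); lra.
Qed.

(** The two parts of a box cut by the hyperplane x_i = t. Clipping with [min] and [max] makes a
    missing part an empty box of volume 0, so no case distinction on the position of [t] is
    needed. *)
Definition osplit1 i t (o : option ('rV[R]_N * 'rV[R]_N)) :=
  if o is Some ab then Some (ab.1, setc ab.2 i (Num.min (ab.2 ord0 i) t)) else None.
Definition osplit2 i t (o : option ('rV[R]_N * 'rV[R]_N)) :=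
  if o is Some ab then Some (setc ab.1 i (Num.max (ab.1 ord0 i) t), ab.2) else None.

(** The hyperplane cuts every box cover of a test set X into covers of the two parts of X, and the
    volumes of the cut boxes add up to the original ones; taking the infimum over covers gives the
    Caratheodory inequality. *)
Lemma measurable_halfspace i t :
  measurable ([set x : 'rV[R]_N | x ord0 i <= t] : set (RN R N)).
Proof.
apply: le_caratheodory_measurable => X.
apply: le_ereal_inf_tmp => _ [c Xc <-].
rewrite (_ : (\sum_(k <oo) obox_volume (c k))%E =
  (\sum_(k <oo) obox_volume (osplit1 i t (c k)) +
   \sum_(k <oo) obox_volume (osplit2 i t (c k)))%E); last first.
  rewrite -nneseriesD; [|by move=> *; exact: obox_volume_ge0..].
  apply: eq_eseriesr => k _; case: (c k) => [[a b]|] /=; last by rewrite adde0.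
  by rewrite -EFinD; congr EFin; rewrite box_volume_split.
apply: leeD; apply: lebesgue_outer_cover => x [/Xc [k _]].
- case E : (c k) => [[a b]|] //= xab xt; exists k => //; rewrite E /= => j.
  by rewrite mxE; have /andP[-> xb] := xab j; case: eqP => [ji|//]; rewrite ji in xb *;
      rewrite le_min xb.
- case E : (c k) => [[a b]|] //= xab /negP; rewrite -ltNge => xt; exists k => //; rewrite E /= => j.
  by rewrite mxE; have /andP[xa ->] := xab j; rewrite andbT; case: eqP => [ji|//];
      rewrite ji in xa *; rewrite gt_max xa.
Qed.

Lemma measurable_box a b : measurable (box a b : set (RN R N)).
Proof.
have -> : box a b = \bigcap_(i in [set: 'I_N])
    (~` [set x : 'rV[R]_N | x ord0 i <= a ord0 i] `&` [set x | x ord0 i <= b ord0 i]).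
  apply/seteqP; split => x /=.
    by move=> xab i _ /=; have /andP[ax xb] := xab i; split => //; apply/negP; rewrite -ltNge.
  by move=> xab i; have [/negP + xb] := xab i I; rewrite -ltNge => ->.
apply: fin_bigcap_measurable => // i _; apply: measurableI; last exact: measurable_halfspace.
by apply: measurableC; exact: measurable_halfspace.
Qed.

(** An open set is the union of the boxes with rational corners that it contains, and there are
    countably many of these. *)
Lemma measurable_open (U : set 'rV[R]_N) : open U -> measurable (U : set (RN R N)).
Proof.
move=> oU.
pose rbox (ab : 'rV[rat]_N * 'rV[rat]_N) := box (map_mx ratr ab.1 : 'rV[R]_N) (map_mx ratr ab.2).
have -> : U = \bigcup_(ab in [set ab | rbox ab `<=` U]) rbox ab.
  apply/seteqP; split => [x Ux|x [ab + xab]]; last exact.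
  have /nbhs_ballP[e/= e0 xeU] := open_nbhs_nbhs (conj oU Ux).
  have H (i : 'I_N) : exists q : rat * rat,
     x ord0 i - e < ratr q.1 < x ord0 i /\ x ord0 i <= ratr q.2 < x ord0 i + e.
    have [|r1 /itvP r1P] := @rat_in_itvoo R (x ord0 i - e) (x ord0 i); first by rewrite ltrBlDr ltrDl.
    have [|r2 /itvP r2P] := @rat_in_itvoo R (x ord0 i) (x ord0 i + e); first by rewrite ltrDl.
    by exists (r1, r2); split; rewrite /= ?r1P ?r2P// ltW ?r2P.
  have [q qP] := choice H.
  exists (\row_i (q i).1, \row_i (q i).2) => /=.
    move=> y yq; apply: xeU; split => // i j; rewrite ord1 /ball/=.
    have := yq j; rewrite !mxE; have [/andP[? ?] /andP[? ?]] := qP j.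
    move=> /andP[? ?]; rewrite ltr_norml; apply/andP; split; lra.
  by move=> i; rewrite !mxE; have [/andP[? ?] /andP[? ?]] := qP i; apply/andP; split; lra.
rewrite bigcup_mkcond; apply: (@countable_bigcupT_measurable _ (RN R N)).
  exact: countableP.
by move=> ab; case: ifP => // _; exact: measurable_box.
Qed.

Lemma measurable_fun_continuous (f : 'rV[R]_N -> R) (D : set (RN R N)) :
  continuous f -> measurable_fun D (f : RN R N -> R).
Proof.
move=> cf; apply: measurable_funTS => mD.
apply: (measurability _ (measurable_realfun.RGenOInfty.measurableE R)) => //.
move=> _ [_ [a ->] <-]; rewrite setTI.
apply: measurable_open; move/continuousP: cf; apply; exact: interval_open.
Qed.

Lemma coord_le_norm (x : 'rV[R]_N) i : `|x ord0 i| <= `|x|.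
Proof.
rewrite [leRHS]mx_normrE.
exact: (@le_bigmax _ _ _ 0 (fun ij : 'I_1 * 'I_N => `|x ij.1 ij.2|) (ord0, i)).
Qed.

Lemma lebesgue_outer_bounded X : bounded_set X -> (lo X < +oo)%E.
Proof.
move=> [M [Mreal XM]].
have MM : M < `|M| + 1 by rewrite (le_lt_trans (ler_norm M))// ltrDl.
(* Boxes are open on the left, hence the extra [- 1] in the lower corner. *)
pose a : 'rV[R]_N := const_mx (- (`|M| + 1) - 1); pose b : 'rV[R]_N := const_mx (`|M| + 1).
apply: (@le_lt_trans _ _ (lo (box a b))); last first.
  by apply: le_lt_trans (lebesgue_outer_box_le _ _) _; rewrite ltry.
apply: le_lebesgue_outer => x Xx i; rewrite !mxE.
have := le_trans (coord_le_norm x i) (XM _ MM _ Xx).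
by rewrite ler_norml => /andP[? ?]; apply/andP; split; lra.
Qed.

Lemma box_volume_shift a b h : box_volume (a - h) (b - h) = box_volume a b.
Proof. by apply: eq_bigr => i _; rewrite !mxE opprB addrA subrK. Qed.

Lemma lebesgue_outer_shift_le h X : (lo ((fun x => x + h)%R @^-1` X) <= lo X)%E.
Proof.
apply: le_ereal_inf_tmp => _ [c Xc <-].
pose c' k := if c k is Some ab then Some (ab.1 - h, ab.2 - h) else None.
rewrite (_ : (\sum_(k <oo) obox_volume (c k))%E = (\sum_(k <oo) obox_volume (c' k))%E).
  apply: lebesgue_outer_cover => x /= /Xc [k _ ck]; exists k => //.
  rewrite /c'; case: (c k) ck => [[a b]|] //= xab i.
  by rewrite !mxE ltrBlDr lerBrDr; have := xab i; rewrite mxE.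
apply: eq_eseriesr => k _; rewrite /c'; case: (c k) => [[a b]|] //=.
by rewrite /obox_volume /= box_volume_shift.
Qed.

Lemma lebesgue_outer_shift h X : lo ((fun x => x + h)%R @^-1` X) = lo X.
Proof.
apply/eqP; rewrite eq_le lebesgue_outer_shift_le /=.
rewrite -{1}[X](_ : (fun x => x + - h)%R @^-1` ((fun x => x + h)%R @^-1` X) = X).
  exact: lebesgue_outer_shift_le.
by apply/seteqP; split => x /=; rewrite subrK.
Qed.

Lemma measurable_shift h (A : set (RN R N)) : measurable A ->
  measurable ((fun x : 'rV[R]_N => x + h)%R @^-1` A : set (RN R N)).
Proof.
move=> mA; suff : caratheodory_measurable lo ((fun x : 'rV[R]_N => x + h)%R @^-1` A) by [].
have {}mA : caratheodory_measurable lo A by exact: mA.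
move=> X; rewrite -[in LHS](lebesgue_outer_shift (- h) X).
rewrite (mA _) -[X in (X + _)%E = _](lebesgue_outer_shift h) -[X in (_ + X)%E =
    _](lebesgue_outer_shift h).
by congr (lo _ + lo _)%E; apply/seteqP; split => x /=; rewrite addrK.
Qed.

Lemma lebesgue_outer_bigsetU (I : finType) (P : pred I) (F : I -> set 'rV[R]_N) :
  (lo (\big[setU/set0]_(i | P i) F i) <= \sum_(i | P i) lo (F i))%E.
Proof.
apply: (big_rec2 (fun X (y : \bar R) => lo X <= y)%E); first by rewrite lebesgue_outer0.
move=> i X y _ Xy; apply: (le_trans (outer_measureU2 _ _ _)); exact: leeD.
Qed.

(** If A had density at most 3/4 in every box, a cover of total volume below 7/6 of the measure of A
    would bound that measure by 3/4 * 7/6 = 7/8 of itself. *)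
Lemma exists_dense_box A : (0 < lo A)%E -> (lo A < +oo)%E ->
  exists a b, ((3 / 4 * box_volume a b)%:E < lo (A `&` box a b))%E.
Proof.
move=> A0 Aoo.
have Afin : lo A \is a fin_num by rewrite ge0_fin_numE// lebesgue_outer_ge0.
apply: contrapT => H.
have {}H a b : (lo (A `&` box a b) <= (3 / 4 * box_volume a b)%:E)%E.
  by rewrite leNgt; apply/negP => ?; apply: H; exists a, b.
have m0 : 0 < fine (lo A) by rewrite fine_gt0// A0.
have [|_ [c Ac <-] cA] := @lb_ereal_inf_adherent _ _ (fine (lo A) / 6) _ Afin.
  by rewrite divr_gt0.
have : (lo A <= (3 / 4)%:E * \sum_(k <oo) obox_volume (c k))%E.
  rewrite -nneseriesZl; last by move=> k _; exact: obox_volume_ge0.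
  apply: (@le_trans _ _ (\sum_(k <oo) lo (A `&` obox (c k)))%E).
    apply: le_trans (outer_measure_sigma_subadditive _ _).
    by apply: le_lebesgue_outer => x Ax; have [k _ ck] := Ac _ Ax; exists k.
  apply: lee_nneseries => [k _ _|k _]; first exact: lebesgue_outer_ge0.
  case: (c k) => [[a b]|] /=; last by rewrite setI0 lebesgue_outer0 mule0.
  exact: H.
apply/negP; rewrite -ltNge.
apply: (@le_lt_trans _ _ ((3 / 4)%:E * (lo A + (fine (lo A) / 6)%:E))%E).
  by apply: lee_wpmul2l; [rewrite lee_fin|exact: ltW].
move: (fine _) (fineK Afin) m0 => m <- m0.
rewrite -EFinD -EFinM lte_fin; lra.
Qed.

(** Here [L] stands for the sides of a box and [s] for the side of small cubes: rounding every side
    up to a multiple of [s] costs at most a factor 3/2, and 3/2 times a density of 1/2 is the 3/4 of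
    the dense box. The bound is continuity of the product at s = 0. *)
Lemma prodDr_small (L : 'I_N -> R) : (forall i, 0 < L i) ->
  exists2 d, 0 < d & forall s, 0 < s -> s <= d ->
    \prod_i (L i + s) <= 3 / 2 * \prod_i L i.
Proof.
move=> L0.
have P0 : 0 < \prod_i L i by apply: prodr_gt0.
have : (fun s => \prod_i (L i + s)) @ (0 : R) --> \prod_i (L i + 0).
  apply: cvg_big => [|i _]; first exact: mul_continuous.
  by apply: cvgD; [exact: cvg_cst|exact: cvg_id].
rewrite (eq_bigr L); last by move=> i _; rewrite addr0.
move=> /cvgrPdist_lt /(_ (1 / 2 * \prod_i L i)) [|d/= d0 dP]; first by rewrite mulr_gt0.
exists (d / 2) => [|s s0 sd]; first by rewrite divr_gt0.
have /dP : ball (0 : R) d s by rewrite /ball/= sub0r normrN gtr0_norm//; lra.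
rewrite ltr_norml => /andP[]; lra.
Qed.

(* A box in which [A] has density above 3/4 is tiled by cubes of side [s], with a
   wasted volume that is small when [s] is; some cube keeps density above 1/2. *)
Lemma exists_dense_cube A : (0 < lo A)%E -> (lo A < +oo)%E ->
  exists2 d, 0 < d & forall s, 0 < s -> s <= d ->
    exists a, ((1 / 2 * s ^+ N)%:E < lo (A `&` box a (a + const_mx s)))%E.
Proof.
move=> A0 Aoo; have [a [b ab]] := exists_dense_box A0 Aoo.
have vol0 : 0 < box_volume a b.
  rewrite lt_neqAle box_volume_ge0 andbT; apply/eqP => v0.
  have := lt_le_trans ab (le_trans (le_lebesgue_outer (@subIsetr _ _ _)) (lebesgue_outer_box_le a b)).
  by rewrite -v0 mulr0 ltxx.
have L0 i : 0 < b ord0 i - a ord0 i.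
  rewrite ltNge; apply/negP => abi; move: vol0.
  by rewrite /box_volume (bigD1 i)//= (max_idPl abi) mul0r ltxx.
have volE : box_volume a b = \prod_i (b ord0 i - a ord0 i).
  by apply: eq_bigr => i _; rewrite (max_idPr (ltW (L0 i))).
have [d d0 dP] := prodDr_small L0.
exists d => // s s0 sd; apply: contrapT => H.
have {}H c : (lo (A `&` box c (c + const_mx s)) <= (1 / 2 * s ^+ N)%:E)%E.
  by rewrite leNgt; apply/negP => ?; apply: H; exists c.
(* The number of cubes along axis i: enough to cover the side, with an overshoot of at most [s]. *)
pose m i := (Num.truncn ((b ord0 i - a ord0 i) / s)).+1.
have mL i : b ord0 i - a ord0 i < s * (m i)%:R <= b ord0 i - a ord0 i + s.
  have /andP[] := truncn_itv (divr_ge0 (ltW (L0 i)) (ltW s0)).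
  rewrite ler_pdivlMr// ltr_pdivrMr// => H1 H2.
  by rewrite mulrC H2 /m -natr1 mulrDl mul1r lerD2r.
pose M := (\max_i m i)%N.
have mM i : (m i <= M)%N by rewrite /M; exact: leq_bigmax.
pose Q (k : {ffun 'I_N -> 'I_M}) := box (a + \row_i (s * (k i)%:R)) (a + \row_i (s * (k i)%:R) +
    const_mx s).
pose fam := family (fun i => [pred j : 'I_M | (j < m i)%N]).
have sub : A `&` box a b `<=` \big[setU/set0]_(k in fam) (A `&` Q k).
  move=> x [Ax xab].
  have ex i : exists k, x ord0 i - a ord0 i <= s * k.+1%:R.
    exists (m i).-1; have /andP[/ltW H1 _] := mL i; apply: le_trans H1.
    by rewrite lerD2r; have /andP[] := xab i.
  (* Cubes are closed on the right, so the cube containing x has as index the least k with x_i - a_i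
     <= s (k + 1). *)
  pose k i := ex_minn (ex i).
  have kP i : s * (k i)%:R < x ord0 i - a ord0 i <= s * (k i).+1%:R.
    rewrite /k; case: ex_minnP => -[|n] -> nmin; rewrite andbT.
      by rewrite mulr0 subr_gt0; have /andP[] := xab i.
    by rewrite ltNge; apply/negP => /nmin; rewrite ltnn.
  have km i : (k i < m i)%N.
    rewrite -(ltr_nat R) -(ltr_pM2l s0).
    have /andP[H1 _] := kP i; apply: (lt_trans H1); have /andP[H2 _] := mL i.
    by apply: le_lt_trans H2; rewrite lerD2r; have /andP[] := xab i.
  have kM i : (k i < M)%N := leq_trans (km i) (mM i).
  have kf : [ffun i => Ordinal (kM i)] \in fam.
    by apply/familyP => i; rewrite ffunE inE /=.
  rewrite (bigD1 _ kf)/=.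
  left; split => // i; rewrite !mxE ffunE/=.
  have /andP[] := kP i; rewrite -natr1; lra.
have : (lo (A `&` box a b) <= (3 / 4 * box_volume a b)%:E)%E.
  apply: le_trans (le_lebesgue_outer sub) _; apply: le_trans (lebesgue_outer_bigsetU _ _) _.
  apply: (@le_trans _ _ (\sum_(k in fam) (1 / 2 * \prod_(i < N) s)%:E)%E).
    by apply: lee_sum => k _; apply: le_trans (H _) _; rewrite prodr_const card_ord.
  (* The sum of s^N over all multi-indices factors into the product of the rounded sides s * m_i. *)
  rewrite sumEFin lee_fin -mulr_sumr -(bigA_distr_big_dep (fun i => [pred j : 'I_M | (j < m
      i)%N]) (fun _ _ => s)).
  apply: (@le_trans _ _ (1 / 2 * (3 / 2 * \prod_i (b ord0 i - a ord0 i)))); last by rewrite volE; lra.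
  rewrite ler_pM2l//; apply: le_trans (dP s s0 sd).
  apply: ler_prod => i _.

  rewrite (big_ord_narrow (mM i)) sumr_const card_ord -mulr_natr; apply/andP; split.
    by rewrite mulr_ge0// ltW.
  by have /andP[] := mL i.
by rewrite leNgt ab.
Qed.

(* Choose equal cubes in which [A] and [B] have more than half the volume: after
   translating one cube onto the other the two sets must overlap. *)
Lemma exists_translate_overlap (A B : set (RN R N)) :
  measurable A -> measurable B -> (0 < mu A < +oo)%E -> (0 < mu B < +oo)%E ->
  exists h, (0 < mu (A `&` (fun x : 'rV[R]_N => x + h)%R @^-1` B))%E.
Proof.
move=> mA mB /andP[A0 Aoo] /andP[B0 Boo].
have [d1 d10 d1P] := exists_dense_cube A0 Aoo.
have [d2 d20 d2P] := exists_dense_cube B0 Boo.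
pose s := Num.min d1 d2.
have s0 : 0 < s by rewrite lt_min d10.
have [a aP] : exists a, ((1 / 2 * s ^+ N)%:E < lo (A `&` box a (a + const_mx s)))%E.
  by apply: d1P => //; rewrite ge_min lexx.
have [b bP] : exists b, ((1 / 2 * s ^+ N)%:E < lo (B `&` box b (b + const_mx s)))%E.
  by apply: d2P => //; rewrite ge_min lexx orbT.
exists (b - a); rewrite lt0e measure_ge0 andbT; apply/eqP => H0.
pose S : set (RN R N) := (fun x : 'rV[R]_N => x + (b - a))%R @^-1` (B `&` box b (b + const_mx s)).
pose T : set (RN R N) := A `&` box a (a + const_mx s).
have mS : measurable S by apply: measurable_shift; apply: measurableI => //; exact: measurable_box.
have mT : measurable T by apply: measurableI => //; exact: measurable_box.
have SP : ((1 / 2 * s ^+ N)%:E < mu S)%E by rewrite [mu S]lebesgue_outer_shift.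
have ST0 : mu (S `&` T) = 0%E.
  apply/eqP; rewrite -measure_le0 -H0; apply: le_lebesgue_outer => x [[Bx _] [Ax _]]; split => //.
(* [S] and [T] both lie in the cube at [a] and each fills more than half of it; if they overlapped
   in a null set only, their union would be larger than the cube. *)
have : (mu (S `|` T) <= (s ^+ N)%:E)%E.
  apply: (@le_trans _ _ (lo (box a (a + const_mx s)))).
    apply: le_lebesgue_outer => x [[_ xb]|[]//] i.
    by have := xb i; rewrite !mxE; lra.
  apply: le_trans (lebesgue_outer_box_le _ _) _; rewrite lee_fin /box_volume.
  rewrite (eq_bigr (fun=> s)) ?prodr_const ?card_ord// => i _.
  by rewrite !mxE addrAC subrr add0r; apply/max_idPr/ltW.
apply/negP; rewrite -ltNge.
have -> : S `|` T = (S `\` T) `|` T by rewrite setUDl setDv setD0.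
have ES : mu (S `\` T) = mu S.
  by rewrite -[LHS]adde0 -ST0; apply/esym/measureDI.
have -> : mu ((S `\` T) `|` T) = (mu S + mu T)%E.
  by rewrite -ES; apply: measureU => //; [exact: measurableD|rewrite setDKI].
rewrite (_ : s ^+ N = 1 / 2 * s ^+ N + 1 / 2 * s ^+ N); last lra.
by rewrite EFinD lteD.
Qed.

End lebesgue_space.

(** * Powers and truncations *)

Section powers.
Context {R : realType}.
Implicit Types (p r s a b c e t : R).

(** Away from 0 this reduces differentiating |s|^r to the chain rule for powers of the smooth
    function s^2. *)
Lemma normr_powRE r s : `|s| `^ r = (s ^+ 2) `^ (r / 2).
Proof.
by rewrite -real_normK ?num_real// -powR_mulrn// -powRrM mulrC divfK.
Qed.

Lemma is_derive1_comp_fun (f g : R -> R) (x a b : R) :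
  is_derive (g x) 1 f a -> is_derive x 1 g b ->
  is_derive x 1 (fun t => f (g t)) (a * b).
Proof.
exact: is_derive1_comp.
Qed.

Lemma is_derive1_continuous (f : R -> R) (x a : R) :
  is_derive x 1 f a -> {for x, continuous f}.
Proof.
by move=> [fx _]; apply: differentiable_continuous; apply/derivable1_diffP.
Qed.

Lemma is_derive_cstD (k : R) (f : R -> R) (x a : R) :
  is_derive x 1 f a -> is_derive x 1 (fun t => k + f t) a.
Proof.
move=> H; rewrite (_ : (fun t => k + f t) = cst k + f)//.
by apply: is_derive_eq; rewrite add0r.
Qed.

Lemma is_derive_cstM (k : R) (f : R -> R) (x a : R) :
  is_derive x 1 f a -> is_derive x 1 (fun t => k * f t) (k * a).
Proof.
by move=> H; rewrite (_ : (fun t => k * f t) = k *: f)//; exact: is_deriveZ.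
Qed.

Lemma is_derive_idD (f : R -> R) (x a : R) :
  is_derive x 1 f a -> is_derive x 1 (fun t => t + f t) (1 + a).
Proof.
by move=> H; rewrite (_ : (fun t => t + f t) = id + f)//; exact: is_deriveD.
Qed.

Lemma is_derive_normr_powR_neq0 r s : s != 0 ->
  is_derive s 1 (fun t : R => `|t| `^ r) (r * (`|s| `^ (r - 2) * s)).
Proof.
move=> s0; under eq_fun do rewrite normr_powRE.
have s20 : 0 < s ^+ 2 by rewrite exprn_even_gt0.
have H : is_derive s 1 (fun t : R => t ^+ 2) (2 * s).
  by apply: is_derive_eq; rewrite /GRing.scale/= mulr1 mulr_natl.
have H2 := @is_derive1_powR _ (r / 2) _ s20.
have := @is_derive1_comp_fun (fun t => t `^ (r / 2)) (fun t => t ^+ 2) s _ _ H2 H.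
rewrite normr_powRE (_ : r / 2 - 1 = (r - 2) / 2); last by field.
by rewrite (_ : r / 2 * (s ^+ 2) `^ ((r - 2) / 2) * (2 * s) = r * ((s ^+ 2) `^ ((r - 2) / 2) *
    s)); last by field.
Qed.

Lemma continuous_normr_powR_neq0 r s : s != 0 ->
  {for s, continuous (fun t : R => `|t| `^ r)}.
Proof.
by move=> s0; exact: is_derive1_continuous (is_derive_normr_powR_neq0 r s0).
Qed.

Lemma continuous_normr_powR r : 0 < r -> continuous (fun s : R => `|s| `^ r).
Proof.
move=> r0 s; have [->|s0] := eqVneq s 0; last exact: continuous_normr_powR_neq0.
rewrite /continuous_at normr0 powR0 ?gt_eqF//.
apply/cvgrPdist_lt => e e0.
have er0 : 0 < e `^ r^-1 by rewrite powR_gt0.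
have : \forall t \near (0 : R), `|t| < e `^ r^-1 by apply/nbhs_norm0P; exists (e `^ r^-1).
apply: filterS => t tl; rewrite sub0r normrN ger0_norm ?powR_ge0//.
rewrite -[ltRHS](@powRr1 _ e) ?ltW// -(mulVf (lt0r_neq0 r0)) powRrM.
by rewrite gt0_ltr_powR// nnegrE ?powR_ge0.
Qed.

(** The signed power |s|^{p-2} s vanishes at 0: the factor [s] absorbs the default value that the
    first factor, singular for p < 2, takes there. *)
Lemma norm_spow p s : 1 < p -> `| `|s| `^ (p - 2) * s| = `|s| `^ (p - 1).
Proof.
move=> p1; rewrite normrM (ger0_norm (powR_ge0 _ _)).
have [->|s0] := eqVneq s 0; first by rewrite normr0 mulr0 powR0// subr_eq0 gt_eqF.
rewrite -[X in _ * X](@powRr1 _ `|s|)// -powRD; first by congr (_ `^ _); ring.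
by rewrite normr_eq0 s0 implybT.
Qed.

Lemma spow_mulr p s : 1 < p -> `|s| `^ (p - 2) * s * s = `|s| `^ p.
Proof.
move=> p1; rewrite -mulrA -expr2 -real_normK ?num_real//.
have [->|s0] := eqVneq s 0; first by rewrite normr0 expr0n mulr0 powR0// gt_eqF// (lt_trans ltr01).
rewrite -(@powR_mulrn _ `|s| 2)// -powRD; first by congr (_ `^ _); ring.
by rewrite normr_eq0 s0 implybT.
Qed.

Lemma continuous_spow p : 1 < p -> continuous (fun s : R => `|s| `^ (p - 2) * s).
Proof.
move=> p1 s; have [->|s0] := eqVneq s 0; last first.
  by apply: cvgM; [exact: continuous_normr_powR_neq0|exact: cvg_id].
rewrite /continuous_at mulr0; apply/norm_cvg0P; under eq_fun do rewrite norm_spow//.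
have p10 : 0 < p - 1 by rewrite subr_gt0.
have := @continuous_normr_powR _ p10 0.
by rewrite /continuous_at normr0 powR0 ?gt_eqF//; exact.
Qed.

(** At 0 the difference quotient is itself the signed power |h|^{p-2} h, which tends to 0 because p
    > 1. *)
Lemma is_derive_normr_powR p s : 1 < p ->
  is_derive s 1 (fun t : R => `|t| `^ p) (p * (`|s| `^ (p - 2) * s)).
Proof.
move=> p1; have [->|s0] := eqVneq s 0; last exact: is_derive_normr_powR_neq0.
have H : (fun h : R => h^-1 *: ((`|h *: (1 : R) + 0| `^ p - `|0 : R| `^ p) : R)) @ 0^' --> (0 : R).
  rewrite (_ : (fun h => _) = fun h : R => `|h| `^ (p - 2) * h).
    apply: cvg_within_filter; have := @continuous_spow p p1 0.
    by rewrite /continuous_at mulr0.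
  apply/funext => h; rewrite normr0 powR0 ?gt_eqF ?(lt_trans ltr01)// subr0 addr0.
  rewrite /GRing.scale/= mulr1 -(@spow_mulr p h)//.
  by have [->|h0] := eqVneq h 0; [rewrite invr0 !mulr0|rewrite mulrC mulfK].
rewrite !mulr0; apply: DeriveDef.
  by apply/cvg_ex; exists 0.
exact/cvg_lim.
Qed.

Lemma young p a b : 1 < p -> 0 <= a -> 0 <= b ->
  p * (a * b `^ (p - 1)) <= a `^ p + (p - 1) * b `^ p.
Proof.
move=> p1 a0 b0; have p0 : 0 < p by apply: lt_trans p1.
have p10 : 0 < p - 1 by rewrite subr_gt0.
have E : p^-1 + (p / (p - 1))^-1 = 1 by field; rewrite !gt_eqF.
have := @conjugate_powR _ a (b `^ (p - 1)) p (p / (p - 1)) a0 (powR_ge0 _ _) p0 (divr_gt0 p0 p10) E.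
rewrite -powRrM (_ : (p - 1) * (p / (p - 1)) = p); last by field; rewrite gt_eqF.
move=> H; rewrite -ler_pdivlMl// (le_trans H)// le_eqVlt; apply/orP; left; apply/eqP.
by field; rewrite !gt_eqF.
Qed.

Lemma powRD_le p a b : 0 <= p -> 0 <= a -> 0 <= b ->
  (a + b) `^ p <= 2 `^ p * (a `^ p + b `^ p).
Proof.
move=> p0; wlog ab : a b / a <= b => [H a0 b0|a0 b0].
  by have [/H|/ltW/H] := leP a b; last rewrite addrC [_ `^ _ + _]addrC; apply.
apply: (@le_trans _ _ ((2 * b) `^ p)).
  by rewrite ge0_ler_powR ?nnegrE ?mulr_ge0 ?addr_ge0//; lra.
by rewrite powRM// ler_wpM2l ?powR_ge0// lerDr powR_ge0.
Qed.

(** The class for which products f(u) h(v) of Sobolev functions stay in W^{1,p}: both functions and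
    both slopes must be bounded for the product rule to give a gradient in L^p. *)
Definition C1_bounded (f f' : R -> R) :=
  [/\ forall x : R, is_derive x 1 f (f' x), continuous f' &
      exists M, forall x, `|f x| <= M /\ `|f' x| <= M].

Lemma C1_bounded_lipschitz f f' : C1_bounded f f' ->
  exists2 M, 0 <= M & forall a b, `|f a - f b| <= M * `|a - b|.
Proof.
move=> [df _ [M fM]]; exists M; first by apply: le_trans (fM 0).2.
have cf : continuous f.
  by move=> x; exact: is_derive1_continuous (df x).
suff H a b : a < b -> `|f b - f a| <= M * `|b - a|.
  move=> a b; have [ab|ba|->] := ltgtP a b; last by rewrite !subrr normr0 mulr0.
    by rewrite distrC [`|a - b|]distrC H.
  exact: H.
move=> ab; have [|c _ ->] := @MVT _ f f' a b ab (fun x _ => df x).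
  exact: continuous_subspaceT.
by rewrite normrM ler_wpM2r// (fM c).2.
Qed.

(** A smooth truncation. For c > 0 it is bounded by 1/c, its slope lies in [-1, 1], it never exceeds
    |s| in absolute value, and it tends to s as c tends to 0. Unlike a cut-off by [min] and [max] it
    preserves C^1 approximants. *)
Definition trunc c s := s / (1 + c ^+ 2 * s ^+ 2).
Definition trunc' c s := (1 - c ^+ 2 * s ^+ 2) / (1 + c ^+ 2 * s ^+ 2) ^+ 2.

Lemma trunc_den_gt0 c s : 0 < 1 + c ^+ 2 * s ^+ 2.
Proof.
by rewrite ltr_wpDr// mulr_ge0// sqr_ge0.
Qed.

Lemma is_derive_trunc c s : is_derive s 1 (trunc c) (trunc' c s).
Proof.
have d0 := trunc_den_gt0 c s.
have H0 : is_derive s 1 (fun t : R => t ^+ 2) (2 * s).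
  by apply: is_derive_eq; rewrite /GRing.scale/= mulr1 mulr_natl.
have H1 : is_derive s 1 (fun t : R => c ^+ 2 * t ^+ 2) (c ^+ 2 * (2 * s)).
  exact: is_derive_cstM.
have H : is_derive s 1 (fun t : R => 1 + c ^+ 2 * t ^+ 2) (c ^+ 2 * (2 * s)).
  exact: is_derive_cstD.
have H2 : is_derive s 1 (fun t : R => (1 + c ^+ 2 * t ^+ 2)^-1)
    (- (1 + c ^+ 2 * s ^+ 2) ^- 2 * (c ^+ 2 * (2 * s))).
  exact: (@realfun.is_deriveV _ (fun t : R => 1 + c ^+ 2 * t ^+ 2) _ _ _ (lt0r_neq0 d0) H).
have := @is_deriveM _ _ id (fun t : R => (1 + c ^+ 2 * t ^+ 2)^-1) s 1 _ _ (is_derive_id _ _) H2.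
rewrite /GRing.scale/= => H3.
rewrite (_ : trunc' c s = s * (- (1 + c ^+ 2 * s ^+ 2) ^- 2 * (c ^+ 2 * (2 * s))) +
  (1 + c ^+ 2 * s ^+ 2)^-1 * 1)//.
have E (u : R) : s * (- u * (c ^+ 2 * (2 * s))) = - u * (2 * (c ^+ 2 * s ^+ 2)) by ring.
rewrite /trunc' E.
by move: (c ^+ 2 * s ^+ 2) d0 => x /lt0r_neq0 x0; field.
Qed.

Lemma trunc'_le1 c s : `|trunc' c s| <= 1.
Proof.
rewrite /trunc'; have : 0 <= c ^+ 2 * s ^+ 2 by rewrite mulr_ge0// sqr_ge0.
move: (c ^+ 2 * s ^+ 2) => x x0.
have d0 : 0 < (1 + x) ^+ 2 by rewrite exprn_gt0//; lra.
by rewrite ler_norml ler_pdivlMr// ler_pdivrMr//; apply/andP; split; nra.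
Qed.

Lemma continuous_trunc' c : continuous (trunc' c).
Proof.
have c2 : continuous (fun t : R => c ^+ 2 * t ^+ 2).
  by move=> s; apply: cvgMr; exact: exprn_continuous.
move=> s; rewrite /trunc'; apply: cvgM.
  by apply: cvgB; [exact: cvg_cst|exact: c2].
apply: cvgV; first by rewrite expf_neq0// lt0r_neq0// trunc_den_gt0.
apply: (@cvg_comp _ _ _ (fun t : R => 1 + c ^+ 2 * t ^+ 2) (fun t : R => t ^+ 2)).
  by apply: cvgD; [exact: cvg_cst|exact: c2].
exact: exprn_continuous.
Qed.

Lemma norm_trunc_le c s : `|trunc c s| <= `|s|.
Proof.
rewrite /trunc normrM ler_piMr// normfV (gtr0_norm (trunc_den_gt0 _ _)) invf_le1 ?trunc_den_gt0//.
by rewrite lerDl mulr_ge0// sqr_ge0.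
Qed.

Lemma norm_trunc_bound c s : 0 < c -> `|trunc c s| <= c^-1.
Proof.
move=> c0; rewrite /trunc normrM normfV (gtr0_norm (trunc_den_gt0 _ _)) ler_pdivrMr ?trunc_den_gt0//.
rewrite ler_pdivlMl// -(real_normK (num_real s)) -exprMn.
rewrite -[leLHS]/(c * `|s|); have : 0 <= c * `|s| by rewrite mulr_ge0// ltW.
by move: (c * `|s|) => y y0; nra.
Qed.

(* A [C^1] regularization of the positive part: it is bounded below by [e] (so its
   negative powers are bounded), lies above [t], and has slope at least 1/2 on [t > 0]. *)
Definition smoothpos (e t : R) := e + (t + (t ^+ 2 + e ^+ 2) `^ (1 / 2)) / 2.
Definition smoothpos' (e t : R) := (1 + t / (t ^+ 2 + e ^+ 2) `^ (1 / 2)) / 2.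

Lemma sqr_powR_half (x : R) : 0 <= x -> (x `^ (1 / 2)) ^+ 2 = x.
Proof.
by move=> x0; rewrite -powR_mulrn ?powR_ge0// -powRrM divfK// powRr1.
Qed.

Lemma smoothpos_sqrt e t : 0 < e ->
  [/\ 0 < (t ^+ 2 + e ^+ 2) `^ (1 / 2), `|t| <= (t ^+ 2 + e ^+ 2) `^ (1 / 2) &
      (t ^+ 2 + e ^+ 2) `^ (1 / 2) <= `|t| + e].
Proof.
move=> e0; have e20 : 0 < e ^+ 2 by rewrite exprn_gt0.
have s0 : 0 < t ^+ 2 + e ^+ 2 by rewrite ltr_wpDl// sqr_ge0.
have S0 : 0 < (t ^+ 2 + e ^+ 2) `^ (1 / 2) by rewrite powR_gt0.
split => //.
  suff : `|t| ^+ 2 <= ((t ^+ 2 + e ^+ 2) `^ (1 / 2)) ^+ 2.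
    by rewrite ler_sqr// nnegrE ltW.
  by rewrite sqr_powR_half ?(ltW s0)// real_normK ?num_real// lerDl ltW.
suff : ((t ^+ 2 + e ^+ 2) `^ (1 / 2)) ^+ 2 <= (`|t| + e) ^+ 2.
  by rewrite ler_sqr// nnegrE ?(ltW S0)// addr_ge0// ltW.
rewrite sqr_powR_half ?(ltW s0)// sqrrD real_normK ?num_real// lerD2r lerDl.
by rewrite mulrn_wge0// mulr_ge0// ltW.
Qed.

Lemma is_derive_smoothpos e t : 0 < e -> is_derive t 1 (smoothpos e) (smoothpos' e t).
Proof.
move=> e0; have [S0 _ _] := smoothpos_sqrt t e0.
have s0 : 0 < t ^+ 2 + e ^+ 2 by rewrite ltr_wpDl ?sqr_ge0// exprn_gt0.
have H : is_derive t 1 (fun t : R => t ^+ 2 + e ^+ 2) (2 * t).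
  by apply: is_derive_eq; rewrite /GRing.scale/= mulr1 addr0 mulr_natl.
have H2 := @is_derive1_powR _ (1 / 2) _ s0.
have H3 := @is_derive1_comp_fun (fun t => t `^ (1 / 2)) (fun t => t ^+ 2 + e ^+ 2) t _ _ H2 H.
have H4 : is_derive t 1 (fun t => e + 2^-1 * (t + (t ^+ 2 + e ^+ 2) `^ (1 / 2)))
    (2^-1 * (1 + 1 / 2 * (t ^+ 2 + e ^+ 2) `^ (1 / 2 - 1) * (2 * t))).
  by apply: is_derive_cstD; apply: is_derive_cstM; exact: is_derive_idD.
rewrite (_ : smoothpos e = fun t => e + 2^-1 * (t + (t ^+ 2 + e ^+ 2) `^ (1 / 2))); last first.
  by apply/funext => x; rewrite /smoothpos; congr (_ + _); exact: mulrC.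
rewrite (_ : smoothpos' e t = 2^-1 * (1 + 1 / 2 * (t ^+ 2 + e ^+ 2) `^ (1 / 2 - 1) * (2 * t)))//.
rewrite /smoothpos' powRB; last by rewrite (gt_eqF s0) implybT.
rewrite powRr1 ?ltW// -[in X in _ = _ * (_ + _ * (_ / X) * _)](@sqr_powR_half (t ^+ 2 + e ^+ 2)) ?ltW//.
by move: (_ `^ (1 / 2)) S0 => S S0; field; rewrite gt_eqF.
Qed.

Lemma smoothpos_ge e t : 0 < e -> e <= smoothpos e t /\ t <= smoothpos e t.
Proof.
move=> e0; have [S0] := smoothpos_sqrt t e0; rewrite /smoothpos ler_norml => /andP[].
by move: (_ `^ _) S0 => S S0 *; split; lra.
Qed.

Lemma smoothpos_le e t : 0 < e -> 0 <= t -> smoothpos e t <= t + 2 * e.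
Proof.
move=> e0 t0; have [_ _] := smoothpos_sqrt t e0; rewrite /smoothpos (ger0_norm t0).
by move: (_ `^ _) => S *; lra.
Qed.

Lemma smoothpos'_bound e t : 0 < e -> `|smoothpos' e t| <= 1.
Proof.
move=> e0; have [S0] := smoothpos_sqrt t e0; rewrite /smoothpos' ler_norml => /andP[].
move: (_ `^ _) S0 => S S0 H1 H2 _.
have H3 : t / S <= 1 by rewrite ler_pdivrMr// mul1r.
have H4 : -1 <= t / S by rewrite ler_pdivlMr// mulN1r.
by rewrite ler_norml; apply/andP; split; lra.
Qed.

Lemma smoothpos'_pos e t : 0 < e -> 0 < t ->
  1 / 2 <= smoothpos' e t /\ (1 + t / (t + e)) / 2 <= smoothpos' e t.
Proof.
move=> e0 t0; have [S0 _] := smoothpos_sqrt t e0; rewrite /smoothpos' (gtr0_norm t0).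
move: (_ `^ _) S0 => S S0 H.
have H1 : t / (t + e) <= t / S by rewrite ler_pM2l// lef_pV2// posrE addr_gt0.
have H2 : 0 <= t / S by rewrite divr_ge0// ltW.
by split; lra.
Qed.

Lemma continuous_smoothpos' e : 0 < e -> continuous (smoothpos' e).
Proof.
move=> e0 t; have [S0 _ _] := smoothpos_sqrt t e0.
have s0 : 0 < t ^+ 2 + e ^+ 2 by rewrite ltr_wpDl ?sqr_ge0// exprn_gt0.
apply: cvgMl; apply: cvgD; first exact: cvg_cst.
apply: cvgM; first exact: cvg_id.
apply: cvgV; first by rewrite gt_eqF.
apply: (@cvg_comp _ _ _ (fun t : R => t ^+ 2 + e ^+ 2) (fun t => t `^ (1 / 2))).
  by apply: cvgD; [exact: exprn_continuous|exact: cvg_cst].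
exact: is_derive1_continuous (is_derive1_powR (1 / 2) s0).
Qed.

Lemma C1_bounded_trunc_powR p c : 1 < p -> 0 < c ->
  C1_bounded (fun s => `|trunc c s| `^ p)
    (fun s => p * (`|trunc c s| `^ (p - 2) * trunc c s) * trunc' c s).
Proof.
move=> p1 c0; have p0 : 0 < p by apply: lt_trans p1.
have ci0 : 0 <= c^-1 by rewrite invr_ge0 ltW.
have ct : continuous (trunc c) by move=> s; exact: is_derive1_continuous (is_derive_trunc c s).
split => [s|s|].
- exact: (@is_derive1_comp_fun (fun t => `|t| `^ p) (trunc c) s _ _ (is_derive_normr_powR _ p1)
    (is_derive_trunc c s)).
- apply: cvgM; last exact: continuous_trunc'.
  apply: cvgMr; apply: (@cvg_comp _ _ _ (trunc c) (fun t => `|t| `^ (p - 2) * t)).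
    exact: ct.
  exact: continuous_spow.
exists (c^-1 `^ p + p * c^-1 `^ (p - 1)) => s.
have pk0 : 0 <= p * c^-1 `^ (p - 1) by rewrite mulr_ge0 ?powR_ge0// ltW.
rewrite ger0_norm ?powR_ge0//; split.
  rewrite (@le_trans _ _ (c^-1 `^ p)) ?lerDl//.
  by rewrite ge0_ler_powR ?nnegrE ?norm_trunc_bound// ltW.
rewrite 2!normrM norm_spow// (gtr0_norm p0).
apply: (@le_trans _ _ (p * c^-1 `^ (p - 1))); last by rewrite lerDr powR_ge0.
rewrite -[leRHS]mulr1; apply: ler_pM => //; first by rewrite mulr_ge0 ?powR_ge0// ltW.
  by rewrite ler_pM2l// ge0_ler_powR ?nnegrE ?norm_trunc_bound// subr_ge0 ltW.
exact: trunc'_le1.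
Qed.

Lemma C1_bounded_smoothpos_powR p e : 1 < p -> 0 < e ->
  C1_bounded (fun t => smoothpos e t `^ (1 - p))
    (fun t => (1 - p) * smoothpos e t `^ (- p) * smoothpos' e t).
Proof.
move=> p1 e0; have p0 : 0 < p by apply: lt_trans p1.
have sp0 t : 0 < smoothpos e t by apply: lt_le_trans (smoothpos_ge t e0).1.
have cs : continuous (smoothpos e) by move=> s; exact: is_derive1_continuous (is_derive_smoothpos s e0).
have le_neg r t : 0 <= r -> smoothpos e t `^ (- r) <= e `^ (- r).
  move=> r0; rewrite !powRN lef_pV2 ?posrE ?powR_gt0//.
  by apply: ge0_ler_powR; rewrite ?nnegrE ?(ltW e0) ?(ltW (sp0 t))// (smoothpos_ge t e0).1.
split => [t|t|].
- have := @is_derive1_comp_fun (fun t => t `^ (1 - p)) (smoothpos e) t _ _ (is_derive1_powR (1 -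
    p) (sp0 t)) (is_derive_smoothpos t e0).
  by rewrite (_ : 1 - p - 1 = - p)//; ring.
- apply: cvgM; last exact: continuous_smoothpos'.
  apply: cvgMr; apply: (@cvg_comp _ _ _ (smoothpos e) (fun t => t `^ (- p))).
    exact: cs.
  exact: is_derive1_continuous (is_derive1_powR (- p) (sp0 t)).
exists (e `^ (1 - p) + (p - 1) * e `^ (- p)) => t.
have pk0 : 0 <= (p - 1) * e `^ (- p) by rewrite mulr_ge0 ?powR_ge0// subr_ge0 ltW.
rewrite ger0_norm ?powR_ge0//; split.
  rewrite (@le_trans _ _ (e `^ (1 - p))) ?lerDl//.
  by rewrite -opprB le_neg// subr_ge0 ltW.
rewrite 2!normrM [`|1 - p|]distrC (gtr0_norm (_ : 0 < p - 1)) ?subr_gt0//.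
rewrite (ger0_norm (powR_ge0 _ _)).
apply: (@le_trans _ _ ((p - 1) * e `^ (- p))); last by rewrite lerDr powR_ge0.
rewrite -[leRHS]mulr1; apply: ler_pM => //.
- by rewrite mulr_ge0 ?powR_ge0// subr_ge0 ltW.
- by rewrite ler_pM2l ?subr_gt0// le_neg// ltW.
- exact: smoothpos'_bound.
Qed.

End powers.

(** * Convergence of integrals *)

Section integral_convergence.
Context d (T : measurableType d) (R : realType).
Variables (mu : {measure set T -> \bar R}) (D : set T).
Hypothesis mD : measurable D.
Implicit Types (F G : nat -> T -> R).

Lemma cvg_subseq (X : topologicalType) (u : nat -> X) (l : X) (s : nat -> nat) :
  (forall k, (k <= s k)%N) -> u n @[n --> \oo] --> l -> u (s k) @[k --> \oo] --> l.
Proof.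
move=> ks; apply: cvg_comp => A [n _ nA]; exists n => // k /= nk; apply: nA.
exact: leq_trans (ks k).
Qed.

Lemma cvg_int0_le F G (C : R) :
  0 <= C -> (forall n, measurable_fun D (F n)) -> (forall n, measurable_fun D (G n)) ->
  (forall n x, D x -> 0 <= F n x <= C * G n x) -> (forall n x, D x -> 0 <= G n x) ->
  (\int[mu]_(x in D) (G n x)%:E)%E @[n --> \oo] --> 0%E ->
  (\int[mu]_(x in D) (F n x)%:E)%E @[n --> \oo] --> 0%E.
Proof.
move=> C0 mF mG FG Gp G0.
have H : (fun n => C%:E * \int[mu]_(x in D) (G n x)%:E)%E @ \oo --> 0%E.
  by rewrite -(mule0 C%:E); apply: cvgeZl.
apply: (squeeze_cvge _ (cvg_cst 0%E) H); apply: nearW => n; apply/andP; split.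
  by apply: integral_ge0 => x Dx; rewrite lee_fin; have /andP[] := FG n x Dx.
rewrite -ge0_integralZl_EFin//; last 2 first.
- by move=> x Dx; rewrite lee_fin Gp.
- exact/measurable_EFinP.
apply: ge0_le_integral => //.
- by move=> x Dx; rewrite lee_fin; have /andP[] := FG n x Dx.
- exact/measurable_EFinP.
- by apply: emeasurable_funM => //; exact/measurable_EFinP.
- by move=> x Dx; rewrite -EFinM lee_fin; have /andP[] := FG n x Dx.
Qed.

Lemma cvg_int0D F G :
  (forall n, measurable_fun D (F n)) -> (forall n, measurable_fun D (G n)) ->
  (forall n x, D x -> 0 <= F n x) -> (forall n x, D x -> 0 <= G n x) ->
  (\int[mu]_(x in D) (F n x)%:E)%E @[n --> \oo] --> 0%E ->
  (\int[mu]_(x in D) (G n x)%:E)%E @[n --> \oo] --> 0%E ->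
  (\int[mu]_(x in D) (F n x + G n x)%:E)%E @[n --> \oo] --> 0%E.
Proof.
move=> mF mG Fp Gp F0 G0.
have -> : (fun n => \int[mu]_(x in D) (F n x + G n x)%:E)%E =
    (fun n => \int[mu]_(x in D) (F n x)%:E)%E \+ (fun n => \int[mu]_(x in D) (G n x)%:E)%E.
  apply/funext => n /=; rewrite -ge0_integralD//.
  - by move=> x Dx; rewrite lee_fin Fp.
  - exact/measurable_EFinP.
  - by move=> x Dx; rewrite lee_fin Gp.
  - exact/measurable_EFinP.
by rewrite -(adde0 0%E); apply: cvgeD.
Qed.

(** Choose indices whose integrals are at most 2^{-(k+1)}. The sum of the chosen functions is
    integrable, hence finite almost everywhere, so its terms tend to 0. The indices need not
    increase: [k <= s k] already transfers limits. *)
Lemma cvg_int0_ae_subseq F :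
  (forall n, measurable_fun D (F n)) -> (forall n x, D x -> 0 <= F n x) ->
  (\int[mu]_(x in D) (F n x)%:E)%E @[n --> \oo] --> 0%E ->
  exists s : nat -> nat, (forall k, (k <= s k)%N) /\
    {ae mu, forall x, D x -> F (s k) x @[k --> \oo] --> (0 : R)}.
Proof.
move=> mF Fp F0.
have Ip n : (0 <= \int[mu]_(x in D) (F n x)%:E)%E.
  by apply: integral_ge0 => x Dx; rewrite lee_fin Fp.
have H k : exists n, (k <= n)%N /\ (\int[mu]_(x in D) (F n x)%:E <= (1 / (2 ^ k.+1)%:R)%:E)%E.
  have e0 : 0 < 1 / (2 ^ k.+1)%:R :> R by rewrite divr_gt0// ltr0n expn_gt0.
  have /fine_cvgP[[n1 _ fF] /cvgrPdist_le /(_ _ e0) [n2 _ nF]] := F0.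
  exists (maxn k (maxn n1 n2)); split; first exact: leq_maxl.
  have /nF : (n2 <= maxn k (maxn n1 n2))%N by rewrite !leq_max leqnn !orbT.
  have /fF : (n1 <= maxn k (maxn n1 n2))%N by rewrite !leq_max leqnn !orbT.
  move=> /fineK <-; rewrite lee_fin /= sub0r normrN ger0_norm//.
  by rewrite fine_ge0.
have [s sP] := choice H; exists s; split; first by move=> k; have [] := sP k.
pose S (x : T) : \bar R := (\sum_(k <oo) (F (s k) x)%:E)%E.
have S0 x : D x -> (0 <= S x)%E by move=> Dx; apply: nneseries_ge0 => k _ _; rewrite lee_fin Fp.
have mS : measurable_fun D S.
  apply: ge0_emeasurable_sum => [k x Dx _|k _]; first by rewrite lee_fin Fp.
  exact/measurable_EFinP.
have iS : mu.-integrable D S.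
  apply/integrableP; split => //.
  rewrite (@eq_integral _ _ _ mu D S); last by move=> x; rewrite inE => Dx; rewrite gee0_abs// S0.
  rewrite integral_nneseries//; last 2 first.
  - by move=> k; exact/measurable_EFinP.
  - by move=> k x Dx; rewrite lee_fin Fp.
  apply: (@le_lt_trans _ _ (\sum_(k <oo) (1 / (2 ^ k.+1)%:R)%:E)%E).
    by apply: lee_nneseries => k _ //; have [] := sP k.
  by apply: le_lt_trans (epsilon_trick0 _ _) _; rewrite ?ltry.
have := integrable_ae mD iS; apply: filterS => x /[swap] Dx /(_ Dx) Sfin.
have Sx : (S x < +oo)%E by rewrite ltey_eq Sfin.
apply: cvg_series_cvg_0; apply: nnseries_is_cvg => [n|]; last exact: Sx.
exact: Fp.
Qed.

Lemma le_integrable_EFin (f g : T -> R) : measurable_fun D f ->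
  (forall x, D x -> `|f x| <= g x) ->
  mu.-integrable D (EFin \o g) -> mu.-integrable D (EFin \o f).
Proof.
move=> mf fg; apply: le_integrable => //; first exact/measurable_EFinP.
by move=> x Dx /=; rewrite lee_fin (le_trans (fg x Dx))// ler_norm.
Qed.

Lemma integrable_EFinD (f g : T -> R) : mu.-integrable D (EFin \o f) ->
  mu.-integrable D (EFin \o g) -> mu.-integrable D (EFin \o (fun x => f x + g x)).
Proof. exact: integrableD. Qed.

Lemma integrable_EFinB (f g : T -> R) : mu.-integrable D (EFin \o f) ->
  mu.-integrable D (EFin \o g) -> mu.-integrable D (EFin \o (fun x => f x - g x)).
Proof.
exact: integrableB.
Qed.

Lemma integrable_EFinM (k : R) (f : T -> R) : mu.-integrable D (EFin \o f) ->
  mu.-integrable D (EFin \o (fun x => k * f x)).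
Proof. exact: integrableZl. Qed.

Lemma Rintegral_dominated_cvg F (f g : T -> R) :
  (forall n, measurable_fun D (F n)) -> measurable_fun D f ->
  {ae mu, forall x, D x -> F n x @[n --> \oo] --> f x} ->
  mu.-integrable D (EFin \o g) ->
  {ae mu, forall x, D x -> forall n, `|F n x| <= g x} ->
  mu.-integrable D (EFin \o f) /\
  (\int[mu]_(x in D) F n x) @[n --> \oo] --> \int[mu]_(x in D) f x.
Proof.
move=> mF mf Ff ig Fg.
have [] := @dominated_convergence _ _ _ mu D mD (fun n => EFin \o F n) (EFin \o f) (EFin \o g).
- by move=> n; exact/measurable_EFinP.
- exact/measurable_EFinP.
- by apply: filterS Ff => x H Dx; apply/cvg_EFin; [exact: nearW|exact: H].
- exact: ig.
- by apply: filterS Fg => x H n Dx; rewrite /= lee_fin H.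
move=> If _ H; split => //; apply: fine_cvg.
by rewrite fineK//; exact: integrable_fin_num.
Qed.

Lemma cvg_int0_dominated F (g : T -> R) :
  (forall n, measurable_fun D (F n)) ->
  {ae mu, forall x, D x -> F n x @[n --> \oo] --> (0 : R)} ->
  mu.-integrable D (EFin \o g) ->
  (forall n x, D x -> `|F n x| <= g x) ->
  (\int[mu]_(x in D) (F n x)%:E)%E @[n --> \oo] --> 0%E.
Proof.
move=> mF F0 ig Fg.
have [] := @dominated_convergence _ _ _ mu D mD (fun n => EFin \o F n) (cst 0%E) (EFin \o g).
- by move=> n; exact/measurable_EFinP.
- exact: measurable_cst.
- by apply: filterS F0 => x H Dx; apply/cvg_EFin; [exact: nearW|exact: H].
- exact: ig.
- by apply: aeW => x n Dx; rewrite /= lee_fin Fg.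
by move=> _ _; rewrite integral0.
Qed.

End integral_convergence.

(** * The Euclidean norm and measurability of vector fields *)

Section euclidean_norm.
Context {R : realType} {N : nat}.
Implicit Types x y : 'rV[R]_N.

Lemma dotp_ge0 x : 0 <= dotp x x.
Proof.
by apply: sumr_ge0 => i _; rewrite -expr2 sqr_ge0.
Qed.

Lemma enorm_ge0 x : 0 <= enorm x.
Proof.
exact: sqrtr_ge0.
Qed.

Lemma sqr_enorm x : enorm x ^+ 2 = dotp x x.
Proof.
by rewrite sqr_sqrtr// dotp_ge0.
Qed.

Lemma dotpC x y : dotp x y = dotp y x.
Proof.
by apply: eq_bigr => i _; rewrite mulrC.
Qed.

Lemma dotpDl x y z : dotp (x + y) z = dotp x z + dotp y z.
Proof.
by rewrite -big_split; apply: eq_bigr => i _; rewrite mxE mulrDl.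
Qed.

Lemma dotpZl (a : R) x y : dotp (a *: x) y = a * dotp x y.
Proof.
by rewrite /dotp mulr_sumr; apply: eq_bigr => i _; rewrite mxE mulrA.
Qed.

Lemma dotpDr x y z : dotp x (y + z) = dotp x y + dotp x z.
Proof.
by rewrite dotpC dotpDl !(dotpC x).
Qed.

Lemma dotpZr (a : R) x y : dotp x (a *: y) = a * dotp x y.
Proof.
by rewrite dotpC dotpZl dotpC.
Qed.

Lemma coord_le_enorm x i : `|x ord0 i| <= enorm x.
Proof.
suff : `|x ord0 i| ^+ 2 <= enorm x ^+ 2 by rewrite ler_sqr// nnegrE ?enorm_ge0.
rewrite sqr_enorm real_normK ?num_real// /dotp (bigD1 i)//= expr2 lerDl.
by apply: sumr_ge0 => j _; rewrite -expr2 sqr_ge0.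
Qed.

(** Cauchy-Schwarz: the square of | |z| t - |t| z | equals 2 |z| |t| (|z| |t| - z.t), and it is
    nonnegative. *)
Lemma norm_dotp_le x y : `|dotp x y| <= enorm x * enorm y.
Proof.
suff H (z t : 'rV[R]_N) : dotp z t <= enorm z * enorm t.
  rewrite ler_norml H andbT lerNl -mulN1r -dotpZl.
  rewrite (le_trans (H _ _))// le_eqVlt; apply/orP; left; apply/eqP.
  congr (_ * _); congr Num.sqrt; rewrite dotpZl dotpZr; ring.
have [z0|z0] := eqVneq (enorm z) 0.
  rewrite z0 mul0r /dotp big1// => i _.
  have := coord_le_enorm z i; rewrite z0 normr_le0 => /eqP ->; exact: mul0r.
have [t0|t0] := eqVneq (enorm t) 0.
  rewrite t0 mulr0 /dotp big1// => i _.
  have := coord_le_enorm t i; rewrite t0 normr_le0 => /eqP ->; exact: mulr0.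
have zp : 0 < enorm z by rewrite lt_neqAle eq_sym z0 enorm_ge0.
have tp : 0 < enorm t by rewrite lt_neqAle eq_sym t0 enorm_ge0.
have := dotp_ge0 (enorm z *: t + (- enorm t) *: z).
rewrite !dotpDl !dotpDr !dotpZl !dotpZr -!sqr_enorm (dotpC t z).
rewrite (_ : _ + _ = 2 * (enorm z * enorm t) * (enorm z * enorm t - dotp z t)); last by ring.
by rewrite pmulr_rge0 ?subr_ge0// !mulr_gt0.
Qed.

Lemma dotp_le x y : dotp x y <= enorm x * enorm y.
Proof.
exact: le_trans (ler_norm _) (norm_dotp_le x y).
Qed.

Lemma enormD x y : enorm (x + y) <= enorm x + enorm y.
Proof.
suff : enorm (x + y) ^+ 2 <= (enorm x + enorm y) ^+ 2.
  by rewrite ler_sqr// nnegrE ?enorm_ge0// addr_ge0// enorm_ge0.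
rewrite sqrrD !sqr_enorm dotpDl !dotpDr (dotpC y x).
by have := dotp_le x y; rewrite -mulr_natl; lra.
Qed.

Lemma enormZ (a : R) x : enorm (a *: x) = `|a| * enorm x.
Proof.
by rewrite /enorm dotpZl dotpZr mulrA -expr2 sqrtrM ?sqr_ge0// sqrtr_sqr.
Qed.

Lemma enormN x : enorm (- x) = enorm x.
Proof.
by rewrite -scaleN1r enormZ normrN1 mul1r.
Qed.

Lemma enorm_le_sum x : enorm x <= \sum_i `|x ord0 i|.
Proof.
have s0 : 0 <= \sum_i `|x ord0 i| by apply: sumr_ge0.
suff : enorm x ^+ 2 <= (\sum_i `|x ord0 i|) ^+ 2 by rewrite ler_sqr// nnegrE// enorm_ge0.
rewrite sqr_enorm expr2 mulr_suml; apply: ler_sum => i _.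
rewrite (le_trans (ler_norm _))// normrM ler_wpM2l//.
by rewrite (bigD1 i)//= lerDl sumr_ge0.
Qed.

Lemma measurable_dotp d (T : measurableType d) (D : set T) (G H : T -> 'rV[R]_N) :
  (forall i, measurable_fun D (fun z => G z ord0 i)) ->
  (forall i, measurable_fun D (fun z => H z ord0 i)) ->
  measurable_fun D (fun z => dotp (G z) (H z)).
Proof.
by move=> mG mH; apply: measurable_sum => i; exact: measurable_funM.
Qed.

Lemma measurable_enorm d (T : measurableType d) (D : set T) (G : T -> 'rV[R]_N) :
  (forall i, measurable_fun D (fun z => G z ord0 i)) ->
  measurable_fun D (fun z => enorm (G z)).
Proof.
move=> mG; apply: (measurableT_comp (continuous_measurable_fun (@sqrt_continuous R))).
exact: measurable_dotp.
Qed.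

Lemma measurable_distr d (T : measurableType d) (D : set T) (f g : T -> R) :
  measurable_fun D f -> measurable_fun D g -> measurable_fun D (fun z => `|f z - g z|).
Proof.
move=> mf mg; apply: measurableT_comp; first exact: normr_measurable.
exact: measurable_funB.
Qed.

Lemma measurable_coordB d (T : measurableType d) (D : set T) (G H : T -> 'rV[R]_N) i :
  measurable_fun D (fun z => G z ord0 i) -> measurable_fun D (fun z => H z ord0 i) ->
  measurable_fun D (fun z => (G z - H z) ord0 i).
Proof.
move=> mG mH; under eq_fun do rewrite !mxE.
exact: measurable_funB.
Qed.

Lemma measurable_lincomb d (T : measurableType d) (D : set T) (a b : T -> R)
    (G H : T -> 'rV[R]_N) i :
  measurable_fun D a -> measurable_fun D b ->
  measurable_fun D (fun z => G z ord0 i) -> measurable_fun D (fun z => H z ord0 i) ->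
  measurable_fun D (fun z => (a z *: G z + b z *: H z) ord0 i).
Proof.
move=> ma mb mG mH; under eq_fun do rewrite !mxE.
by apply: measurable_funD; exact: measurable_funM.
Qed.

Lemma measurable_powR_fun d (T : measurableType d) (D : set T) (r : R) (f : T -> R) :
  measurable_fun D f -> measurable_fun D (fun z => f z `^ r).
Proof.
exact: measurableT_comp (measurable_powR r).
Qed.

End euclidean_norm.

(** * Functions of class C^1 and their gradients *)

Lemma continuous_mulr {R : realType} (T : topologicalType) (f g : T -> R) :
  continuous f -> continuous g -> continuous (fun x => f x * g x).
Proof.
by move=> cf cg x; apply: cvgM; [exact: cf|exact: cg].
Qed.

Lemma continuous_addr {R : realType} (T : topologicalType) (f g : T -> R) :
  continuous f -> continuous g -> continuous (fun x => f x + g x).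
Proof.
by move=> cf cg x; apply: cvgD; [exact: cf|exact: cg].
Qed.

Lemma continuous_compr {R : realType} (T : topologicalType) (f : T -> R) (g : R -> R) :
  continuous f -> continuous g -> continuous (fun x => g (f x)).
Proof.
by move=> cf cg x; apply: continuous_comp; [exact: cf|exact: cg].
Qed.

Section C1_functions.
Context {R : realType} {N : nat}.
Implicit Types (phi psi : 'rV[R]_N -> R).

Lemma bounded_continuous (Omega : set 'rV[R]_N) phi :
  bounded_set Omega -> continuous phi ->
  exists M, forall x, Omega x -> `|phi x| <= M.
Proof.
move=> [M [Mreal OM]] cphi.
have MM : M < `|M| + 1 by rewrite (le_lt_trans (ler_norm M))// ltrDl.
pose K : set 'rV[R]_N := [set v | forall i, `[- (`|M| + 1), `|M| + 1]%classic (v ord0 i)].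
have cK : compact K by apply: (@rV_compact R N (fun=> `[- (`|M| + 1), `|M| + 1]%classic)) => i;
    exact: segment_compact.
have := @continuous_compact _ _ phi K (continuous_subspaceT cphi) cK.
move=> /compact_bounded [B [_ BP]]; exists (B + 1) => x Ox.
apply: (BP (B + 1)); first by rewrite ltrDl.
exists x => // i; have := le_trans (coord_le_norm x i) (OM _ MM _ Ox).
by rewrite ler_norml /= in_itv.
Qed.

Lemma partial_comp i phi (f : R -> R) (a : R) x : differentiable phi x ->
  is_derive (phi x) 1 f a -> partial i (f \o phi) x = a * partial i phi x.
Proof.
move=> dphi [df <-]; have /derivable1_diffP df' := df.
rewrite /partial deriveE; last exact: differentiable_comp.
rewrite diff_comp//= diff1E// derive1E /GRing.scale/=.
by rewrite (deriveE _ dphi) mulrC.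
Qed.

Lemma partialM i phi psi x : differentiable phi x -> differentiable psi x ->
  partial i (fun y => phi y * psi y) x = phi x * partial i psi x + psi x * partial i phi x.
Proof.
move=> dphi dpsi; have := @deriveM _ _ phi psi x (delta_mx ord0 i).
by rewrite /partial /GRing.scale/=; apply; exact: diff_derivable.
Qed.

Lemma Ck1_comp phi (f f' : R -> R) : Ck 1 phi ->
  (forall x : R, is_derive x 1 f (f' x)) -> continuous f' -> Ck 1 (f \o phi).
Proof.
move=> [dphi cphi] df cf'; split.
  move=> x; apply: differentiable_comp => //; apply/derivable1_diffP.
  by have [] := df (phi x).
move=> i /=; rewrite (_ : partial i _ = fun x => f' (phi x) * partial i phi x).
  apply: continuous_mulr; last exact: cphi.
  apply: continuous_compr => // x; exact: differentiable_continuous.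
by apply/funext => x; apply: partial_comp.
Qed.

Lemma Ck1M phi psi : Ck 1 phi -> Ck 1 psi -> Ck 1 (fun x => phi x * psi x).
Proof.
move=> [dphi cphi] [dpsi cpsi]; split; first by move=> x; exact: differentiableM.
move=> i /=; rewrite (_ : partial i _ = fun x => phi x * partial i psi x + psi x * partial i phi x).
  apply: continuous_addr; apply: continuous_mulr; [|exact: cpsi| |exact: cphi];
    by move=> x; exact: differentiable_continuous.
by apply/funext => x; apply: partialM.
Qed.

Lemma Ck1_continuous phi : Ck 1 phi -> continuous phi.
Proof.
by move=> [dphi _] x; exact: differentiable_continuous.
Qed.

Lemma gradientM phi psi x : Ck 1 phi -> Ck 1 psi ->
  gradient (fun y => phi y * psi y) x = phi x *: gradient psi x + psi x *: gradient phi x.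
Proof.
by move=> [dphi _] [dpsi _]; apply/rowP => i; rewrite !mxE partialM.
Qed.

Lemma gradient_comp phi (f f' : R -> R) x : Ck 1 phi ->
  (forall x : R, is_derive x 1 f (f' x)) ->
  gradient (f \o phi) x = f' (phi x) *: gradient phi x.
Proof.
by move=> [dphi _] df; apply/rowP => i; rewrite !mxE (partial_comp i (dphi x) (df _)).
Qed.

Lemma measurable_gradient phi i (D : set (RN R N)) : Ck 1 phi ->
  measurable_fun D (fun x : RN R N => gradient phi x ord0 i).
Proof.
move=> [_ cphi]; rewrite (_ : (fun x => _) = partial i phi).
  by apply: measurable_fun_continuous; exact: cphi.
by apply/funext => x; rewrite mxE.
Qed.

Lemma bounded_gradient (Omega : set 'rV[R]_N) phi :
  bounded_set Omega -> Ck 1 phi ->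
  exists M, forall x, Omega x -> enorm (gradient phi x) <= M.
Proof.
move=> bO [_ cphi].
have [M MP] := choice (fun i => bounded_continuous bO (cphi i)).
exists (\sum_i M i) => x Ox; apply: le_trans (enorm_le_sum _) _.
by apply: ler_sum => i _; rewrite mxE MP.
Qed.

End C1_functions.

(** * The space W^{1,p}_0 *)

Section sobolev_space.
Context {R : realType} {N : nat}.
Variables (Omega : set (RN R N)) (p : R).
Hypotheses (oO : open (Omega : set 'rV[R]_N)) (bO : bounded_set (Omega : set 'rV[R]_N)).
Hypothesis p1 : 1 < p.
Local Notation mu := (@leb R N).
Local Notation T := (RN R N).
Implicit Types (u v : T -> R) (G H : T -> 'rV[R]_N).

Let mO : measurable Omega.
Proof.
exact: measurable_open.
Qed.

Let Ooo : (mu Omega < +oo)%E.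
Proof.
exact: lebesgue_outer_bounded.
Qed.

Let p0 : 0 < p.
Proof.
exact: lt_trans p1.
Qed.

Let powR_le (a b : R) : 0 <= a -> a <= b -> a `^ p <= b `^ p.
Proof.
by move=> a0 ab; apply: ge0_ler_powR; rewrite ?nnegrE// ?(ltW p0)// (le_trans a0).
Qed.

Lemma integrable_bounded (f : T -> R) (M : R) :
  measurable_fun Omega f -> (forall x, Omega x -> `|f x| <= M) ->
  mu.-integrable Omega (EFin \o f).
Proof.
move=> mf fM; apply: (le_integrable_EFin mO mf fM).
apply: measurable_bounded_integrable => //.
exists `|M|; split; first exact: num_real.
by move=> x Mx y _ /=; apply: ltW.
Qed.

(** Some approximant is at finite L^p distance, and it is bounded with bounded gradient on the
    bounded set [Omega]. *)
Lemma W0_integrable_pow u G : W0 Omega p u G ->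
  mu.-integrable Omega (EFin \o (fun x => `|u x| `^ p)) /\
  mu.-integrable Omega (EFin \o (fun x => enorm (G x) `^ p)).
Proof.
move=> [mu_ mG [phi [phiC phiu phiG]]].
have mdiff n : measurable_fun Omega (fun x : T => `|phi n x - u x| `^ p).
  apply: measurable_powR_fun; apply: measurableT_comp => //.
  apply: measurable_funB => //; apply: measurable_fun_continuous.
  exact: Ck1_continuous (phiC n).1.
have mgdiff n : measurable_fun Omega (fun x : T => enorm (gradient (phi n) x - G x) `^ p).
  apply: measurable_powR_fun; apply: measurable_enorm => i.
  apply: measurable_coordB; first exact: measurable_gradient (phiC n).1.
  exact: mG.
have fin (F : nat -> T -> R) : (forall n, measurable_fun Omega (F n)) ->
    (forall n x, 0 <= F n x) ->
    (\int[mu]_(x in Omega) (F n x)%:E)%E @[n --> \oo] --> 0%E ->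
    exists n, mu.-integrable Omega (EFin \o F n).
  move=> mF Fp /fine_cvgP[[n _ nF] _]; exists n; apply/integrableP; split.
    exact/measurable_EFinP.
  rewrite (@eq_integral _ _ _ mu Omega (EFin \o F n)); last first.
    by move=> x _ /=; rewrite ger0_norm.
  by have := nF n (leqnn n); rewrite /= fin_numElt => /andP[].
split.
- have [n In] := fin (fun n x => `|phi n x - u x| `^ p) mdiff (fun _ _ => powR_ge0 _ _) phiu.
  have [M MP] := bounded_continuous bO (Ck1_continuous (phiC n).1).
  apply: (@le_integrable_EFin _ _ _ _ _ mO _ (fun x => 2 `^ p * (`|phi n x - u x| `^ p + `|phi n
      x| `^ p))).
  + by apply: measurable_powR_fun; apply: measurableT_comp.
  + move=> x Ox; rewrite ger0_norm ?powR_ge0//.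
    apply: le_trans (powRD_le (ltW p0) (normr_ge0 _) (normr_ge0 _)).
    apply: powR_le => //.
    by have := ler_normB (phi n x) (phi n x - u x); rewrite subKr addrC.
  apply: integrable_EFinM => //; apply: integrable_EFinD => //.
  apply: (@integrable_bounded _ (M `^ p)).
    apply: measurable_powR_fun; apply: measurableT_comp => //.
    by apply: measurable_fun_continuous; exact: Ck1_continuous (phiC n).1.
  by move=> x Ox; rewrite ger0_norm ?powR_ge0// powR_le// MP.
- have [n In] := fin (fun n x => enorm (gradient (phi n) x - G x) `^ p) mgdiff (fun _ _ =>
    powR_ge0 _ _) phiG.
  have [M MP] := bounded_gradient bO (phiC n).1.
  apply: (@le_integrable_EFin _ _ _ _ _ mO _ (fun x => 2 `^ p * (enorm (gradient (phi n) x - G x)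
      `^ p + enorm (gradient (phi n) x) `^ p))).
  + by apply: measurable_powR_fun; exact: measurable_enorm.
  + move=> x Ox; rewrite ger0_norm ?powR_ge0//.
    apply: le_trans (powRD_le (ltW p0) (enorm_ge0 _) (enorm_ge0 _)).
    apply: powR_le; first exact: enorm_ge0.
    have := enormD (gradient (phi n) x) (- (gradient (phi n) x - G x)).
    by rewrite enormN subKr addrC.
  apply: integrable_EFinM => //; apply: integrable_EFinD => //.
  apply: (@integrable_bounded _ (M `^ p)).
    by apply: measurable_powR_fun; apply: measurable_enorm => i; exact: measurable_gradient (phiC n).1.
  by move=> x Ox; rewrite ger0_norm ?powR_ge0// powR_le ?enorm_ge0// MP.
Qed.

Lemma cvg_pow_le3 (A : nat -> T -> R) (B C E : nat -> T -> R) (M : R) :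
  0 <= M ->
  (forall n, measurable_fun Omega (A n)) -> (forall n, measurable_fun Omega (B n)) ->
  (forall n, measurable_fun Omega (C n)) -> (forall n, measurable_fun Omega (E n)) ->
  (forall n x, [/\ 0 <= A n x, 0 <= B n x, 0 <= C n x & 0 <= E n x]) ->
  (forall n x, Omega x -> A n x <= M * (B n x + (C n x + E n x))) ->
  (\int[mu]_(x in Omega) (B n x `^ p)%:E)%E @[n --> \oo] --> 0%E ->
  (\int[mu]_(x in Omega) (C n x `^ p)%:E)%E @[n --> \oo] --> 0%E ->
  (\int[mu]_(x in Omega) (E n x `^ p)%:E)%E @[n --> \oo] --> 0%E ->
  (\int[mu]_(x in Omega) (A n x `^ p)%:E)%E @[n --> \oo] --> 0%E.
Proof.
move=> M0 mA mB mC mE pos AB B0 C0 E0.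
apply: (@cvg_int0_le _ _ _ mu Omega mO _
  (fun n x => B n x `^ p + (C n x `^ p + E n x `^ p)) (M `^ p * (2 `^ p * (1 + 2 `^ p)))).
- by rewrite !mulr_ge0 ?addr_ge0 ?powR_ge0.
- by move=> n; exact: measurable_powR_fun.
- by move=> n; apply: measurable_funD; [|apply: measurable_funD]; exact: measurable_powR_fun.
- move=> n x Ox; have [A0 B0' C0' E0'] := pos n x; rewrite powR_ge0/=.
  apply: le_trans (powR_le A0 (AB n x Ox)) _.
  rewrite powRM// ?addr_ge0// -!mulrA ler_wpM2l ?powR_ge0//.
  apply: le_trans (powRD_le (ltW p0) B0' (addr_ge0 C0' E0')) _.
  rewrite ler_wpM2l ?powR_ge0//.
  rewrite [leRHS]mulrDl mul1r; apply: lerD; first by rewrite lerDl addr_ge0 ?powR_ge0.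
  apply: le_trans (powRD_le (ltW p0) C0' E0') _.
  by rewrite ler_wpM2l ?powR_ge0// lerDr powR_ge0.
- by move=> n x Ox; rewrite !addr_ge0 ?powR_ge0.
- have mp (F : nat -> T -> R) : (forall n, measurable_fun Omega (F n)) ->
      forall n, measurable_fun Omega (fun x => F n x `^ p).
    by move=> mF n; exact: measurable_powR_fun.
  have pp (F : nat -> T -> R) n x : Omega x -> 0 <= F n x `^ p by rewrite powR_ge0.
  apply: (cvg_int0D mO (mp _ mB) _ (pp B) _ B0).
  + by move=> n; apply: measurable_funD; exact: mp.
  + by move=> n x Ox; rewrite addr_ge0 ?pp.
  + exact: (cvg_int0D mO (mp _ mC) (mp _ mE) (pp C) (pp E) C0 E0).
Qed.

(** The products m phi_n are approximants: the error in the gradient is m (Dphi_n - G) + (phi_n - u)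
    Dm, where m and Dm are bounded on [Omega]. *)
Lemma W0_mul_smooth (m : 'rV[R]_N -> R) u G : Ck 1 m -> W0 Omega p u G ->
  W0 Omega p (fun x => m x * u x) (fun x => m x *: G x + u x *: gradient m x).
Proof.
move=> mC [mu_ mG [phi [phiC phiu phiG]]].
have mm : measurable_fun Omega (m : T -> R) by apply: measurable_fun_continuous; exact: Ck1_continuous.
have mphi n : measurable_fun Omega (phi n : T -> R).
  by apply: measurable_fun_continuous; exact: Ck1_continuous (phiC n).1.
have mgm i : measurable_fun Omega (fun x : T => gradient m x ord0 i) by exact: measurable_gradient.
have [M MP] := bounded_continuous bO (Ck1_continuous mC).
have [M' MP'] := bounded_gradient bO mC.
have mdiff n : measurable_fun Omega (fun x : T => `|phi n x - u x|).
  exact: measurable_distr (mphi n) mu_.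
have mgdiff n : measurable_fun Omega (fun x : T => enorm (gradient (phi n) x - G x)).
  apply: measurable_enorm => i.
  apply: measurable_coordB; first exact: measurable_gradient (phiC n).1.
  exact: mG.
have mcoef i : measurable_fun Omega (fun x : T => (m x *: G x + u x *: gradient m x) ord0 i).
  exact: (measurable_lincomb mm mu_ (mG i) (mgm i)).
have C1 n : Ck 1 (fun x => m x * phi n x) by apply: Ck1M => //; exact: (phiC n).1.
have z0 : (\int[mu]_(x in Omega) ((0 : R) `^ p)%:E)%E @[n --> \oo] --> 0%E.
  by rewrite powR0 ?gt_eqF// integral0; exact: cvg_cst.
have M0 : 0 <= `|M| + `|M'| by rewrite addr_ge0.
have mc0 (n : nat) : measurable_fun Omega (fun _ : T => 0 : R) by exact: measurable_cst.
split; [exact: (measurable_funM mm mu_)|exact: mcoef|].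
exists (fun n x => m x * phi n x); split.
- move=> n; split => //; have [_ [K [cK KO K0]]] := phiC n.
  by exists K; split => // x Kx; rewrite K0// mulr0.
- apply: (@cvg_pow_le3 _ (fun n x => `|phi n x - u x|) (fun _ _ => 0) (fun _ _ => 0) _ M0 _ mdiff
    mc0 mc0 _ _ phiu z0 z0).
  + move=> n; exact: measurable_distr (measurable_funM mm (mphi n)) (measurable_funM mm mu_).
  + by move=> n x; split.
  + move=> n x Ox; rewrite !addr0 -mulrBr normrM ler_wpM2r//.
    by rewrite (le_trans (MP x Ox))// (le_trans (ler_norm M))// lerDl.
- apply: (@cvg_pow_le3 _ (fun n x => enorm (gradient (phi n) x - G x)) (fun n x => `|phi n x - u
    x|) (fun _ _ => 0) _ M0 _ mgdiff mdiff mc0 _ _ phiG phiu z0).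
  + move=> n; apply: measurable_enorm => i.
    exact: (measurable_coordB (measurable_gradient i (C1 n)) (mcoef i)).
  + by move=> n x; split; rewrite ?enorm_ge0.
  + move=> n x Ox; rewrite addr0 gradientM//; last exact: (phiC n).1.
    rewrite (_ : _ - _ = m x *: (gradient (phi n) x - G x) + (phi n x - u x) *: gradient m x);
        last first.
      by apply/rowP => i; rewrite !mxE; ring.
    apply: le_trans (enormD _ _) _; rewrite !enormZ mulrDr lerD//.
      rewrite ler_wpM2r ?enorm_ge0//.
      by rewrite (le_trans (MP x Ox))// (le_trans (ler_norm M))// lerDl.
    rewrite mulrC ler_wpM2r//.
    by rewrite (le_trans (MP' x Ox))// (le_trans (ler_norm M'))// lerDr.
Qed.

End sobolev_space.

(** * Chain and product rules in W^{1,p}_0 *)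

Section sobolev_chain_rule.
Context {R : realType} {N : nat}.
Variables (Omega : set (RN R N)) (p : R).
Hypotheses (oO : open (Omega : set 'rV[R]_N)) (bO : bounded_set (Omega : set 'rV[R]_N)).
Hypothesis p1 : 1 < p.
Local Notation mu := (@leb R N).
Local Notation T := (RN R N).
Implicit Types (u v : T -> R) (G H : T -> 'rV[R]_N).

Let mO : measurable Omega.
Proof.
exact: measurable_open.
Qed.

Let p0 : 0 < p.
Proof.
exact: lt_trans p1.
Qed.

Lemma C1_bounded_continuous (f f' : R -> R) : C1_bounded f f' -> continuous f.
Proof.
by move=> [df _ _] x; exact: is_derive1_continuous (df x).
Qed.

Lemma measurable_comp_continuous (f : R -> R) (g : T -> R) : continuous f ->
  measurable_fun Omega g -> measurable_fun Omega (fun x => f (g x)).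
Proof.
by move=> cf mg; exact: (measurableT_comp (continuous_measurable_fun cf) mg).
Qed.

Lemma cvg_powR0 (F : nat -> R) : (forall n, 0 <= F n) ->
  F n @[n --> \oo] --> (0 : R) -> F n `^ p @[n --> \oo] --> (0 : R).
Proof.
move=> Fp F0; rewrite (_ : (fun n => _) = (fun n => `|F n| `^ p)); last first.
  by apply/funext => n; rewrite ger0_norm.
have := @continuous_normr_powR _ p p0 0; rewrite /continuous_at normr0 powR0 ?gt_eqF//.
exact: cvg_comp.
Qed.

Lemma cvg_of_powR0 (F : nat -> R) (l : R) :
  `|F n - l| `^ p @[n --> \oo] --> (0 : R) -> F n @[n --> \oo] --> l.
Proof.
move=> F0; have pi0 : 0 < p^-1 by rewrite invr_gt0.
have := @continuous_normr_powR _ _ pi0 0; rewrite /continuous_at normr0 powR0 ?gt_eqF//.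
move/(cvg_comp _ _ F0) => H.
apply/subr_cvg0; apply/norm_cvg0P; apply: cvg_trans H; apply: near_eq_cvg; apply: nearW => n /=.
by rewrite ger0_norm ?powR_ge0// -powRrM divff ?gt_eqF// powRr1.
Qed.

(** Almost everywhere convergence is needed because the derivatives composed with the approximants
    are merely continuous. Extracting from the sum of the two errors gives one subsequence for both
    functions. *)
Lemma W0_ae_approx u G v H : W0 Omega p u G -> W0 Omega p v H ->
  exists phi psi : nat -> 'rV[R]_N -> R,
  [/\ forall n, C1c Omega (phi n), forall n, C1c Omega (psi n),
    [/\ (\int[mu]_(x in Omega) (`|phi n x - u x| `^ p)%:E)%E @[n --> \oo] --> 0%E,
      (\int[mu]_(x in Omega) (enorm (gradient (phi n) x - G x) `^ p)%:E)%E @[n --> \oo] --> 0%E,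
      (\int[mu]_(x in Omega) (`|psi n x - v x| `^ p)%:E)%E @[n --> \oo] --> 0%E &
      (\int[mu]_(x in Omega) (enorm (gradient (psi n) x - H x) `^ p)%:E)%E @[n --> \oo] --> 0%E],
    {ae mu, forall x, Omega x -> phi n x @[n --> \oo] --> u x} &
    {ae mu, forall x, Omega x -> psi n x @[n --> \oo] --> v x}].
Proof.
move=> [mu_ _ [phi [phiC phiu phiG]]] [mv _ [psi [psiC psiv psiH]]].
have mC (w : T -> R) (f : nat -> 'rV[R]_N -> R) n : (forall n, C1c Omega (f n)) ->
    measurable_fun Omega w -> measurable_fun Omega (fun x : T => `|f n x - w x| `^ p).
  move=> fC mw; apply: measurable_powR_fun; apply: measurable_distr => //.
  by apply: measurable_fun_continuous; exact: Ck1_continuous (fC n).1.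
have [s [sk sP]] := cvg_int0_ae_subseq mO (fun n => measurable_funD (mC u phi n phiC mu_) (mC v
    psi n psiC mv))
  (fun n x _ => addr_ge0 (powR_ge0 _ _) (powR_ge0 _ _))
  (cvg_int0D mO (fun n => mC u phi n phiC mu_) (fun n => mC v psi n psiC mv)
     (fun n x _ => powR_ge0 _ _) (fun n x _ => powR_ge0 _ _) phiu psiv).
exists (fun n => phi (s n)), (fun n => psi (s n)); split.
- by move=> n; exact: phiC.
- by move=> n; exact: psiC.
- split; [exact: (cvg_subseq sk phiu)|exact: (cvg_subseq sk phiG)|exact: (cvg_subseq sk
    psiv)|exact: (cvg_subseq sk psiH)].
- apply: filterS sP => x /[apply] H0; apply: cvg_of_powR0.
  apply: (squeeze_cvgr _ (cvg_cst (0 : R)) H0); apply: nearW => n.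
  by rewrite powR_ge0 lerDl powR_ge0.
- apply: filterS sP => x /[apply] H0; apply: cvg_of_powR0.
  apply: (squeeze_cvgr _ (cvg_cst (0 : R)) H0); apply: nearW => n.
  by rewrite powR_ge0 lerDr powR_ge0.
Qed.

(** The approximants are f(phi_n) h(psi_n); f(0) = 0 keeps their supports compact. In the gradient,
    the errors of Dphi_n and Dpsi_n have bounded coefficients, and the errors in these coefficients,
    multiplied by the fixed G and H, vanish in L^p by dominated convergence. *)
Lemma W0_mul_comp (f f' h h' : R -> R) u G v H :
  C1_bounded f f' -> f 0 = 0 -> C1_bounded h h' ->
  W0 Omega p u G -> W0 Omega p v H ->
  W0 Omega p (fun x => f (u x) * h (v x))
    (fun x => (f' (u x) * h (v x)) *: G x + (f (u x) * h' (v x)) *: H x).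
Proof.
move=> fC f0 hC uG vH.
have [mu_ mG _] := uG; have [mv mH _] := vH.
have [phi [psi [phiC psiC [phiu phiG psiv psiH] phia psia]]] := W0_ae_approx uG vH.
have cf := C1_bounded_continuous fC; have ch := C1_bounded_continuous hC.
have [Lf Lf0 fL] := C1_bounded_lipschitz fC; have [Lh Lh0 hL] := C1_bounded_lipschitz hC.
have [df cf' [Mf fM]] := fC; have [dh ch' [Mh hM]] := hC.
have Mf0 : 0 <= Mf by apply: le_trans (fM 0).1.
have Mh0 : 0 <= Mh by apply: le_trans (hM 0).1.
have mphi n : measurable_fun Omega (phi n : T -> R).
  by apply: measurable_fun_continuous; exact: Ck1_continuous (phiC n).1.
have mpsi n : measurable_fun Omega (psi n : T -> R).
  by apply: measurable_fun_continuous; exact: Ck1_continuous (psiC n).1.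
have mprod (k l : R -> R) (a b : T -> R) : continuous k -> continuous l ->
    measurable_fun Omega a -> measurable_fun Omega b ->
    measurable_fun Omega (fun x => k (a x) * l (b x)).
  move=> ck cl ma mb.
  exact: (measurable_funM (measurable_comp_continuous ck ma) (measurable_comp_continuous cl mb)).
have mcoef i : measurable_fun Omega (fun x : T =>
    ((f' (u x) * h (v x)) *: G x + (f (u x) * h' (v x)) *: H x) ord0 i).
  exact: (measurable_lincomb (mprod _ _ _ _ cf' ch mu_ mv) (mprod _ _ _ _ cf ch' mu_ mv) (mG i) (mH i)).
have C1f n : Ck 1 (f \o phi n) := Ck1_comp (phiC n).1 df cf'.
have C1h n : Ck 1 (h \o psi n) := Ck1_comp (psiC n).1 dh ch'.
have C1 n : Ck 1 (fun x => f (phi n x) * h (psi n x)) := Ck1M (C1f n) (C1h n).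
have z0 : (\int[mu]_(x in Omega) ((0 : R) `^ p)%:E)%E @[n --> \oo] --> 0%E.
  by rewrite powR0 ?gt_eqF// integral0; exact: cvg_cst.
have mc0 (n : nat) : measurable_fun Omega (fun _ : T => 0 : R) by exact: measurable_cst.
split; [exact: mprod|exact: mcoef|].
exists (fun n x => f (phi n x) * h (psi n x)); split.
- move=> n; split; first exact: C1.
  have [_ [K [cK KO K0]]] := phiC n.
  by exists K; split => // x Kx; rewrite K0// f0 mul0r.
- have M0 : 0 <= Lf * Mh + Mf * Lh by rewrite addr_ge0// mulr_ge0.
  apply: (@cvg_pow_le3 _ _ Omega p oO p1 _ (fun n x => `|phi n x - u x|) (fun n x => `|psi n x -
      v x|) (fun _ _ => 0) _ M0 _
    (fun n => measurable_distr (mphi n) mu_) (fun n => measurable_distr (mpsi n) mv) mc0 _ _ phiu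
        psiv z0).
  + move=> n; exact: measurable_distr (mprod _ _ _ _ cf ch (mphi n) (mpsi n)) (mprod _ _ _ _ cf
      ch mu_ mv).
  + by move=> n x; split.
  + move=> n x Ox; rewrite addr0.
    rewrite (_ : f (phi n x) * h (psi n x) - f (u x) * h (v x) =
      (f (phi n x) - f (u x)) * h (psi n x) + f (u x) * (h (psi n x) - h (v x))); last by ring.
    apply: le_trans (ler_normD _ _) _; rewrite !normrM.
    have H1 : `|f (phi n x) - f (u x)| * `|h (psi n x)| <= Lf * `|phi n x - u x| * Mh.
      by apply: ler_pM => //; exact: (hM _).1.
    have H2 : `|f (u x)| * `|h (psi n x) - h (v x)| <= Mf * (Lh * `|psi n x - v x|).
      by apply: ler_pM => //; exact: (fM _).1.
    apply: le_trans (lerD H1 H2) _.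
    rewrite mulrDl !mulrDr -addrA; apply: lerD; first by rewrite mulrAC.
    by rewrite -[leLHS]add0r mulrA; apply: lerD;
      [rewrite !mulr_ge0|rewrite lerDr !mulr_ge0].
- pose c n x := f' (phi n x) * h (psi n x) - f' (u x) * h (v x).
  pose e n x := f (phi n x) * h' (psi n x) - f (u x) * h' (v x).
  pose E n x := `|c n x| * enorm (G x) + `|e n x| * enorm (H x).
  (* The coefficient differences [c] and [e] are bounded by 2 Mf Mh; the summand 1 lets the same
     constant dominate the coefficient 1 of [E]. *)
  pose M := 2 * (Mf * Mh) + 1.
  have MM0 : 0 <= Mf * Mh by rewrite mulr_ge0.
  have M0 : 0 <= M by rewrite /M; lra.
  have cM n x : `|c n x| <= M.
    apply: le_trans (ler_normB _ _) _; rewrite !normrM.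
    have b y z : `|f' y| * `|h z| <= Mf * Mh by apply: ler_pM => //; [exact: (fM _).2|exact: (hM _).1].
    by apply: le_trans (lerD (b _ _) (b _ _)) _; rewrite /M; lra.
  have eM n x : `|e n x| <= M.
    apply: le_trans (ler_normB _ _) _; rewrite !normrM.
    have b y z : `|f y| * `|h' z| <= Mf * Mh by apply: ler_pM => //; [exact: (fM _).1|exact: (hM _).2].
    by apply: le_trans (lerD (b _ _) (b _ _)) _; rewrite /M; lra.
  have mc n : measurable_fun Omega (fun x => `|c n x|).
    exact: measurable_distr (mprod _ _ _ _ cf' ch (mphi n) (mpsi n)) (mprod _ _ _ _ cf' ch mu_ mv).
  have me n : measurable_fun Omega (fun x => `|e n x|).
    exact: measurable_distr (mprod _ _ _ _ cf ch' (mphi n) (mpsi n)) (mprod _ _ _ _ cf ch' mu_ mv).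
  have mE n : measurable_fun Omega (E n).
    exact: (measurable_funD (measurable_funM (mc n) (measurable_enorm mG)) (measurable_funM (me
        n) (measurable_enorm mH))).
  have Ep n x : 0 <= E n x by rewrite addr_ge0// mulr_ge0// enorm_ge0.
  have E0 : (\int[mu]_(x in Omega) (E n x `^ p)%:E)%E @[n --> \oo] --> 0%E.
    have [_ iG] := W0_integrable_pow oO bO p1 uG.
    have [_ iH] := W0_integrable_pow oO bO p1 vH.
    apply: (@cvg_int0_dominated _ _ _ mu Omega mO _ (fun x => M `^ p * (2 `^ p * (enorm (G x) `^
        p + enorm (H x) `^ p)))).
    + by move=> n; exact: measurable_powR_fun.
    + apply: filterS2 phia psia => x ua va Ox; apply: cvg_powR0 => //.
      have {}ua := ua Ox; have {}va := va Ox.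
      have cc (k l : R -> R) : continuous k -> continuous l ->
          (k (phi n x) * l (psi n x) - k (u x) * l (v x)) @[n --> \oo] --> (0 : R).
        move=> ck cl; apply/subr_cvg0.
        by apply: cvgM; [exact: (cvg_comp _ _ ua (ck (u x)))|exact: (cvg_comp _ _ va (cl (v x)))].
      rewrite -(addr0 0); apply: cvgD.
        rewrite -(mul0r (enorm (G x))); apply: cvgMl; apply/norm_cvg0P; exact: cc.
      rewrite -(mul0r (enorm (H x))); apply: cvgMl; apply/norm_cvg0P; exact: cc.
    + by apply: integrable_EFinM => //; apply: integrable_EFinM => //; exact: integrable_EFinD.
    + move=> n x Ox; rewrite ger0_norm ?powR_ge0//.
      apply: le_trans (ler_wpM2l (powR_ge0 _ _) (powRD_le (ltW p0) (enorm_ge0 (G x)) (enorm_ge0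
          (H x)))).
      rewrite -(powRM _ M0 (addr_ge0 (enorm_ge0 _) (enorm_ge0 _))).
      have GH0 : 0 <= M * (enorm (G x) + enorm (H x)).
        by apply: mulr_ge0 => //; rewrite addr_ge0// enorm_ge0.
      apply: ge0_ler_powR; rewrite ?nnegrE; [exact: ltW|exact: Ep|exact: GH0|].
      by rewrite mulrDr; apply: lerD; rewrite ler_wpM2r ?enorm_ge0.
  have mg (w : nat -> 'rV[R]_N -> R) (K : T -> 'rV[R]_N) n : (forall k, C1c Omega (w k)) ->
      (forall i, measurable_fun Omega (fun z => K z ord0 i)) ->
      measurable_fun Omega (fun x : T => enorm (gradient (w n) x - K x)).
    move=> wC mK; apply: measurable_enorm => i.
    by apply: measurable_coordB; [exact: measurable_gradient (wC n).1|exact: mK].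
  apply: (@cvg_pow_le3 _ _ Omega p oO p1 _ (fun n x => enorm (gradient (phi n) x - G x))
    (fun n x => enorm (gradient (psi n) x - H x)) E _ M0 _
    (fun n => mg phi G n phiC mG) (fun n => mg psi H n psiC mH) mE _ _ phiG psiH E0).
  + move=> n; apply: measurable_enorm => i.
    by apply: measurable_coordB; [exact: measurable_gradient|exact: mcoef].
  + by move=> n x; split; rewrite ?enorm_ge0.
  + move=> n x Ox; rewrite (gradientM x (C1f n) (C1h n)).
    rewrite (gradient_comp x (phiC n).1 df) (gradient_comp x (psiC n).1 dh) /=.
    rewrite (_ : _ - _ = (f' (phi n x) * h (psi n x)) *: (gradient (phi n) x - G x) +
      ((f (phi n x) * h' (psi n x)) *: (gradient (psi n) x - H x) +
       (c n x *: G x + e n x *: H x))); last first.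
      by apply/rowP => i; rewrite /c /e !mxE; ring.
    apply: le_trans (enormD _ _) _; rewrite mulrDr; apply: lerD.
      rewrite enormZ ler_wpM2r ?enorm_ge0// normrM.
      apply: le_trans (ler_pM (normr_ge0 _) (normr_ge0 _) (fM _).2 (hM _).1) _.
      by rewrite /M; lra.
    apply: le_trans (enormD _ _) _; rewrite mulrDr; apply: lerD.
      rewrite enormZ ler_wpM2r ?enorm_ge0// normrM.
      apply: le_trans (ler_pM (normr_ge0 _) (normr_ge0 _) (fM _).1 (hM _).2) _.
      by rewrite /M; lra.
    apply: le_trans (enormD _ _) _; rewrite !enormZ -[leLHS]mul1r.
    by apply: ler_wpM2r; [exact: Ep|rewrite /M; lra].
Qed.

End sobolev_chain_rule.

(** * Positivity from Picone's identity *)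

Section picone.
Context {R : realType} {N : nat}.
Variables (Omega : set (RN R N)) (p : R).
Hypotheses (oO : open (Omega : set 'rV[R]_N)) (bO : bounded_set (Omega : set 'rV[R]_N)).
Hypothesis p1 : 1 < p.
Local Notation mu := (@leb R N).
Local Notation T := (RN R N).
Implicit Types (u v w W : T -> R) (G H K : T -> 'rV[R]_N).

Let mO : measurable Omega.
Proof.
exact: measurable_open.
Qed.

Let p0 : 0 < p.
Proof.
exact: lt_trans p1.
Qed.

Let pm10 : 0 < p - 1.
Proof.
by rewrite subr_gt0.
Qed.

(** Replacing g by max(f, g), which equals g almost everywhere, reduces the claim to pointwise
    monotonicity. *)
Lemma ae_le_Rintegral (f g : T -> R) :
  mu.-integrable Omega (EFin \o f) -> mu.-integrable Omega (EFin \o g) ->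
  {ae mu, forall x, Omega x -> f x <= g x} ->
  \int[mu]_(x in Omega) f x <= \int[mu]_(x in Omega) g x.
Proof.
move=> fi gi fg.
have mf : measurable_fun Omega f by apply/measurable_EFinP; exact: measurable_int fi.
have mg : measurable_fun Omega g by apply/measurable_EFinP; exact: measurable_int gi.
have mm : measurable_fun Omega (fun x => Num.max (f x) (g x)) by exact: measurable_maxr.
have mi : mu.-integrable Omega (EFin \o (fun x => Num.max (f x) (g x))).
  apply: (@le_integrable_EFin _ _ _ _ _ mO _ (fun x => `|f x| + `|g x|) mm).
    by move=> x _; have [fgx|fgx] := leP (f x) (g x); rewrite ?lerDl ?lerDr.
  by apply: integrable_EFinD => //; [have := integrable_abse fi|have := integrable_abse gi].
have -> : \int[mu]_(x in Omega) g x = \int[mu]_(x in Omega) Num.max (f x) (g x).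
  congr fine; apply: ae_eq_integral => //; try exact/measurable_EFinP.
  by apply: filterS fg => x /[apply] /max_idPr ->.
by apply: le_Rintegral => // x _; rewrite le_max lexx.
Qed.

Lemma flux_bound (x y : 'rV[R]_N) :
  `|enorm x `^ (p - 2) * dotp x y| <= enorm x `^ p + enorm y `^ p.
Proof.
have ex := enorm_ge0 x; have ey := enorm_ge0 y.
rewrite normrM (ger0_norm (powR_ge0 _ _)).
apply: (@le_trans _ _ (enorm x `^ (p - 1) * enorm y)).
  have := @norm_spow _ p (enorm x) p1; rewrite normrM (ger0_norm (powR_ge0 _ _)) (ger0_norm ex) => <-.
  by rewrite -mulrA ler_wpM2l ?powR_ge0// norm_dotp_le.
have H := young p1 ey ex.
rewrite -(ler_pM2l p0); rewrite mulrC in H *.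
apply: (@le_trans _ _ (enorm y `^ p + (p - 1) * enorm x `^ p)).
  by apply: le_trans H; rewrite mulrC [X in _ * X]mulrC.
have := powR_ge0 (enorm x) p; have := powR_ge0 (enorm y) p.
move: (enorm x `^ p) (enorm y `^ p) => a b b0 a0.
by rewrite mulrDl; have := mulr_ge0 (ltW pm10) b0; have := mulr_ge0 (ltW p0) a0; lra.
Qed.

Lemma integrable_flux u G v H : W0 Omega p u G -> W0 Omega p v H ->
  mu.-integrable Omega (EFin \o (fun x => enorm (G x) `^ (p - 2) * dotp (G x) (H x))).
Proof.
move=> uG vH; have [_ iG] := W0_integrable_pow oO bO p1 uG.
have [_ iH] := W0_integrable_pow oO bO p1 vH.
have [_ mG _] := uG; have [_ mH _] := vH.
apply: (@le_integrable_EFin _ _ _ _ _ mO _ _ _ _ (integrable_EFinD mO iG iH)).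
  exact: (measurable_funM (measurable_powR_fun _ (measurable_enorm mG)) (measurable_dotp mG mH)).
by move=> x _; exact: flux_bound.
Qed.

(* With [b = |t| |x| / eta], Young's inequality [p b^(p-1) |y| <= (p-1) b^p e + e^(1-p) |y|^p]
   is Picone's inequality, where [d] and [e] absorb the slopes of the two truncations. *)
Lemma picone_pointwise (x y : 'rV[R]_N) (t d eta e : R) :
  0 < eta -> 0 < e -> `|d| <= 1 ->
  enorm x `^ (p - 2) * dotp x
    ((p * (`|t| `^ (p - 2) * t) * d * eta `^ (1 - p)) *: y +
     (`|t| `^ p * ((1 - p) * eta `^ (- p) * e)) *: x) <=
  e `^ (1 - p) * enorm y `^ p.
Proof.
move=> eta0 e0 d1.
have ex := enorm_ge0 x; have ey := enorm_ge0 y.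
pose b := `|t| * enorm x / eta.
have b0 : 0 <= b by rewrite /b !mulr_ge0// invr_ge0 ltW.
have bE r : b `^ r = `|t| `^ r * enorm x `^ r * eta `^ (- r).
  by rewrite /b !powRM ?mulr_ge0 ?invr_ge0 ?(ltW eta0)// -powR_inv1 ?(ltW eta0)// -powRrM mulN1r.
have Ex2 : enorm x `^ (p - 2) * dotp x x = enorm x `^ p.
  by have := @spow_mulr _ p (enorm x) p1; rewrite (ger0_norm ex) -sqr_enorm expr2 mulrA.
have Ex1 : enorm x `^ (p - 2) * enorm x = enorm x `^ (p - 1).
  have := @norm_spow _ p (enorm x) p1.
  by rewrite normrM (ger0_norm (powR_ge0 _ _)) (ger0_norm ex).
have T1 : enorm x `^ (p - 2) * (p * (`|t| `^ (p - 2) * t) * d * eta `^ (1 - p) * dotp x y) <=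
    p * (enorm y * b `^ (p - 1)).
  apply: le_trans (ler_norm _) _.
  rewrite !normrM !(ger0_norm (powR_ge0 _ _)) (gtr0_norm p0).
  have -> : `|t| `^ (p - 2) * `|t| = `|t| `^ (p - 1).
    by have := @norm_spow _ p t p1; rewrite normrM (ger0_norm (powR_ge0 _ _)).
  rewrite bE opprB -Ex1.
  have H1 : `|d| * `|dotp x y| <= 1 * (enorm x * enorm y) by apply: ler_pM => //; exact: norm_dotp_le.
  have c0 : 0 <= enorm x `^ (p - 2) * p * `|t| `^ (p - 1) * eta `^ (1 - p).
    by rewrite !mulr_ge0 ?powR_ge0// ltW.
  have := ler_wpM2l c0 H1.
  rewrite mul1r (_ : enorm x `^ (p - 2) * (p * `|t| `^ (p - 1) * `|d| * eta `^ (1 - p) * `|dotp x y|) =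
    enorm x `^ (p - 2) * p * `|t| `^ (p - 1) * eta `^ (1 - p) * (`|d| * `|dotp x y|)); last by ring.
  by move/le_trans; apply; rewrite le_eqVlt; apply/orP; left; apply/eqP; ring.
have T2 : enorm x `^ (p - 2) * (`|t| `^ p * ((1 - p) * eta `^ (- p) * e) * dotp x x) =
    - ((p - 1) * (e * b `^ p)).
  by rewrite bE -Ex2; ring.
rewrite dotpDr !dotpZr mulrDr T2 lerBlDr; apply: le_trans T1 _.
have ei0 r : 0 <= e `^ r := powR_ge0 e r.
(* Young's inequality for e^{(1-p)/p} |y| and e^{1/p} b: in the mixed term the powers of [e] cancel,
   and the terms e^{1-p} |y|^p and (p-1) e b^p appear as required. *)
have := young p1 (mulr_ge0 (ei0 ((1 - p) / p)) ey) (mulr_ge0 (ei0 p^-1) b0).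
rewrite (powRM _ (ei0 _) ey) (powRM _ (ei0 _) b0) (powRM _ (ei0 _) b0) -!powRrM.
rewrite divfK ?gt_eqF// mulVf ?gt_eqF// powRr1 ?(ltW e0)//.
rewrite (_ : e `^ ((1 - p) / p) * enorm y * (e `^ (p^-1 * (p - 1)) * b `^ (p - 1)) =
  (e `^ ((1 - p) / p) * e `^ (p^-1 * (p - 1))) * (enorm y * b `^ (p - 1))); last by ring.
rewrite -powRD ?(gt_eqF e0) ?implybT//.
rewrite (_ : (1 - p) / p + p^-1 * (p - 1) = 0) ?powRr0 ?mul1r//.
by field; rewrite gt_eqF.
Qed.

(** The eigenvalue equation with V - l g merged into a single weight W, so that pairs before and
    after a swap differ only by a perturbation of W. *)
Definition weak_equation W u G :=
  W0 Omega p u G /\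
  forall v H, W0 Omega p v H ->
    mu.-integrable Omega (EFin \o (fun x => W x * (`|u x| `^ (p - 2) * u x * v x))) /\
    \int[mu]_(x in Omega) (enorm (G x) `^ (p - 2) * dotp (G x) (H x)) +
    \int[mu]_(x in Omega) (W x * (`|u x| `^ (p - 2) * u x * v x)) = 0.

Lemma weak_solution_equation g V (l : R) u G : weak_solution Omega p g V l u G ->
  weak_equation (fun x => V x - l * g x) u G.
Proof.
move=> [uG H]; split => // v K vK; have [iV ig E] := H v K vK.
have -> : (fun x => (V x - l * g x) * (`|u x| `^ (p - 2) * u x * v x)) =
    (fun x => V x * `|u x| `^ (p - 2) * u x * v x + - l * (g x * `|u x| `^ (p - 2) * u x * v x)).
  by apply/funext => x; ring.
have il := integrable_EFinM mO (- l) ig.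
split; first exact: integrable_EFinD.
by rewrite RintegralD// RintegralZl// addrA E mulNr subrr.
Qed.

Lemma cvg_harmonicS : (n.+1%:R : R)^-1 @[n --> \oo] --> (0 : R).
Proof.
exact: cvg_harmonic.
Qed.

Lemma cvg_continuous (F : nat -> R) (l : R) (g : R -> R) :
  F n @[n --> \oo] --> l -> {for l, continuous g} -> g (F n) @[n --> \oo] --> g l.
Proof.
by move=> Fl cg; exact: (cvg_comp _ _ Fl cg).
Qed.

Lemma cvg_trunc (s : R) : trunc (n.+1%:R^-1) s @[n --> \oo] --> s.
Proof.
have H : (1 + (n.+1%:R^-1) ^+ 2 * s ^+ 2) @[n --> \oo] --> (1 + 0 ^+ 2 * s ^+ 2 : R).
  apply: cvgD; first exact: cvg_cst.
  apply: cvgMl; exact: (cvg_continuous cvg_harmonicS (@exprn_continuous _ 2 _)).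
rewrite expr0n mul0r addr0 in H.
rewrite -[X in _ --> X](mulr1 s) -[X in _ --> s * X]invr1.
by apply: cvgMr; apply: cvgV.
Qed.

Lemma cvg_smoothpos (t : R) : 0 < t -> smoothpos (n.+1%:R^-1) t @[n --> \oo] --> t.
Proof.
move=> t0.
have H : (t + 2 * n.+1%:R^-1) @[n --> \oo] --> t.
  rewrite -[X in _ --> X]addr0 -[X in _ --> _ + X](mulr0 2).
  by apply: cvgD; [exact: cvg_cst|apply: cvgMr; exact: cvg_harmonicS].
apply: (squeeze_cvgr _ (cvg_cst t) H); apply: nearW => n.
have n0 : 0 < n.+1%:R^-1 :> R by rewrite invr_gt0.
by rewrite (smoothpos_ge t n0).2 smoothpos_le// ltW.
Qed.

Lemma cvg_smoothpos' (t : R) : 0 < t -> smoothpos' (n.+1%:R^-1) t @[n --> \oo] --> (1 : R).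
Proof.
move=> t0.
have H : ((1 + t / (t + n.+1%:R^-1)) / 2) @[n --> \oo] --> ((1 + t / (t + 0)) / 2).
  apply: cvgMl; apply: cvgD; first exact: cvg_cst.
  apply: cvgMr; apply: cvgV; first by rewrite addr0 gt_eqF.
  by apply: cvgD; [exact: cvg_cst|exact: cvg_harmonicS].
rewrite addr0 divff ?gt_eqF// (_ : (1 + 1) / 2 = 1 :> R) in H; last by field.
apply: (squeeze_cvgr _ H (cvg_cst (1 : R))); apply: nearW => n.
have n0 : 0 < n.+1%:R^-1 :> R by rewrite invr_gt0.
rewrite (smoothpos'_pos n0 t0).2/=.
exact: le_trans (ler_norm _) (smoothpos'_bound t n0).
Qed.

Lemma cvg_powR (F : nat -> R) (l r : R) : 0 < l ->
  F n @[n --> \oo] --> l -> F n `^ r @[n --> \oo] --> l `^ r.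
Proof.
move=> l0 Fl; apply: (cvg_continuous (g := fun t => t `^ r) Fl).
exact: is_derive1_continuous (is_derive1_powR r l0).
Qed.

(* The test function is [T_n(w)^p eta_n(v)^(1-p)], an admissible substitute for
   [|w|^p v^(1-p)] which needs neither bounds on [w] nor a positive lower bound on [v]. *)
Lemma picone W v K w H : measurable_fun Omega W -> weak_equation W v K ->
  {ae mu, forall x, Omega x -> 0 < v x} -> W0 Omega p w H ->
  mu.-integrable Omega (EFin \o (fun x => W x * `|w x| `^ p)) ->
  0 <= \int[mu]_(x in Omega) (enorm (H x) `^ p) + \int[mu]_(x in Omega) (W x * `|w x| `^ p).
Proof.
move=> mW [vK veq] vpos wH iWw.
have [mv mK _] := vK; have [mw mH _] := wH.
pose c n : R := n.+1%:R^-1.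
have c0 n : 0 < c n by rewrite invr_gt0.
pose f n s := `|trunc (c n) s| `^ p.
pose f' n s := p * (`|trunc (c n) s| `^ (p - 2) * trunc (c n) s) * trunc' (c n) s.
pose h n t := smoothpos (c n) t `^ (1 - p).
pose h' n t := (1 - p) * smoothpos (c n) t `^ (- p) * smoothpos' (c n) t.
have fC n : C1_bounded (f n) (f' n) := C1_bounded_trunc_powR p1 (c0 n).
have hC n : C1_bounded (h n) (h' n) := C1_bounded_smoothpos_powR p1 (c0 n).
have f0 n : f n 0 = 0 by rewrite /f /trunc mul0r normr0 powR0// gt_eqF.
have test n := W0_mul_comp oO bO p1 (fC n) (f0 n) (hC n) wH vK.
pose I n := \int[mu]_(x in Omega) (enorm (K x) `^ (p - 2) * dotp (K x)
  ((f' n (w x) * h n (v x)) *: H x + (f n (w x) * h' n (v x)) *: K x)).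
pose jf n x := W x * (`|v x| `^ (p - 2) * v x * (f n (w x) * h n (v x))).
pose J n := \int[mu]_(x in Omega) jf n x.
have IJ n : I n + J n = 0 := (veq _ _ (test n)).2.
(* The bound of [picone_pointwise] for the slope e = [smoothpos']. That slope is at least 1/2 where
   v > 0, which dominates its negative power, and it tends to 1, so the limit is |H|^p. *)
pose lf n x := `|smoothpos' (c n) (v x)| `^ (1 - p) * enorm (H x) `^ p.
have [_ iH] := W0_integrable_pow oO bO p1 wH.
have mlf n : measurable_fun Omega (lf n).
  apply: measurable_funM; last exact: (measurable_powR_fun _ (measurable_enorm mH)).
  apply: measurable_powR_fun; apply: measurableT_comp; first exact: normr_measurable.
  exact: measurable_comp_continuous (continuous_smoothpos' (c0 n)) mv.
have lfb : {ae mu, forall x, Omega x -> forall n, `|lf n x| <= (1 / 2) `^ (1 - p) * enorm (H x) `^ p}.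
  apply: filterS vpos => x /[apply] vx n.
  rewrite ger0_norm ?mulr_ge0 ?powR_ge0// ler_wpM2r ?powR_ge0//.
  have [H1 _] := smoothpos'_pos (c0 n) vx.
  have H2 : 0 < smoothpos' (c n) (v x) by apply: lt_le_trans H1.
  rewrite (gtr0_norm H2) -opprB !powRN lef_pV2 ?posrE ?powR_gt0//.
  by apply: ge0_ler_powR; rewrite ?nnegrE ?(ltW pm10) ?(ltW H2).
have lfcvg : {ae mu, forall x, Omega x -> lf n x @[n --> \oo] --> enorm (H x) `^ p}.
  apply: filterS vpos => x /[apply] vx.
  have H1 : `|smoothpos' (c n) (v x)| @[n --> \oo] --> (1 : R).
    by rewrite -[X in _ --> X]normr1; apply: cvg_norm; exact: cvg_smoothpos'.
  have H2 := @cvg_powR (fun n => `|smoothpos' (c n) (v x)|) 1 (1 - p) ltr01 H1.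
  rewrite powR1 in H2.
  by rewrite -[X in _ --> X]mul1r; exact: cvgMl.
have iHM := integrable_EFinM mO ((1 / 2) `^ (1 - p)) iH.
have [_ lfI] := Rintegral_dominated_cvg mO mlf
  (measurable_powR_fun _ (measurable_enorm mH)) lfcvg iHM lfb.
have IL n : I n <= \int[mu]_(x in Omega) lf n x.
  apply: ae_le_Rintegral.
  - exact: integrable_flux vK (test n).
  - have cst_cvg : {ae mu, forall x, Omega x -> (fun _ : nat => lf n x) m @[m --> \oo] --> lf n x}.
      by apply: aeW => x _; exact: cvg_cst.
    have cst_bound : {ae mu, forall x, Omega x -> forall m : nat,
        `|lf n x| <= (1 / 2) `^ (1 - p) * enorm (H x) `^ p}.
      by apply: filterS lfb => x Hx Ox m; exact: Hx Ox n.
    exact: (Rintegral_dominated_cvg mO (fun=> mlf n) (mlf n) cst_cvg iHM cst_bound).1.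
  - apply: filterS vpos => x /[apply] vx.
    have [H1 _] := smoothpos'_pos (c0 n) vx.
    have H2 : 0 < smoothpos' (c n) (v x) by apply: lt_le_trans H1.
    rewrite /lf (gtr0_norm H2); apply: picone_pointwise => //; last exact: trunc'_le1.
    exact: lt_le_trans (c0 n) (smoothpos_ge (v x) (c0 n)).1.
have mjf n : measurable_fun Omega (jf n).
  by apply/measurable_EFinP; exact: measurable_int (veq _ _ (test n)).1.
have vE x : 0 < v x -> `|v x| `^ (p - 2) * v x = v x `^ (p - 1).
  move=> vx; have := @norm_spow _ p (v x) p1.
  by rewrite normrM (ger0_norm (powR_ge0 _ _)) (gtr0_norm vx).
(* As [smoothpos] lies above v, the factor v^{p-1} cancels the possibly large negative power, and
   the truncation of w is at most |w|. *)
have jfb : {ae mu, forall x, Omega x -> forall n, `|jf n x| <= `|W x * `|w x| `^ p|}.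
  apply: filterS vpos => x /[apply] vx n.
  rewrite /jf vE// !normrM ler_wpM2l// !(ger0_norm (powR_ge0 _ _)).
  rewrite mulrCA -[leRHS]mulr1; apply: ler_pM; rewrite ?mulr_ge0 ?powR_ge0//.
    by apply: ge0_ler_powR; rewrite ?nnegrE ?norm_trunc_le// ltW.
  rewrite /h (_ : 1 - p = - (p - 1)); last by rewrite opprB.
  rewrite powRN ler_pdivrMr ?mul1r; last first.
    by rewrite powR_gt0//; exact: lt_le_trans (c0 n) (smoothpos_ge (v x) (c0 n)).1.
  have H1 := (smoothpos_ge (v x) (c0 n)).2.
  by apply: ge0_ler_powR; rewrite ?nnegrE ?(ltW pm10) ?(ltW vx)// (le_trans (ltW vx)).
have jfcvg : {ae mu, forall x, Omega x -> jf n x @[n --> \oo] --> W x * `|w x| `^ p}.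
  apply: filterS vpos => x /[apply] vx.
  apply: cvgMr; rewrite (_ : `|w x| `^ p = v x `^ (p - 1) * (`|w x| `^ p * v x `^ (1 - p))); last first.
    rewrite mulrCA -powRD ?(gt_eqF vx) ?implybT// (_ : p - 1 + (1 - p) = 0) ?powRr0 ?mulr1//; ring.
  under eq_fun do rewrite vE//.
  apply: cvgMr; apply: cvgM.
    have cw := @continuous_normr_powR R p p0 (w x).
    exact: (@cvg_continuous _ _ (fun s : R => `|s| `^ p) (@cvg_trunc (w x)) cw).
  by apply: cvg_powR => //; exact: cvg_smoothpos.
have [_ jfI] := Rintegral_dominated_cvg mO mjf
  (measurable_funM mW (measurable_powR_fun _ (measurableT_comp (@normr_measurable _ _) mw)))
  jfcvg (integrable_abse iWw) jfb.
apply: (ler_cvg_to (cvg_cst 0) (cvgD lfI jfI)); apply: nearW => n.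
by rewrite -(IJ n) lerD2r.
Qed.

End picone.

(** * No swap preserves positivity *)

Section exponential_multiplier.
Context {R : realType} {N : nat}.
Implicit Types (x v : 'rV[R]_N) (i : 'I_N).

Lemma is_derive_coord i (t : R) x e :
  is_derive x e (fun x : 'rV[R]_N => t * x ord0 i) (t * e ord0 i).
Proof.
have H : (fun h : R => h^-1 *: ((t * (h *: e + x) ord0 i - t * x ord0 i) : R)) @ 0^' --> t * e ord0 i.
  apply: (@cvg_trans _ ((fun _ : R => t * e ord0 i) @ 0^')); last exact: cvg_cst.
  apply: near_eq_cvg; near=> h.
  have h0 : h != 0 by near: h; exact: nbhs_dnbhs_neq.
  by rewrite !mxE mulrDr addrK /GRing.scale/= mulrCA mulKf.
apply: DeriveDef; first by apply/cvg_ex; exists (t * e ord0 i).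
exact/cvg_lim.
Unshelve. all: by end_near.
Qed.

Lemma partial_coord i j (t : R) x :
  partial j (fun x => t * x ord0 i) x = t * (delta_mx ord0 j : 'rV[R]_N) ord0 i.
Proof.
by have [] := is_derive_coord i t x (delta_mx ord0 j).
Qed.

Lemma Ck1_coord i (t : R) : Ck 1 (fun x => t * x ord0 i).
Proof.
split.
  move=> x; rewrite (_ : (fun x => _) = t *: (fun x : 'rV[R]_N => x ord0 i : R))//.
  by apply: differentiableZ; exact: differentiable_coord.
move=> j /=; rewrite (_ : partial j _ = cst (t * (delta_mx ord0 j : 'rV[R]_N) ord0 i)).
  exact: cst_continuous.
by apply/funext => x; exact: partial_coord.
Qed.

Lemma gradient_coord i (t : R) x :
  gradient (fun x => t * x ord0 i) x = t *: delta_mx ord0 i.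
Proof.
by apply/rowP => j; rewrite [LHS]mxE partial_coord !mxE eqxx eq_sym.
Qed.

(** The exponential has the two properties required of the multiplier: its gradient is t e_i times
    itself, and a translation multiplies it by a constant. *)
Definition emul i (t : R) x := expR (t * x ord0 i).

Lemma Ck1_emul i t : Ck 1 (emul i t).
Proof.
exact: (Ck1_comp (Ck1_coord i t) (@is_derive_expR R) (@continuous_expR R)).
Qed.

Lemma gradient_emul i t x : gradient (emul i t) x = (t * emul i t x) *: delta_mx ord0 i.
Proof.
rewrite (gradient_comp x (Ck1_coord i t) (@is_derive_expR R)) gradient_coord scalerA.
by rewrite mulrC.
Qed.

Lemma emul_gt0 i t x : 0 < emul i t x.
Proof.
exact: expR_gt0.
Qed.

Lemma emul_powR i t x p : emul i t x `^ p = emul i (p * t) x.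
Proof.
by rewrite /emul -expRM; congr expR; ring.
Qed.

Lemma emulD i t x v : emul i t (x + v) = emul i t x * expR (t * v ord0 i).
Proof.
by rewrite /emul mxE mulrDr expRD.
Qed.

Lemma emul_bounds i t x (M : R) : 0 <= M -> `|x ord0 i| <= M -> `|t| <= 1 ->
  forall p, 0 < p -> expR (- (p * M)) <= emul i (p * t) x <= expR (p * M).
Proof.
move=> M0 xM t1 p p0; rewrite /emul !ler_expR.
have : `|p * t * x ord0 i| <= p * M.
  rewrite !normrM (gtr0_norm p0) -mulrA ler_pM2l//.
  by rewrite -[leRHS]mul1r; apply: ler_pM.
by rewrite ler_norml.
Qed.

End exponential_multiplier.

Section shift.
Context {R : realType} {N : nat}.
Local Notation mu := (@leb R N).
Local Notation T := (RN R N).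

Definition shiftf (h : 'rV[R]_N) : T -> T := fun x => (x + h : 'rV[R]_N).

Lemma measurable_fun_shift h (D : set T) : measurable_fun D (shiftf h).
Proof.
apply: measurable_funTS => _ Y mY; rewrite setTI; exact: measurable_shift.
Qed.

Lemma leb_shift h (A : set T) : mu (shiftf h @^-1` A) = mu A.
Proof.
exact: lebesgue_outer_shift.
Qed.

Lemma Rintegral_shift h (B : set T) (f : T -> R) : measurable B ->
  measurable_fun B f -> (forall y, B y -> 0 <= f y) ->
  \int[mu]_(x in B) f x = \int[mu]_(x in shiftf h @^-1` B) f (shiftf h x).
Proof.
move=> mB mf f0; congr fine.
have ms := @measurable_fun_shift h setT.
rewrite -(@ge0_integral_pushforward _ _ _ _ R (shiftf h) ms mu B (EFin \o f))//; last 2 first.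
- exact/measurable_EFinP.
- by move=> y; rewrite inE => By; rewrite /= lee_fin f0.
by apply: eq_measure_integral => A mA _; exact/esym/leb_shift.
Qed.

End shift.

Section swap_contradiction.
Context {R : realType} {N : nat}.
Variables (Omega : set (RN R N)) (p : R).
Hypotheses (oO : open (Omega : set 'rV[R]_N)) (bO : bounded_set (Omega : set 'rV[R]_N)).
Hypothesis p1 : 1 < p.
Local Notation mu := (@leb R N).
Local Notation T := (RN R N).
Implicit Types (u v w W : T -> R) (G H K : T -> 'rV[R]_N).

Let mO : measurable Omega.
Proof.
exact: measurable_open.
Qed.

Let p0 : 0 < p.
Proof.
exact: lt_trans p1.
Qed.

(** The tangent inequality of the convex function |.|^p, with the tangent taken at the end point x +
    y: after subtracting the flux at x, only a difference of fluxes at nearby points is left. *)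
Lemma enorm_convex (x y : 'rV[R]_N) :
  enorm (x + y) `^ p - enorm x `^ p <=
  p * (enorm (x + y) `^ (p - 2) * dotp (x + y) y).
Proof.
set z := x + y; have -> : y = z - x by rewrite /z addrAC subrr add0r.
have ex := enorm_ge0 x; have ez := enorm_ge0 z.
have E2 : enorm z `^ (p - 2) * dotp z z = enorm z `^ p.
  by have := @spow_mulr _ p (enorm z) p1; rewrite (ger0_norm ez) -sqr_enorm expr2 mulrA.
have E1 : enorm z `^ (p - 2) * enorm z = enorm z `^ (p - 1).
  by have := @norm_spow _ p (enorm z) p1; rewrite normrM (ger0_norm (powR_ge0 _ _)) (ger0_norm ez).
have dN : dotp z (- x) = - dotp z x by rewrite -[- x]scaleN1r dotpZr mulN1r.
rewrite dotpDr dN mulrDr E2 mulrN mulrBr.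
have H : enorm z `^ (p - 2) * dotp z x <= enorm x * enorm z `^ (p - 1).
  rewrite -E1; apply: le_trans (ler_wpM2l (powR_ge0 _ _) (dotp_le z x)) _.
  by rewrite le_eqVlt; apply/orP; left; apply/eqP; ring.
have := young p1 ex ez; have := ler_wpM2l (ltW p0) H.
move: (enorm z `^ p) (enorm x `^ p) (enorm x * _) (enorm z `^ (p - 2)) => a b c d H1 H2.
lra.
Qed.

(** Continuity of |z|^{p-2} z along a line. At x = 0, where the first factor is singular for p < 2,
    the flux is bounded by |z|^{p-1}. *)
Lemma cvg_flux (x y : 'rV[R]_N) (s : nat -> R) i : s k @[k --> \oo] --> (0 : R) ->
  enorm (x + s k *: y) `^ (p - 2) * (x + s k *: y) ord0 i @[k --> \oo] -->
  enorm x `^ (p - 2) * x ord0 i.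
Proof.
move=> s0.
have ns : `|s k| * enorm y @[k --> \oo] --> (0 : R).
  by rewrite -(mul0r (enorm y)); apply: cvgMl; apply/norm_cvg0P.
have ne : enorm (x + s k *: y) @[k --> \oo] --> enorm x.
  apply/subr_cvg0/norm_cvg0P; apply: (squeeze_cvgr _ (cvg_cst (0 : R)) ns); apply: nearW => k.
  rewrite normr_ge0/= ler_norml; apply/andP; split.
    have := enormD (x + s k *: y) (- (s k *: y)); rewrite addrK enormN enormZ; lra.
  have := enormD x (s k *: y); rewrite enormZ; lra.
have [x0|x0] := eqVneq (enorm x) 0.
  have xi : x ord0 i = 0 by apply/eqP; rewrite -normr_le0 -x0 coord_le_enorm.
  rewrite xi mulr0; apply/norm_cvg0P.
  have pm10 : 0 < p - 1 by rewrite subr_gt0.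
  have H : `|enorm (x + s k *: y)| `^ (p - 1) @[k --> \oo] --> (0 : R).
    have := cvg_continuous (g := fun t => `|t| `^ (p - 1)) ne (@continuous_normr_powR R _ pm10
        (enorm x)).
    by rewrite x0 normr0 powR0// gt_eqF.
  apply: (squeeze_cvgr _ (cvg_cst (0 : R)) H); apply: nearW => k.
  rewrite normr_ge0/= normrM -(norm_spow _ p1) [leRHS]normrM.
  rewrite !(ger0_norm (powR_ge0 _ _)) (ger0_norm (enorm_ge0 _)).
  by rewrite ler_wpM2l ?powR_ge0// coord_le_enorm.
have xp : 0 < enorm x by rewrite lt_neqAle eq_sym x0 enorm_ge0.
apply: cvgM; first exact: cvg_powR.
have -> : (fun k => (x + s k *: y) ord0 i) = (fun k => x ord0 i + s k * y ord0 i).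
  by apply/funext => k; rewrite !mxE.
rewrite -[X in _ --> X]addr0 -[X in _ --> _ + X](mul0r (y ord0 i)).
by apply: cvgD; [exact: cvg_cst|exact: cvgMl].
Qed.

Lemma Rintegral_gt0 (A : set T) (f : T -> R) : measurable A -> (0 < mu A)%E ->
  mu.-integrable A (EFin \o f) -> (forall x, A x -> 0 < f x) ->
  0 < \int[mu]_(x in A) f x.
Proof.
move=> mA A0 fi f0.
have I0 : 0 <= \int[mu]_(x in A) f x by apply: Rintegral_ge0 => x Ax; exact: ltW (f0 x Ax).
rewrite lt_neqAle I0 andbT; apply/eqP => E0.
have mf : measurable_fun A (EFin \o f) := measurable_int _ fi.
have : (\int[mu]_(x in A) `|(EFin \o f) x| = 0)%E.
  rewrite (@eq_integral _ _ _ mu A (EFin \o f)); last first.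
    by move=> x; rewrite inE => Ax /=; rewrite gtr0_norm// f0.
  by rewrite -[LHS]fineK; [rewrite -/(Rintegral mu A f) -E0|exact: integrable_fin_num].
move/(ae_eq_integral_abs mu mA mf) => [Z [mZ Z0 AZ]].
have : (mu A <= mu Z)%E.
  apply: le_measure; rewrite ?inE// => x Ax; apply: AZ => /= /(_ Ax) [fx0].
  by have := f0 x Ax; rewrite fx0 ltxx.
by rewrite Z0 leNgt A0.
Qed.

Lemma dotp_delta (x : 'rV[R]_N) i : dotp x (delta_mx ord0 i) = x ord0 i.
Proof.
rewrite /dotp (bigD1 i)//= big1 ?addr0; first by rewrite mxE !eqxx mulr1.
by move=> j ji; rewrite mxE (negbTE ji) andbF mulr0.
Qed.

Lemma enorm_delta i : enorm (delta_mx ord0 i : 'rV[R]_N) = 1.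
Proof.
by rewrite /enorm dotp_delta mxE !eqxx sqrtr1.
Qed.

(** A consequence of e^y >= 1 + y, used to make the gain of the swap at least linear in |t|. *)
Lemma one_sub_expRN (y : R) : 0 <= y -> y / (1 + y) <= 1 - expR (- y).
Proof.
move=> y0; have y1 : 0 < 1 + y by rewrite ltr_wpDr.
rewrite lerBrDr -lerBrDl (_ : 1 - y / (1 + y) = (1 + y)^-1); last by field; rewrite gt_eqF.
by rewrite expRN lef_pV2 ?posrE ?expR_gt0// expR_ge1Dx.
Qed.

(** The balance at a pair x, x + h: [a] and [a * e] are the exponential weights at the two points,
    [U] and [U'] the values of |u|^p there, and the integrand is negative at x and opposite at x +
    h. *)
Lemma exchange_arith (E a e U U' K : R) : E < 0 -> a * U' <= a * U ->
  K * U' <= a * (1 - e) * U' -> E * (a * U) + (- E) * (a * e * U') <= - K * (- E * U').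
Proof.
rewrite -oppr_gt0 => E0 H1 H2; have := ler_wpM2l (ltW E0) (lerD H1 H2); lra.
Qed.

(** f lives on the disjoint sets A and A + h, and the integral over A + h is moved back to A by
    translation invariance; nonnegativity of f on A + h permits this change of variables. *)
Lemma Rintegral_exchange (A : set T) h (f : T -> R) :
  measurable A -> A `<=` Omega -> (forall x, A x -> Omega (shiftf h x)) ->
  (forall x, A x -> ~ A (shiftf h x)) ->
  mu.-integrable Omega (EFin \o f) ->
  (forall x, A x -> 0 <= f (shiftf h x)) ->
  (forall x, Omega x -> ~ A x -> ~ A (shiftf (- h) x) -> f x = 0) ->
  mu.-integrable A (EFin \o (fun x => f (shiftf h x))) /\
  \int[mu]_(x in Omega) f x = \int[mu]_(x in A) f x + \int[mu]_(x in A) f (shiftf h x).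
Proof.
move=> mA AO AhO AhA fi f0 fz.
have shK x : shiftf h (shiftf (- h) x) = x by rewrite /shiftf subrK.
have shK' x : shiftf (- h) (shiftf h x) = x by rewrite /shiftf addrK.
pose B : set T := shiftf (- h) @^-1` A.
have mB : measurable B by exact: measurable_shift.
have BA : shiftf h @^-1` B = A by apply/seteqP; split => x; rewrite /B /= shK'.
have BO : B `<=` Omega by move=> x /AhO; rewrite shK.
have dAB : [disjoint A & B].
  apply/disj_setPLR => x Ax Bx; apply: (AhA _ Bx); by rewrite shK.
have f0B y : B y -> 0 <= f y by move=> /f0; rewrite shK.
have iA : mu.-integrable A (EFin \o f) := integrableS mO mA AO fi.
have iB : mu.-integrable B (EFin \o f) := integrableS mO mB BO fi.
have mfB : measurable_fun B f by apply/measurable_EFinP; exact: measurable_int iB.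
have mAB : measurable (A `|` B) by exact: measurableU.
have ABO : A `|` B `<=` Omega by move=> x [/AO|/BO].
split.
  apply/integrableP; split.
    apply/measurable_EFinP; rewrite -BA.
    apply: (measurable_comp mB _ mfB); first by move=> _ [x Bx <-].
    by rewrite BA; exact: measurable_fun_shift.
  have /integrableP[_ Boo] := iB.
  have ms := @measurable_fun_shift R N h setT.
  have -> : (\int[mu]_(x in A) `|(EFin \o (fun x => f (shiftf h x))) x| =
      \int[mu]_(x in B) `|(EFin \o f) x|)%E; last exact: Boo.
  rewrite -BA -[LHS](@ge0_integral_pushforward _ _ _ _ R (shiftf h) ms mu B (fun x => `|(f x)%:E|%E))//.
    by apply: eq_measure_integral => C mC _; exact: leb_shift.
  by apply: measurableT_comp => //; exact/measurable_EFinP.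
have UO : (A `|` B) `|` (Omega `\` (A `|` B)) = Omega.
  apply/seteqP; split => x; first by move=> [/ABO|[]].
  by move=> Ox; have [ABx|ABx] := pselect ((A `|` B) x); [left|right].
rewrite -{1}UO.
rewrite Rintegral_setU//; last 3 first.
- exact: measurableD.
- by rewrite UO.
- by apply/disj_setPLR => x ABx [_].
rewrite Rintegral_setU//; last exact: integrableS mO mAB ABO fi.
rewrite (@eq_Rintegral _ _ _ mu (Omega `\` (A `|` B)) (fun=> 0) f); last first.
  move=> x; rewrite inE => -[Ox /not_orP[Ax Bx]]; exact: fz.
rewrite /Rintegral integral0 addr0 -/(Rintegral mu A f) -/(Rintegral mu B f); congr (_ + _).
by rewrite (Rintegral_shift h mB mfB f0B) BA.
Qed.

(* Test with [w = u e^(t x_i)] where [h_i != 0] and [t h_i < 0], and compare with the weak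
   equation tested by [u e^(p t x_i)]: the gradient terms differ by [o(t)], while the
   [E]-term is at most [- kap |t| Q] with [Q > 0]. *)
Lemma no_monotone_exchange W u G (E : T -> R) (A : set T) h :
  weak_equation Omega p W u G ->
  measurable A -> (0 < mu A)%E -> A `<=` Omega -> (forall x, A x -> Omega (shiftf h x)) ->
  (forall x, A x -> ~ A (shiftf h x)) ->
  measurable_fun Omega E -> (exists C, forall x, `|E x| <= C) ->
  (forall x, A x -> E x < 0) -> (forall x, A x -> E (shiftf h x) = - E x) ->
  (forall x, Omega x -> ~ A x -> ~ A (shiftf (- h) x) -> E x = 0) ->
  (forall x, A x -> 0 < u (shiftf h x) <= u x) ->
  ~ (forall w H, W0 Omega p w H ->
       mu.-integrable Omega (EFin \o (fun x => (W x + E x) * `|w x| `^ p)) ->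
       0 <= \int[mu]_(x in Omega) (enorm (H x) `^ p) +
            \int[mu]_(x in Omega) ((W x + E x) * `|w x| `^ p)).
Proof.
move=> [uG ueq] mA A0 AO AhO AhA mE [C EC] EA EAh Ez uA J.
have [mu_ mG _] := uG.
have [iu iG] := W0_integrable_pow oO bO p1 uG.
(* h = 0 would make A, which is not empty, meet its own translate. *)
have [i hi] : exists i, h ord0 i != 0.
  apply: contrapT => hz; have h0 : h = 0.
    by apply/rowP => i; rewrite mxE; apply/eqP/negPn/negP => hi; apply: hz; exists i.
  have [x Ax] : A !=set0 by apply/set0P/eqP => Ae; move: A0; rewrite Ae measure0 ltxx.
  by apply: (AhA _ Ax); rewrite /shiftf h0 addr0.
have [M OM] : exists M, forall x, Omega x -> `|x ord0 i| <= M.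
  have [M MP] := bounded_continuous bO (Ck1_continuous (Ck1_coord i 1)).
  by exists M => x /MP; rewrite mul1r.
have [x0 Ax0] : A !=set0 by apply/set0P/eqP => Ae; move: A0; rewrite Ae measure0 ltxx.
have M0 : 0 <= M by apply: le_trans (OM _ (AO _ Ax0)).
have C0 : 0 <= C by apply: le_trans (EC x0).
pose tau (k : nat) : R := k.+1%:R^-1.
have tau0 k : 0 < tau k by rewrite invr_gt0.
have tau1 k : tau k <= 1 by rewrite invf_le1// ler1n.
(* The sign makes t h_i = - tau |h_i|, so the weight is smaller on A + h than on A. *)
pose t k := - Num.sg (h ord0 i) * tau k.
have th k : t k * h ord0 i = - (tau k * `|h ord0 i|).
  by rewrite /t normrEsg; ring.
have nt k : `|t k| = tau k by rewrite normrM normrN normr_sg hi mul1r gtr0_norm.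
have t1 k : `|t k| <= 1 by rewrite nt.
have t0 : t k @[k --> \oo] --> (0 : R).
  by rewrite -(mulr0 (- Num.sg (h ord0 i))); apply: cvgMr; exact: cvg_harmonicS.
pose a k := emul i (p * t k).
pose cM := expR (- (p * M)); pose CM := expR (p * M).
have aM k x : Omega x -> cM <= a k x <= CM.
  by move=> Ox; exact: emul_bounds M0 (OM _ Ox) (t1 k) _ p0.
have a0 k x : 0 < a k x := emul_gt0 _ _ _.
have ma k : measurable_fun Omega (a k : T -> R).
  by apply: measurable_fun_continuous; exact: Ck1_continuous (Ck1_emul _ _).
(* The gradient of u e^{t x_i} is e^{t x_i} [y], and [r] is |u| times the change of the i-th flux
   component between G and [y]. *)
pose y k x := G x + t k *: (u x *: delta_mx ord0 i).
pose r k x := `|u x| * `|enorm (y k x) `^ (p - 2) * y k x ord0 i - enorm (G x) `^ (p - 2) * G x ord0 i|.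
have wt k := W0_mul_smooth oO bO p1 (Ck1_emul i (t k)) uG.
have pt k := W0_mul_smooth oO bO p1 (Ck1_emul i (p * t k)) uG.
have HE k x : enorm (emul i (t k) x *: G x + u x *: gradient (emul i (t k)) x) `^ p = a k x *
    enorm (y k x) `^ p.
  rewrite gradient_emul (_ : _ + _ = emul i (t k) x *: y k x).
    by rewrite enormZ (gtr0_norm (emul_gt0 _ _ _)) powRM ?enorm_ge0 ?(ltW (emul_gt0 _ _ _))// emul_powR.
  by rewrite /y scalerDr !scalerA; congr (_ + _ *: _); ring.
have FE k x : enorm (G x) `^ (p - 2) * dotp (G x) (emul i (p * t k) x *: G x + u x *: gradient
    (emul i (p * t k)) x) =
    a k x * (enorm (G x) `^ p + p * (t k * u x) * (enorm (G x) `^ (p - 2) * G x ord0 i)).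
  have E2 : enorm (G x) `^ (p - 2) * dotp (G x) (G x) = enorm (G x) `^ p.
    by have := @spow_mulr _ p (enorm (G x)) p1; rewrite (ger0_norm (enorm_ge0 _)) -sqr_enorm
        expr2 mulrA.
  by rewrite gradient_emul dotpDr !dotpZr dotp_delta -/(a k x) -E2; ring.
have wE k x : `|emul i (t k) x * u x| `^ p = a k x * `|u x| `^ p.
  by rewrite normrM powRM// (gtr0_norm (emul_gt0 _ _ _)) emul_powR.
have pE k x : `|u x| `^ (p - 2) * u x * (emul i (p * t k) x * u x) = a k x * `|u x| `^ p.
  by rewrite -(spow_mulr (u x) p1) /a; ring.
have pw k x : Omega x -> enorm (emul i (t k) x *: G x + u x *: gradient (emul i (t k)) x) `^ p -
   enorm (G x) `^ (p - 2) * dotp (G x) (emul i (p * t k) x *: G x + u x *: gradient (emul i (p *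
       t k)) x)
   <= p * tau k * CM * r k x.
  move=> Ox; rewrite HE FE -mulrBr opprD addrA.
  have /andP[_ aC] := aM k x Ox.
  have := enorm_convex (G x) (t k *: (u x *: delta_mx ord0 i)); rewrite -/(y k x).
  rewrite !dotpZr dotp_delta => H1.
  apply: (@le_trans _ _ (a k x * (p * tau k * r k x))).
    rewrite ler_pM2l// (le_trans (lerB H1 (lexx _)))//.
    rewrite (_ : _ - _ = p * (t k * (u x * (enorm (y k x) `^ (p - 2) * y k x ord0 i - enorm (G x)
        `^ (p - 2) * G x ord0 i)))); last by ring.
    rewrite -[leRHS]mulrA ler_pM2l// (le_trans (ler_norm _))// normrM nt ler_pM2l//.
    by rewrite /r normrM.
  rewrite mulrC -!mulrA [CM * _]mulrC !mulrA ler_wpM2l//.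
  by rewrite !mulr_ge0// ltW.
have my k j : measurable_fun Omega (fun x => y k x ord0 j).
  rewrite (_ : (fun x => _) = (fun x => G x ord0 j + u x * (t k * (delta_mx ord0 i : 'rV[R]_N)
      ord0 j))).
    by apply: measurable_funD; [exact: mG|apply: measurable_funM; [exact: mu_|exact: measurable_cst]].
  by apply/funext => x; rewrite !mxE; ring.
have mr k : measurable_fun Omega (r k).
  apply: measurable_funM; first exact: (measurableT_comp (@normr_measurable _ _) mu_).
  exact: (measurable_distr (measurable_funM (measurable_powR_fun _ (measurable_enorm (my k))) (my k i))
    (measurable_funM (measurable_powR_fun _ (measurable_enorm mG)) (mG i))).
have powle (c d : R) : 0 <= c -> c <= d -> c `^ p <= d `^ p.
  by move=> c0 cd; apply: ge0_ler_powR; rewrite ?nnegrE ?(ltW p0)// (le_trans c0).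
(* A majorant of all [r k], obtained from Young's inequality and |t| <= 1. *)
pose gr x := 2 `^ p * (enorm (G x) `^ p + `|u x| `^ p) + enorm (G x) `^ p + 2 * `|u x| `^ p.
have rb k x : `|r k x| <= gr x.
  rewrite /r normrM !normr_id.
  have sp (z : 'rV[R]_N) : `|u x| * `|enorm z `^ (p - 2) * z ord0 i| <= enorm z `^ p + `|u x| `^ p.
    have := flux_bound p1 z (`|u x| *: delta_mx ord0 i).
    by rewrite dotpZr dotp_delta mulrCA normrM normr_id enormZ enorm_delta mulr1 normr_id.
  have yp : enorm (y k x) `^ p <= 2 `^ p * (enorm (G x) `^ p + `|u x| `^ p).
    apply: le_trans (powRD_le (ltW p0) (enorm_ge0 _) (normr_ge0 _)).
    apply: powle; first exact: enorm_ge0.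
    apply: le_trans (enormD _ _) _; rewrite lerD2l !enormZ enorm_delta mulr1 nt.
    by rewrite -[leRHS]mul1r ler_wpM2r.
  apply: le_trans (ler_wpM2l (normr_ge0 _) (ler_normB _ _)) _; rewrite mulrDr.
  apply: le_trans (lerD (sp (y k x)) (sp (G x))) _; rewrite /gr.
  rewrite [leLHS](_ : _ = enorm (y k x) `^ p + enorm (G x) `^ p + 2 * `|u x| `^ p); last by ring.
  by rewrite !lerD2r.
have igr : mu.-integrable Omega (EFin \o gr).
  apply: integrable_EFinD => //; last exact: integrable_EFinM.
  apply: integrable_EFinD => //; apply: integrable_EFinM => //; exact: integrable_EFinD.
have ir k : mu.-integrable Omega (EFin \o r k).
  by apply: (@le_integrable_EFin _ _ _ _ _ mO _ _ (mr k) _ igr) => x _; exact: rb.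
have rcvg : {ae mu, forall x, Omega x -> r k x @[k --> \oo] --> (0 : R)}.
  apply: aeW => x _; rewrite -(mulr0 `|u x|); apply: cvgMr.
  apply/norm_cvg0P/subr_cvg0; exact: cvg_flux.
have rb' : {ae mu, forall x, Omega x -> forall k, `|r k x| <= gr x} by apply: aeW => x _ k; exact: rb.
have [_ rI] := Rintegral_dominated_cvg mO mr (measurable_cst _) rcvg igr rb'.
have mup : measurable_fun Omega (fun x => `|u x| `^ p).
  by apply: measurable_powR_fun; exact: (measurableT_comp (@normr_measurable _ _) mu_).
have iau k : mu.-integrable Omega (EFin \o (fun x => E x * (a k x * `|u x| `^ p))).
  apply: (@le_integrable_EFin _ _ _ _ _ mO _ (fun x => C * CM * `|u x| `^ p));
      last exact: integrable_EFinM.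
    exact: (measurable_funM mE (measurable_funM (ma k) mup)).
  move=> x Ox; rewrite !normrM (ger0_norm (powR_ge0 _ _)) -mulrA.
  have /andP[_ aC] := aM k x Ox.
  apply: ler_pM; rewrite ?mulr_ge0 ?powR_ge0//.
  by rewrite ler_wpM2r ?powR_ge0// gtr0_norm.
(* J >= 0 at u e^{t x_i} minus the equation tested by u e^{p t x_i}: the terms in W coincide, so
   only the gradient remainder and the E-term survive. *)
have step1 k : 0 <= p * tau k * CM * (\int[mu]_(x in Omega) r k x) + \int[mu]_(x in Omega) (E x *
    (a k x * `|u x| `^ p)).
  have [iW eqk] := ueq _ _ (pt k).
  have iF := integrable_flux oO bO p1 uG (pt k).
  have [_ iH] := W0_integrable_pow oO bO p1 (wt k).
  have EW : (fun x => (W x + E x) * `|emul i (t k) x * u x| `^ p) =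
      (fun x => W x * (`|u x| `^ (p - 2) * u x * (emul i (p * t k) x * u x)) + E x * (a k x * `|u
          x| `^ p)).
    by apply/funext => x; rewrite wE pE mulrDl.
  have := J _ _ (wt k); rewrite EW => /(_ (integrable_EFinD mO iW (iau k))).
  rewrite RintegralD//= addrA => H1.
  rewrite -(RintegralZl (p * tau k * CM) mO (ir k)).
  apply: le_trans H1 _; rewrite lerD2r.
  have arith (b c e : R) : b + c = 0 -> e + c = e - b.
    by move=> /eqP; rewrite addr_eq0 => /eqP ->; rewrite opprK.
  rewrite (arith _ _ _ eqk) -RintegralB//.
  apply: le_Rintegral => //; [exact: integrable_EFinB|exact: integrable_EFinM|exact: pw].
have ig : mu.-integrable Omega (EFin \o (fun x => E x * `|u x| `^ p)).
  apply: (@le_integrable_EFin _ _ _ _ _ mO _ (fun x => C * `|u x| `^ p)); last exact: integrable_EFinM.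
    exact: (measurable_funM mE mup).
  by move=> x Ox; rewrite normrM (ger0_norm (powR_ge0 _ _)) ler_wpM2r ?powR_ge0.
have iQ : mu.-integrable A (EFin \o (fun x => E (shiftf h x) * `|u (shiftf h x)| `^ p)).
  apply: (Rintegral_exchange mA AO AhO AhA ig _ _).1.
    by move=> x Ax; rewrite EAh// mulr_ge0 ?powR_ge0// oppr_ge0 ltW// EA.
  by move=> x Ox Ax Bx; rewrite Ez// mul0r.
pose Q := \int[mu]_(x in A) (E (shiftf h x) * `|u (shiftf h x)| `^ p).
have hp : 0 < p * `|h ord0 i| by rewrite mulr_gt0// normr_gt0.
have hp1 : 0 < 1 + p * `|h ord0 i| by rewrite addr_gt0.
(* A lower bound, independent of k, for a (1 - e^{p t h_i}) / tau: [cM] bounds the weight from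
   below, and tau <= 1 is used in the denominator 1 + p tau |h_i|. *)
pose kap := cM * (p * `|h ord0 i| / (1 + p * `|h ord0 i|)).
have kap0 : 0 < kap by rewrite /kap mulr_gt0 ?expR_gt0// divr_gt0.
have step2 k : \int[mu]_(x in Omega) (E x * (a k x * `|u x| `^ p)) <= - (tau k * kap * Q).
  have [||iE ->] := Rintegral_exchange mA AO AhO AhA (iau k).
  - move=> x Ax; rewrite EAh// mulr_ge0 ?oppr_ge0 ?(ltW (EA _ Ax))//.
    by rewrite mulr_ge0 ?powR_ge0// ltW.
  - by move=> x Ox Ax Bx; rewrite Ez// mul0r.
  have iA := integrableS mO mA AO (iau k).
  rewrite -mulNr -RintegralZl// -RintegralD//.
  apply: le_Rintegral => //; [exact: integrable_EFinD|exact: integrable_EFinM|].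
  move=> x Ax; rewrite EAh//.
  have /andP[ca _] := aM k x (AO _ Ax).
  have /andP[u'0 u'u] := uA x Ax.
  have up : `|u (shiftf h x)| `^ p <= `|u x| `^ p.
    by apply: powle => //; rewrite !gtr0_norm// (lt_le_trans u'0).
  have u'p := powR_ge0 `|u (shiftf h x)| p.
  have -> : a k (shiftf h x) = a k x * expR (- (p * (tau k * `|h ord0 i|))).
    by rewrite /a /shiftf emulD -mulrA th mulrN.
  have ypos : 0 <= p * (tau k * `|h ord0 i|) by rewrite !mulr_ge0// ltW.
  have H1 := one_sub_expRN ypos.
  have H2 : tau k * (p * `|h ord0 i| / (1 + p * `|h ord0 i|)) <= p * (tau k * `|h ord0 i|) / (1 +
      p * (tau k * `|h ord0 i|)).
    rewrite mulrA (_ : tau k * (p * `|h ord0 i|) = p * (tau k * `|h ord0 i|)); last by ring.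
    rewrite ler_wpM2l// lef_pV2 ?posrE// ?ltr_pwDl// lerD2l mulrCA.
    by rewrite -[leRHS]mul1r ler_wpM2r// ltW.
  have H3 : cM * (tau k * (p * `|h ord0 i| / (1 + p * `|h ord0 i|))) <= a k x * (1 - expR (- (p *
      (tau k * `|h ord0 i|)))).
    apply: ler_pM; [exact: ltW (expR_gt0 _)| |exact: ca|exact: le_trans H2 H1].
    by rewrite !mulr_ge0// ?invr_ge0 ltW.
  rewrite (_ : cM * _ = tau k * kap) in H3; last by rewrite /kap; ring.
  exact: exchange_arith (EA _ Ax) (ler_wpM2l (ltW (a0 k x)) up) (ler_wpM2r u'p H3).
have Q0 : 0 < Q.
  apply: Rintegral_gt0 => // x Ax; have /andP[u'0 _] := uA x Ax.
  by rewrite EAh// mulr_gt0 ?oppr_gt0 ?EA// powR_gt0// gtr0_norm.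
(* Division by tau leaves a fixed positive number below a remainder that tends to 0. *)
have step3 k : kap * Q <= p * CM * \int[mu]_(x in Omega) r k x.
  rewrite -(ler_pM2l (tau0 k)); have := le_trans (step1 k) (lerD (lexx _) (step2 k)).
  move=> H; rewrite -subr_ge0; apply: le_trans H _.
  by rewrite le_eqVlt; apply/orP; left; apply/eqP; ring.
have lim0 : p * CM * (\int[mu]_(x in Omega) r k x) @[k --> \oo] --> (0 : R).
  rewrite -(mulr0 (p * CM)); apply: cvgMr; move: rI.
  by rewrite /Rintegral integral0.
have : kap * Q <= 0 by apply: (ler_cvg_to (cvg_cst (kap * Q)) lim0); exact: nearW.
by rewrite leNgt mulr_gt0.
Qed.

End swap_contradiction.

(** * Functions that factor monotonically *)

Section monotone_factor.
Context {R : realType} {N : nat}.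
Variable Omega : set (RN R N).
Hypothesis mO : measurable Omega.
Local Notation mu := (@leb R N).
Local Notation T := (RN R N).
Implicit Types (u f : T -> R) (Y : set T).

Lemma measurable_level_le u s : measurable_fun Omega u ->
  measurable (Omega `&` [set x | u x <= s]).
Proof.
move=> mu_; have := mu_ mO _ (measurable_itv `]-oo, s]).
by congr measurable; apply/seteqP; split => x [Ox] /=; rewrite in_itv.
Qed.

Lemma measurable_level_lt u s : measurable_fun Omega u ->
  measurable (Omega `&` [set x | u x < s]).
Proof.
move=> mu_; have := mu_ mO _ (measurable_itv `]-oo, s[).
by congr measurable; apply/seteqP; split => x [Ox] /=; rewrite in_itv.
Qed.

Lemma measurable_level_ge u s : measurable_fun Omega u ->
  measurable (Omega `&` [set x | s <= u x]).
Proof.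
move=> mu_; have := mu_ mO _ (measurable_itv `[s, +oo[).
by congr measurable; apply/seteqP; split => x [Ox] /=; rewrite in_itv/= andbT.
Qed.

Lemma measurable_level_gt u s : measurable_fun Omega u ->
  measurable (Omega `&` [set x | s < u x]).
Proof.
move=> mu_; have := mu_ mO _ (measurable_itv `]s, +oo[).
by congr measurable; apply/seteqP; split => x [Ox] /=; rewrite in_itv/= andbT.
Qed.

Lemma negligible_bigcup_countable (I : countType) (F : I -> set T) :
  (forall i, mu.-negligible (F i)) -> mu.-negligible (\bigcup_i F i).
Proof.
move=> nF.
apply: (@negligibleS _ _ _ mu _ _ _ (@negligible_bigcup _ _ _ mu
  (fun n => if unpickle n is Some i then F i else set0) _)).
  by move=> x [i _ Fx]; exists (pickle i) => //; rewrite pickleK.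
by move=> n; case: unpickle => [i|]; [exact: nF|exact: negligible_set0].
Qed.

Lemma negligible_mu0 Y : measurable Y -> mu Y = 0%E -> mu.-negligible Y.
Proof.
by move=> mY Y0; apply/negligibleP.
Qed.

(** The levels s for which u <= s is null in Y form a down-set. If it has a maximum, that single
    sublevel set covers all bad points; otherwise the countably many rational levels below its
    members do. *)
Lemma negligible_low_levels u Y : measurable_fun Omega u -> measurable Y ->
  Y `<=` Omega -> mu.-negligible [set x | Y x /\ mu (Y `&` [set z | u z <= u x]) = 0%E].
Proof.
move=> mu_ mY YO.
have mYs s : measurable (Y `&` [set z | u z <= s]).
  rewrite (_ : Y `&` _ = Y `&` (Omega `&` [set z | u z <= s])).
    by apply: measurableI => //; exact: measurable_level_le.
  by rewrite setIA (setIidl YO).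
pose S0 s := mu (Y `&` [set z | u z <= s]) = 0%E.
have S0le s t : s <= t -> S0 t -> S0 s.
  move=> st t0; apply/eqP; rewrite -measure_le0 -t0; apply: le_measure; rewrite ?inE//.
  by move=> x [Yx /= xs]; split => //=; exact: le_trans st.
have [[m [m0 mmax]]|nomax] := pselect (exists m, S0 m /\ forall s, S0 s -> s <= m).
  apply: (@negligibleS _ _ _ mu (Y `&` [set z | u z <= m])); last exact: negligible_mu0.
  by move=> x [Yx /mmax].
apply: (@negligibleS _ _ _ mu (\bigcup_(q : rat) [set z | S0 (ratr q) /\ (Y z /\ u z <= ratr q)])).
  move=> x [Yx xS].
  have [s [sS xs]] : exists s, S0 s /\ u x < s.
    apply: contrapT => H; apply: nomax; exists (u x); split => // s sS.
    by rewrite leNgt; apply/negP => us; apply: H; exists s.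
  have [q] := rat_in_itvoo xs; rewrite in_itv/= => /andP[xq qs].
  exists q => //; split; first by apply: S0le sS; exact: ltW.
  by split => //; exact: ltW.
apply: negligible_bigcup_countable => q; have [qS|qS] := pselect (S0 (ratr q)).
  by apply: negligibleS (negligible_mu0 (mYs (ratr q)) qS) => z [].
by apply: negligibleS (@negligible_set0 _ _ _ mu) => z [].
Qed.

Lemma negligible_high_levels u Y : measurable_fun Omega u -> measurable Y ->
  Y `<=` Omega -> mu.-negligible [set x | Y x /\ mu (Y `&` [set z | u x <= u z]) = 0%E].
Proof.
move=> mu_ mY YO.
have mN : measurable_fun Omega (fun x => - u x) by exact: (measurableT_comp (@oppr_measurable _ _) mu_).
apply: negligibleS (negligible_low_levels mN mY YO) => x [Yx x0]; split => //.
by rewrite -x0; congr (mu (Y `&` _)); apply/seteqP; split => z /=; rewrite lerN2.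
Qed.

(* On this interval the essential suprema of a function over [u <= s] are finite as soon as
   they are bounded by its values on [u >= s]; off it [sup] would be a junk value. *)
Definition range_levels u : set R :=
  [set s | (0 < mu (Omega `&` [set x | (u x <= s)%R]))%E /\
           (0 < mu (Omega `&` [set x | (s <= u x)%R]))%E].

Lemma is_interval_range_levels u : measurable_fun Omega u -> is_interval (range_levels u).
Proof.
move=> mu_ s t [s1 s2] [t1 t2] r /andP[sr rt]; split.
  apply: lt_le_trans s1 _; apply: le_measure; rewrite ?inE; try exact: measurable_level_le.
  by move=> x [Ox /= xs]; split => //=; exact: le_trans sr.
apply: lt_le_trans t2 _; apply: le_measure; rewrite ?inE; try exact: measurable_level_ge.
by move=> x [Ox /= xs]; split => //=; exact: le_trans xs.
Qed.

Lemma mu_gt0_or0 Y : measurable Y -> mu Y = 0%E \/ (0 < mu Y)%E.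
Proof.
move=> mY; have [->|Y0] := eqVneq (mu Y) 0%E; [by left|right].
by rewrite lt0e Y0 measure_ge0.
Qed.

Lemma ae_range_levels u : measurable_fun Omega u ->
  {ae mu, forall x, Omega x -> range_levels u (u x)}.
Proof.
move=> mu_.
apply: negligibleS (negligibleU (negligible_low_levels mu_ mO (@subset_refl _ _))
  (negligible_high_levels mu_ mO (@subset_refl _ _))) => x /= /not_implyP[Ox] /not_andP[H|H].
  left; split => //; have [//|] := mu_gt0_or0 (measurable_level_le (u x) mu_).
  by move/H.
right; split => //; have [//|] := mu_gt0_or0 (measurable_level_ge (u x) mu_).
by move/H.
Qed.

Lemma mu_gt0_bigcup (Y : set T) (F : nat -> set T) : (0 < mu Y)%E ->
  (forall n, measurable (F n)) -> measurable Y -> Y `<=` \bigcup_n F n ->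
  exists n, (0 < mu (F n))%E.
Proof.
move=> Y0 mF mY YF; apply: contrapT => H.
have F0 n : mu.-negligible (F n).
  apply: negligible_mu0 => //; have [//|Fn] := mu_gt0_or0 (mF n).
  by case: H; exists n.
have := negligibleS YF (negligible_bigcup F0).
by move=> /(negligibleP _ mY) Y00; move: Y0; rewrite Y00 ltxx.
Qed.

(* [phi s] is the essential supremum of [f] on [u <= s]. *)
Lemma monotone_factor u f : measurable_fun Omega u -> measurable_fun Omega f ->
  (forall s a b : R, a < b ->
    mu (Omega `&` [set x | s <= u x] `&` [set x | f x < a]) = 0%E \/
    mu (Omega `&` [set x | u x <= s] `&` [set x | b < f x]) = 0%E) ->
  exists phi : R -> R, {in range_levels u &, {homo phi : s t / s <= t}} /\
    {ae mu, forall x, Omega x -> f x = phi (u x)}.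
Proof.
move=> mu_ mf cross.
have mle_ge s r : measurable (Omega `&` [set x | u x <= s] `&` [set x | r <= f x]).
  rewrite -(setIidl (@subIsetl _ Omega [set x | u x <= s])) -setIA.
  by apply: measurableI; [exact: measurable_level_le|exact: measurable_level_ge].
have mle_gt s r : measurable (Omega `&` [set x | u x <= s] `&` [set x | r < f x]).
  rewrite -(setIidl (@subIsetl _ Omega [set x | u x <= s])) -setIA.
  by apply: measurableI; [exact: measurable_level_le|exact: measurable_level_gt].
have mge_lt s r : measurable (Omega `&` [set x | s <= u x] `&` [set x | f x < r]).
  rewrite -(setIidl (@subIsetl _ Omega [set x | s <= u x])) -setIA.
  by apply: measurableI; [exact: measurable_level_ge|exact: measurable_level_lt].
pose S s : set R := [set r | (0 < mu (Omega `&` [set x | (u x <= s)%R] `&` [set x | (r <= f x)%R]))%E].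
pose phi s := sup (S s).
have Sn0 s : range_levels u s -> S s !=set0.
  move=> [s1 _].
  have [|n Fn] := mu_gt0_bigcup s1 (fun n : nat => mle_ge s (- n%:R)) (measurable_level_le s mu_).
    move=> x [Ox xs]; have := archi_boundP (normr_ge0 (f x)).
    by rewrite ltr_norml => /andP[nf _]; exists (Num.bound `|f x|) => //; split => //=; exact: ltW.
  by exists (- n%:R).
(* Some set of points with u >= s and f < n has positive measure; the crossing hypothesis with a = n
   and b = n + 1 then forbids f > n + 1 on u <= s. *)
have Sub s : range_levels u s -> has_ubound (S s).
  move=> [_ s2].
  have [|n Fn] := mu_gt0_bigcup s2 (fun n : nat => mge_lt s n%:R) (measurable_level_ge s mu_).
    move=> x [Ox xs]; have := archi_boundP (normr_ge0 (f x)).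
    by rewrite ltr_norml => /andP[_ nf]; exists (Num.bound `|f x|).
  exists (n%:R + 1) => r Sr; rewrite leNgt; apply/negP => nr.
  have n1 : n%:R < n%:R + 1 :> R by rewrite ltrDl.
  have [H|H] := cross s _ _ n1.
    by move: Fn; rewrite H ltxx.
  move: Sr; rewrite /S /= ltNge => /negP; apply; rewrite -H; apply: le_measure; rewrite ?inE//.
  by move=> x [Oxs /= rf]; split => //=; exact: lt_le_trans rf.
have SS s : range_levels u s -> has_sup (S s) by move=> Ds; split; [exact: Sn0|exact: Sub].
exists phi; split.
  move=> s t; rewrite !inE => Ds Dt st; apply: ge_sup; first exact: Sn0.
  move=> r Sr; apply: ub_le_sup; first exact: Sub.
  apply: lt_le_trans Sr _; apply: le_measure; rewrite ?inE//.
  by move=> x [[Ox /= xs] rf]; do 2 split => //=; exact: le_trans st.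
have mY1 (q : rat) : measurable (Omega `&` [set x | ratr q <= f x]) := measurable_level_ge _ mf.
have mY2 (q : rat) : measurable (Omega `&` [set x | f x < ratr q]) := measurable_level_lt _ mf.
(* The exceptional points, collected over all rational thresholds q. In [N1], f(x) >= q but f >= q
   almost nowhere on u <= u(x); in [N2], f(x) < q but f < q almost nowhere on u >= u(x). *)
have N1 := negligible_bigcup_countable (fun q : rat => negligible_low_levels mu_ (mY1 q)
    (@subIsetl _ _ _)).
have N2 := negligible_bigcup_countable (fun q : rat => negligible_high_levels mu_ (mY2 q)
    (@subIsetl _ _ _)).
have D0 := ae_range_levels mu_.
apply: negligibleS (negligibleU (negligibleU N1 N2) D0) => x /= /not_implyP[Ox fx].
have [Dx|] := pselect (range_levels u (u x)); last by move=> H; right => /(_ Ox).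
(* If f(x) is below phi(u(x)), two rationals between them give the strict gap of the crossing
   hypothesis: one alternative puts x in [N2], the other contradicts the supremum. If f(x) is above,
   a rational between them either belongs to [S], which is impossible, or puts x in [N1]. *)
left; have [lt|lt|//] := ltgtP (f x) (phi (u x)).
- right.
  have [q1] := rat_in_itvoo lt; rewrite in_itv/= => /andP[fq qp].
  have [r Sr qr] := sup_gt (Sn0 _ Dx) qp.
  have [q2] := rat_in_itvoo fq; rewrite in_itv/= => /andP[fq2 q21].
  exists q2 => //; split => //.
  have [H|H] := cross (u x) _ _ q21.
    rewrite -H; congr (mu _); apply/seteqP; split => z /=; tauto.
  exfalso; move: Sr; rewrite /S /= ltNge => /negP; apply; rewrite -H; apply: le_measure; rewrite ?inE//.
  by move=> z [Oz /= rf]; split => //=; exact: lt_le_trans rf.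
- left.
  have [q] := rat_in_itvoo lt; rewrite in_itv/= => /andP[pq qf].
  exists q => //; split; first by split => //=; exact: ltW.
  have [H|H] := mu_gt0_or0 (mle_ge (u x) (ratr q)).
    rewrite -H; congr (mu _); apply/seteqP; split => z /=; tauto.
  by have := ub_le_sup (Sub _ Dx) H; rewrite leNgt pq.
Qed.

End monotone_factor.

(** * Swapping values on a set and its translate *)

Section swap.
Context {R : realType} {N : nat}.
Variable Omega : set (RN R N).
Hypothesis mO : measurable Omega.
Local Notation mu := (@leb R N).
Local Notation T := (RN R N).
Implicit Types (u f g E : T -> R) (A : set T) (h : 'rV[R]_N).

Lemma shiftfK h (x : T) : shiftf (- h) (shiftf h x) = x.
Proof.
by rewrite /shiftf addrK.
Qed.

Lemma shiftfNK h (x : T) : shiftf h (shiftf (- h) x) = x.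
Proof.
by rewrite /shiftf subrK.
Qed.

Definition swapf A h g : T -> R := fun x =>
  if `[< A x >] then g (shiftf h x)
  else if `[< A (shiftf (- h) x) >] then g (shiftf (- h) x) else g x.

Lemma swapf_in A h g x : A x -> swapf A h g x = g (shiftf h x).
Proof.
by rewrite /swapf => Ax; rewrite asboolT.
Qed.

Lemma swapf_shift A h g x : (forall y, A y -> ~ A (shiftf h y)) -> A x ->
  swapf A h g (shiftf h x) = g x.
Proof.
by move=> AhA Ax; rewrite /swapf shiftfK asboolF ?asboolT//; exact: AhA.
Qed.

Lemma swapf_out A h g x : ~ A x -> ~ A (shiftf (- h) x) -> swapf A h g x = g x.
Proof.
by rewrite /swapf => Ax Bx; rewrite !asboolF.
Qed.

Lemma swapfN A h g x : swapf A h (fun y => - g y) x = - swapf A h g x.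
Proof.
by rewrite /swapf; case: asboolP => // _; case: asboolP.
Qed.

Section swap_preimage.
Variables (A : set T) (h : 'rV[R]_N) (g : T -> R).
Hypotheses (mA : measurable A) (AO : A `<=` Omega).
Hypotheses (AhO : forall x, A x -> Omega (shiftf h x)) (AhA : forall x, A x -> ~ A (shiftf h x)).
Hypothesis mg : measurable_fun Omega g.

Let B : set T := shiftf (- h) @^-1` A.

Let mB : measurable B.
Proof.
exact: measurable_shift.
Qed.

Let BO : B `<=` Omega.
Proof.
by move=> x /AhO; rewrite shiftfNK.
Qed.

Let AB x : A x -> ~ B x.
Proof.
by move=> Ax Bx; apply: (AhA Bx); rewrite shiftfNK.
Qed.

(** Three pieces, each a translate or a restriction of a preimage under g; both measurability and
    equimeasurability of the swapped function follow from this decomposition. *)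
Lemma swapf_preimage (Y : set R) (P := Omega `&` g @^-1` Y) :
  Omega `&` swapf A h g @^-1` Y =
  (A `&` shiftf h @^-1` P) `|` (B `&` shiftf (- h) @^-1` P) `|` (P `\` (A `|` B)).
Proof.
apply/seteqP; split => x.
  move=> [Ox]; rewrite /= /swapf; case: asboolP => Ax.
    by move=> Yx; left; left; split => //; split => //; exact: AhO.
  case: asboolP => Bx Yx; first by left; right; split => //; split => //; exact: AO.
  by right; split => // -[].
move=> [[[Ax [_ Yx]]|[Bx [_ Yx]]]|[[Ox Yx] /not_orP[Ax Bx]]].
- by split; [exact: AO|rewrite /= swapf_in].
- by split; [exact: BO|rewrite /= -(shiftfNK h x) swapf_shift].
- by split => //=; rewrite swapf_out.
Qed.

Lemma measurable_swapf : measurable_fun Omega (swapf A h g).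
Proof.
move=> _ Y mY; rewrite swapf_preimage.
have mP : measurable (Omega `&` g @^-1` Y) by exact: mg.
apply: measurableU; last by apply: measurableD => //; exact: measurableU.
by apply: measurableU; apply: measurableI => //; exact: measurable_shift.
Qed.

(** Translation carries the piece in A onto the part of P in A + h, and the piece in A + h onto the
    part in A, so the three measures are only permuted. *)
Lemma mu_swapf_preimage (Y : set R) : measurable Y ->
  mu (Omega `&` swapf A h g @^-1` Y) = mu (Omega `&` g @^-1` Y).
Proof.
move=> mY; rewrite swapf_preimage; set P := Omega `&` g @^-1` Y.
have mP : measurable P by exact: mg.
have mAB : measurable (A `|` B) by exact: measurableU.
have m1 : measurable (A `&` shiftf h @^-1` P) by apply: measurableI => //; exact: measurable_shift.
have m2 : measurable (B `&` shiftf (- h) @^-1` P) by apply: measurableI => //; exact: measurable_shift.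
have m3 : measurable (P `\` (A `|` B)) by exact: measurableD.
have E1 : mu (A `&` shiftf h @^-1` P) = mu (P `&` B).
  rewrite -[RHS](leb_shift h); congr (mu _); apply/seteqP.
  by split => x; rewrite /B /= shiftfK => -[].
have E2 : mu (B `&` shiftf (- h) @^-1` P) = mu (P `&` A).
  by rewrite -[RHS](leb_shift (- h)); congr (mu _); apply/seteqP; split => x [].
have -> : mu ((A `&` shiftf h @^-1` P) `|` (B `&` shiftf (- h) @^-1` P) `|` (P `\` (A `|` B))) =
    (mu (A `&` shiftf h @^-1` P) + mu (B `&` shiftf (- h) @^-1` P) + mu (P `\` (A `|` B)))%E.
  rewrite measureU//; last 2 first.
  - exact: measurableU.
  - by apply/seteqP; split => x // [[[? ?]|[? ?]] [_ /not_orP[]]].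
  by rewrite measureU//; apply/seteqP; split => x // [[/AB ? _] []].
have -> : mu P = (mu (P `&` A) + mu (P `&` B) + mu (P `\` (A `|` B)))%E.
  rewrite -measureU//; [|exact: measurableI|exact: measurableI|]; last first.
    by apply/seteqP; split => x // [[_ /AB ?] []].
  rewrite -setIUr -measureU//; [|exact: measurableI|]; last first.
    by apply/seteqP; split => x // [[_ ?] []].
  by congr (mu _); rewrite setUIDK.
by rewrite E1 E2 (addeC (mu (P `&` B))).
Qed.

Lemma rearrangements_swapf g0 : rearrangements Omega g0 g -> rearrangements Omega g0 (swapf A h g).
Proof.
move=> [_ gE]; split; first exact: measurable_swapf.
move=> a; rewrite -gE.
have := mu_swapf_preimage (measurable_itv `[a, +oo[).
have E f : Omega `&` f @^-1` `[a, +oo[%classic = Omega `&` [set x | a <= f x].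
  by apply/seteqP; split => x /=; rewrite in_itv/= andbT.
by rewrite !E.
Qed.

End swap_preimage.

(* [E] is the change of weight when values are swapped between [A] and [A + h] so that the
   larger ones move to [A], where [u] is larger (or equal). *)
Definition monotone_exchange u E A h :=
  [/\ [/\ measurable A, (0 < mu A)%E & A `<=` Omega],
      (forall x, A x -> Omega (shiftf h x)) /\ (forall x, A x -> ~ A (shiftf h x)),
      measurable_fun Omega E /\ exists C, forall x, `|E x| <= C,
      [/\ forall x, A x -> E x < 0, forall x, A x -> E (shiftf h x) = - E x &
          forall x, Omega x -> ~ A x -> ~ A (shiftf (- h) x) -> E x = 0] &
      forall x, A x -> 0 < u (shiftf h x) <= u x].

(** Needed because a swap in g changes the weight V - l g by l times the exchange function. *)
Lemma monotone_exchangeZ u E A h (c : R) : 0 < c -> monotone_exchange u E A h ->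
  monotone_exchange u (fun x => c * E x) A h.
Proof.
move=> c0 [HA HAh [mE [C EC]] [E0 Eh Ez] uA]; split => //.
  split; first by apply: measurable_funM => //; exact: measurable_cst.
  by exists (c * C) => x; rewrite normrM (gtr0_norm c0) ler_pM2l.
split.
- by move=> x Ax; rewrite pmulr_rlt0// E0.
- by move=> x Ax; rewrite Eh// mulrN.
- by move=> x Ox Ax Bx; rewrite Ez// mulr0.
Qed.

(** A translate of one crossing set meets the other. Both are first cut to bounded values of f,
    which bounds E, and the null set where u <= 0 is removed from the second one. A and A + h are
    disjoint because f < a on the former and f > b > a on the latter. *)
Lemma exchange_exists u f (s a b : R) : (mu Omega < +oo)%E ->
  measurable_fun Omega u -> measurable_fun Omega f ->
  {ae mu, forall x, Omega x -> 0 < u x} -> a < b ->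
  (0 < mu (Omega `&` [set x | (s <= u x)%R] `&` [set x | (f x < a)%R]))%E ->
  (0 < mu (Omega `&` [set x | (u x <= s)%R] `&` [set x | (b < f x)%R]))%E ->
  exists A h, monotone_exchange u (fun x => f x - swapf A h f x) A h.
Proof.
move=> Ooo mu_ mf upos ab X0 Y0.
have mI (P Q : set T) : measurable (Omega `&` P) -> measurable (Omega `&` Q) ->
    measurable (Omega `&` P `&` Q).
  by move=> mP mQ; rewrite -(setIidl (@subIsetl _ Omega P)) -setIA; exact: measurableI.
pose X n : set T := Omega `&` [set x | s <= u x] `&` [set x | f x < a] `&` (Omega `&` [set x | -
    n%:R <= f x]).
pose Y (n : nat) : set T := Omega `&` [set x | u x <= s] `&` [set x | b < f x] `&` (Omega `&`
    [set x | f x <= n%:R]).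
have mX0 := mI _ _ (measurable_level_ge mO s mu_) (measurable_level_lt mO a mf).
have mY0 := mI _ _ (measurable_level_le mO s mu_) (measurable_level_gt mO b mf).
have mX n : measurable (X n) by apply: measurableI => //; exact: measurable_level_ge.
have mY n : measurable (Y n) by apply: measurableI => //; exact: measurable_level_le.
have [|n Xn] := mu_gt0_bigcup X0 mX mX0.
  move=> x [[Ox xs] fx]; have := archi_boundP (normr_ge0 (f x)).
  rewrite ltr_norml => /andP[nf _]; exists (Num.bound `|f x|) => //; do 2 split => //=.
  exact: ltW.
have [|m Ym] := mu_gt0_bigcup Y0 mY mY0.
  move=> x [[Ox xs] fx]; have := archi_boundP (normr_ge0 (f x)).
  rewrite ltr_norml => /andP[_ nf]; exists (Num.bound `|f x|) => //; do 2 split => //=.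
  exact: ltW.
pose Y' : set T := Y m `&` (Omega `&` [set x | 0 < u x]).
have mY' : measurable Y' by apply: measurableI => //; exact: measurable_level_gt.
have Y'0 : (0 < mu Y')%E.
  have [Y'0|//] := mu_gt0_or0 mY'.
  have Yneg : mu.-negligible (Y m).
    apply: negligibleS (negligibleU (negligible_mu0 mY' Y'0) upos) => x [[[Ox xs] bf] fm].
    have [ux|ux] := pselect (0 < u x); first by left.
    by right => /= /(_ Ox).
  by move/(negligibleP _ (mY m)) : Yneg => Y00; move: Ym; rewrite Y00 ltxx.
have fin (Z : set T) : measurable Z -> Z `<=` Omega -> (mu Z < +oo)%E.
  by move=> mZ ZO; apply: le_lt_trans Ooo; apply: le_measure; rewrite ?inE.
have [h hA] : exists h, (0 < mu (X n `&` shiftf h @^-1` Y'))%E.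
  apply: exists_translate_overlap => //; apply/andP; split => //; apply: fin => //.
    by move=> x [[[]]].
  by move=> x [[[[]]]].
pose A : set T := X n `&` shiftf h @^-1` Y'.
have mA : measurable A by apply: measurableI => //; exact: measurable_shift.
have AO : A `<=` Omega by move=> x [[[[]]]].
have AhO x : A x -> Omega (shiftf h x) by move=> [_ [_ []]].
have fA x : A x -> - n%:R <= f x < a by move=> [[[[_ _] /= ->] [_ /= ->]] _].
have fAh x : A x -> b < f (shiftf h x) <= m%:R by move=> [_ [[[[_ _] /= ->] [_ /= ->]] _]].
have AhA x : A x -> ~ A (shiftf h x).
  move=> /fAh /andP[H1 _] /fA /andP[_ H2].
  by have := lt_trans ab (lt_trans H1 H2); rewrite ltxx.
have Ehx x : A x -> f (shiftf h x) - swapf A h f (shiftf h x) = - (f x - swapf A h f x).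
  by move=> Ax; rewrite swapf_shift// swapf_in// opprB.
have EA x : A x -> f x - swapf A h f x < 0.
  move=> Ax; rewrite swapf_in// subr_lt0; have /andP[_ H1] := fA _ Ax; have /andP[H2 _] := fAh _ Ax.
  exact: lt_trans H1 (lt_trans ab H2).
have Ez x : ~ A x -> ~ A (shiftf (- h) x) -> f x - swapf A h f x = 0.
  by move=> Ax Bx; rewrite swapf_out// subrr.
have bA x : A x -> `|f x - swapf A h f x| <= n%:R + m%:R.
  move=> Ax; rewrite ltr0_norm ?EA// swapf_in// opprB.
  by have /andP[H1 _] := fA _ Ax; have /andP[_ H2] := fAh _ Ax; lra.
exists A, h; split => //.
- split; first by apply: measurable_funB => //; exact: measurable_swapf.
  exists (n%:R + m%:R) => x.
  have [Ax|Ax] := pselect (A x); first exact: bA.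
  have [Bx|Bx] := pselect (A (shiftf (- h) x)); last by rewrite Ez// normr0 addr_ge0.
  by rewrite -[x](shiftfNK h) Ehx// normrN bA.
- by split => // x _; exact: Ez.
- move=> x [[[[_ /= su] _] _] [[[[_ /= us] _] _] [_ /= u0]]].
  by rewrite u0 (le_trans us).
Qed.

End swap.

(** * Exchanges at an optimal pair *)

Section optimal_pair.
Context {R : realType} {N : nat}.
Variables (Omega : set (RN R N)) (p : R).
Hypotheses (oO : open (Omega : set 'rV[R]_N)) (bO : bounded_set (Omega : set 'rV[R]_N)).
Hypothesis p1 : 1 < p.
Local Notation mu := (@leb R N).
Local Notation T := (RN R N).
Implicit Types (u g V E : T -> R) (A : set T) (h : 'rV[R]_N).

Let mO : measurable Omega.
Proof.
exact: measurable_open.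
Qed.

Let p0 : 0 < p.
Proof.
exact: lt_trans p1.
Qed.

(** Pairing x with x + h turns the integrand into E(x) (u(x)^p - u(x + h)^p), a negative factor
    times a nonnegative one. *)
Lemma exchange_integral_le0 u G E A h : W0 Omega p u G -> monotone_exchange Omega u E A h ->
  mu.-integrable Omega (EFin \o (fun x => E x * `|u x| `^ p)) /\
  \int[mu]_(x in Omega) (E x * `|u x| `^ p) <= 0.
Proof.
move=> uG [[mA A0 AO] [AhO AhA] [mE [C EC]] [E0 Eh Ez] uA].
have [mu_ _ _] := uG; have [iu _] := W0_integrable_pow oO bO p1 uG.
have mup : measurable_fun Omega (fun x => `|u x| `^ p).
  by apply: measurable_powR_fun; exact: (measurableT_comp (@normr_measurable _ _) mu_).
have iE : mu.-integrable Omega (EFin \o (fun x => E x * `|u x| `^ p)).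
  apply: (@le_integrable_EFin _ _ _ _ _ mO _ (fun x => C * `|u x| `^ p)); last exact: integrable_EFinM.
    exact: (measurable_funM mE mup).
  by move=> x Ox; rewrite normrM (ger0_norm (powR_ge0 _ _)) ler_wpM2r ?powR_ge0.
split => //.
have [||iEh ->] := Rintegral_exchange oO mA AO AhO AhA iE.
- by move=> x Ax; rewrite Eh// mulr_ge0 ?powR_ge0// oppr_ge0 ltW// E0.
- by move=> x Ox Ax Bx; rewrite Ez// mul0r.
have iA := integrableS mO mA AO iE.
rewrite -RintegralD//.
have -> : 0 = \int[mu]_(x in A) (0 : R) by rewrite /Rintegral integral0.
apply: le_Rintegral => //; [exact: integrable_EFinD|exact: integrable0|].
move=> x Ax; rewrite Eh// mulNr -mulrBr nmulr_rle0 ?E0// subr_ge0.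
have /andP[u'0 u'u] := uA x Ax.
rewrite !gtr0_norm ?(lt_le_trans u'0)//.
by apply: ge0_ler_powR; rewrite ?nnegrE ?(ltW p0) ?(ltW u'0)// (le_trans (ltW u'0)).
Qed.

(** Here l' is the eigenvalue after the swap and [c * E] the change of weight it causes. Positivity
    tested at u itself reads 0 <= (l - l') + c times a nonpositive integral, which forces l' = l;
    then u solves the equation of the unperturbed weight and [no_monotone_exchange] applies. *)
Lemma optimal_no_exchange u G g V (l l' c : R) E A h :
  measurable_fun Omega g -> measurable_fun Omega V ->
  weak_solution Omega p g V l u G ->
  \int[mu]_(x in Omega) (g x * `|u x| `^ p) = 1 ->
  monotone_exchange Omega u E A h -> 0 < c -> l <= l' ->
  ~ (forall w H, W0 Omega p w H ->
       mu.-integrable Omega (EFin \o (fun x => (V x - l' * g x + c * E x) * `|w x| `^ p)) ->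
       0 <= \int[mu]_(x in Omega) (enorm (H x) `^ p) +
            \int[mu]_(x in Omega) ((V x - l' * g x + c * E x) * `|w x| `^ p)).
Proof.
move=> mg mV us gu EA c0 ll' J.
have [uG uEq] := us.
have [_ ig _] := uEq _ _ uG.
have {}ig : mu.-integrable Omega (EFin \o (fun x => g x * `|u x| `^ p)).
  rewrite (_ : (fun x => g x * `|u x| `^ p) = (fun x => g x * `|u x| `^ (p - 2) * u x * u x))//.
  by apply/funext => x; rewrite -(spow_mulr (u x) p1); ring.
have wE := weak_solution_equation oO us.
have [iW WE] := wE.2 _ _ uG.
have EW : (fun x => (V x - l * g x) * (`|u x| `^ (p - 2) * u x * u x)) =
    (fun x => (V x - l * g x) * `|u x| `^ p).
  by apply/funext => x; rewrite (spow_mulr (u x) p1).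
rewrite EW in iW WE.
have EG : (fun x => enorm (G x) `^ (p - 2) * dotp (G x) (G x)) = (fun x => enorm (G x) `^ p).
  apply/funext => x; have := @spow_mulr _ p (enorm (G x)) p1.
  by rewrite (ger0_norm (enorm_ge0 _)) -sqr_enorm expr2 mulrA.
rewrite EG in WE.
have [iE IE] := exchange_integral_le0 uG EA.
have Ed : (fun x => (V x - l' * g x + c * E x) * `|u x| `^ p) =
    (fun x => (V x - l * g x) * `|u x| `^ p + ((l - l') * (g x * `|u x| `^ p) + c * (E x * `|u x|
        `^ p))).
  by apply/funext => x; ring.
have i2 := integrable_EFinM mO (l - l') ig.
have i3 := integrable_EFinM mO c iE.
have i23 := integrable_EFinD mO i2 i3.
have ll : l' = l.
  apply/eqP; rewrite eq_le ll' andbT.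
  have := J _ _ uG; rewrite Ed => /(_ (integrable_EFinD mO iW i23)).
  rewrite (RintegralD mO iW i23) (RintegralD mO i2 i3) (RintegralZl _ mO ig) (RintegralZl _ mO iE).
  rewrite addrA WE add0r gu mulr1 => H1.
  have H2 : c * (\int[mu]_(x in Omega) (E x * `|u x| `^ p)) <= 0 by rewrite pmulr_rle0.
  by rewrite -subr_ge0 (le_trans H1)// -[leRHS]addr0 lerD2l.
have [[mA A0 AO] [AhO AhA] [mE EC] [E0 Eh Ez] uA] := monotone_exchangeZ c0 EA.
apply: (no_monotone_exchange oO bO p1 wE mA A0 AO AhO AhA mE EC E0 Eh Ez uA).
by move=> w H wH; have := J w H wH; rewrite ll.
Qed.

End optimal_pair.

Theorem theorem3p5 (R : realType) (N : nat) (p q : R) (Omega : set 'rV[R]_N)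
    (g0 V0 : 'rV[R]_N -> R)
    (lambda : ('rV[R]_N -> R) -> ('rV[R]_N -> R) -> R)
    (gs Vs us : 'rV[R]_N -> R) :
  (2 <= N)%N -> 1 < p -> exponent_cond N p q ->
  smooth_bounded_domain Omega ->
  admissible Omega p q g0 V0 ->
  (forall g V, rearrangements Omega g0 g -> rearrangements Omega V0 V ->
     unique_positive_principal_eigenvalue Omega p g V (lambda g V)) ->
  rearrangements Omega g0 gs ->
  rearrangements Omega V0 Vs ->
  lambda gs Vs = inf [set lambda g V | g in rearrangements Omega g0
                                     & V in rearrangements Omega V0] ->
  positive_eigenfunction Omega p gs Vs (lambda gs Vs) us ->
  \int[@leb R N]_(x in Omega) (gs x * us x `^ p) = 1 ->
  exists (D : set R) (phi psi : R -> R),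
    [/\ is_interval D,
        {ae @leb R N, forall x, Omega x -> D (us x)},
        {in D &, {homo phi : s t / s <= t}},
        {in D &, {homo psi : s t /~ s <= t}} &
        {ae @leb R N, forall x, Omega x -> gs x = phi (us x)} /\
        {ae @leb R N, forall x, Omega x -> Vs x = psi (us x)}].
Proof.
move=> _ p1 _ [oO _ _ bO _] _ Hlam Rg RV lamE [[G wsol] upos] norm1.
have mO : measurable (Omega : set (RN R N)) by exact: measurable_open.
have Ooo : (leb R N Omega < +oo)%E by exact: lebesgue_outer_bounded.
have lam_min g V : rearrangements Omega g0 g -> rearrangements Omega V0 V ->
    lambda gs Vs <= lambda g V.
  (* The real [inf] is a lower bound only for a set that is bounded below; 0 bounds this one because
     all the eigenvalues are positive. *)
  move=> gR VR; rewrite lamE; apply: ge_inf; last by exists g => //; exists V.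
  by exists 0 => _ [g' g'R [V' V'R <-]]; have [[/ltW]] := Hlam _ _ g'R V'R.
have J g V w H : rearrangements Omega g0 g -> rearrangements Omega V0 V -> W0 Omega p w H ->
    (@leb R N).-integrable Omega (EFin \o (fun x => (V x - lambda g V * g x) * `|w x| `^ p)) ->
    0 <= \int[@leb R N]_(x in Omega) (enorm (H x) `^ p) +
         \int[@leb R N]_(x in Omega) ((V x - lambda g V * g x) * `|w x| `^ p).
  move=> gR VR wH; have [[_ [v [[K vsol] vpos]]] _] := Hlam _ _ gR VR.
  apply: (picone oO bO p1 _ (weak_solution_equation oO vsol) vpos wH).
  apply: measurable_funB; first exact: VR.1.
  by apply: measurable_funM; [exact: measurable_cst|exact: gR.1].
have mus : measurable_fun (Omega : set (RN R N)) us by have [[]] := wsol.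
have mg := Rg.1; have mV := RV.1.
have gu : \int[@leb R N]_(x in Omega) (gs x * `|us x| `^ p) = 1.
  rewrite -norm1; congr fine; apply: ae_eq_integral.
  - exact: mO.
  - apply/measurable_EFinP; apply: (measurable_funM mg); apply: measurable_powR_fun.
    exact: (measurableT_comp (@normr_measurable _ _) mus).
  - by apply/measurable_EFinP; apply: (measurable_funM mg); exact: measurable_powR_fun.
  - by apply: filterS upos => x ux Ox; rewrite /= gtr0_norm// ux.
have mI (P Q : set (RN R N)) : measurable (Omega `&` P : set (RN R N)) -> measurable (Omega `&` Q
    : set (RN R N)) ->
    measurable (Omega `&` P `&` Q : set (RN R N)).
  by move=> mP mQ; rewrite -(setIidl (@subIsetl _ Omega P)) -setIA; exact: measurableI.
have noncross (f : RN R N -> R) : measurable_fun (Omega : set (RN R N)) f ->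
    (forall A h, ~ monotone_exchange Omega us (fun x => f x - swapf A h f x) A h) ->
    forall s a b : R, a < b ->
    leb R N (Omega `&` [set x | s <= us x] `&` [set x | f x < a]) = 0%E \/
    leb R N (Omega `&` [set x | us x <= s] `&` [set x | b < f x]) = 0%E.
  move=> mf nex s a b ab.
  have mX := mI _ _ (measurable_level_ge mO s mus) (measurable_level_lt mO a mf).
  have mY := mI _ _ (measurable_level_le mO s mus) (measurable_level_gt mO b mf).
  have [X0|X0] := mu_gt0_or0 mX; first by left.
  have [Y0|Y0] := mu_gt0_or0 mY; first by right.
  have [A [h ex]] := exchange_exists mO Ooo mus mf upos ab X0 Y0.
  by case: (nex A h).
have nex_g A h : ~ monotone_exchange Omega us (fun x => gs x - swapf A h gs x) A h.
  move=> ex; have [[mA A0 AO] [AhO AhA] _ _ _] := ex.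
  have Rg' := rearrangements_swapf mO mA AO AhO AhA mg Rg.
  (* The exchange in g enters the weight multiplied by the new eigenvalue, so c is that eigenvalue
     and its positivity is required. *)
  have [[l0 _] _] := Hlam _ _ Rg' RV.
  apply: (optimal_no_exchange oO bO p1 mg mV wsol gu ex l0 (lam_min _ _ Rg' RV)) => w H wH.
  set l := lambda (swapf A h gs) Vs.
  rewrite (_ : (fun x => _) = (fun x => (Vs x - l * swapf A h gs x) * `|w x| `^ p)).
    exact: J.
  by apply/funext => x; ring.
(* V enters the weight with the sign opposite to g, so the exchange is set up for - Vs; E is then
   the swapped V minus the old one, and c = 1. *)
have nex_V A h : ~ monotone_exchange Omega us (fun x => - Vs x - swapf A h (fun y => - Vs y) x) A h.
  move=> ex; have [[mA A0 AO] [AhO AhA] _ _ _] := ex.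
  have RV' := rearrangements_swapf mO mA AO AhO AhA mV RV.
  apply: (optimal_no_exchange oO bO p1 mg mV wsol gu ex ltr01 (lam_min _ _ Rg RV')) => w H wH.
  set l := lambda gs (swapf A h Vs).
  rewrite (_ : (fun x => _) = (fun x => (swapf A h Vs x - l * gs x) * `|w x| `^ p)).
    exact: J.
  by apply/funext => x; rewrite swapfN; ring.
have mN : measurable_fun (Omega : set (RN R N)) (fun x => - Vs x).
  exact: (measurableT_comp (@oppr_measurable _ _) mV).
have [phi [phi_mono phiE]] := monotone_factor mO mus mg (noncross _ mg nex_g).
have [psi [psi_mono psiE]] := monotone_factor mO mus mN (noncross _ mN nex_V).
exists (range_levels Omega us), phi, (fun t => - psi t); split.
- exact: is_interval_range_levels.
- exact: ae_range_levels.
- exact: phi_mono.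
- by move=> s t Ds Dt st; rewrite lerN2; exact: psi_mono.
- split; first exact: phiE.
  by apply: filterS psiE => x /[apply] <-; rewrite opprK.
Qed.
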